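(* Let $0<s<1$, $p\ge 2$, $N\ge 2$ with $N>ps$, let $\Omega\subset\mathbb{R}^N$ be a bounded convex open set with $C^2$ boundary, and let $p-1<r<p_s^*-1$, where $p_s^*=\frac{Np}{N-ps}$. Assume the nonexistence assumption $(\mathcal{NA})$ stated in the context. Then there exists $\mu_0>0$ such that for every $\mu\in(0,\mu_0)$ the problem $$(-\Delta)_p^s u=\mu(u^r-1)\ \text{ in }\Omega,\qquad u>0\ \text{ in }\Omega,\qquad u=0\ \text{ on }\Omega^c=\mathbb{R}^N\setminus\Omega$$ admits a positive (weak) solution $u$.
   Context: The fractional $p$-Laplacian is $(-\Delta)_p^s u(x)=2\,\mathrm{P.V.}\int_{\mathbb{R}^N}\frac{|u(x)-u(y)|^{p-2}(u(x)-u(y))}{|x-y|^{N+sp}}\,dy$. Function spaces: $W_0^{s,p}(\Omega)=\{u\in W^{s,p}(\mathbb{R}^N): u=0 \text{ in }\mathbb{R}^N\setminus\Omega\}$, and $L^{p-1}_{sp}(\mathbb{R}^N)=\{u\in L^{p-1}_{loc}(\mathbb{R}^N):\int_{\mathbb{R}^N}\frac{|u(x)|^{p-1}}{(1+|x|)^{N+sp}}dx<\infty\}$. Weak solution of $(-\Delta)_p^su=h(x,u)$ in $\Omega$, $u=0$ on $\Omega^c$: $u\in W_0^{s,p}(\Omega)$ with $\int_{\mathbb{R}^N\times\mathbb{R}^N}\frac{|u(x)-u(y)|^{p-2}(u(x)-u(y))(\varphi(x)-\varphi(y))}{|x-y|^{N+sp}}dx\,dy=\int_\Omega h(x,u)\varphi\,dx$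 for all $\varphi\in W_0^{s,p}(\Omega)$. Viscosity solution (for $p>\frac{2}{2-s}$, which holds when $p\ge2$) of $(-\Delta)_p^s u=h(x,u)$ in an open set $D$ with $u=0$ on $\mathbb{R}^N\setminus D$: $u$ is a viscosity supersolution (resp. subsolution) if (i) $u<+\infty$ (resp. $u>-\infty$) a.e. in $\mathbb{R}^N$ and $u>-\infty$ (resp. $u<+\infty$) a.e. in $D$; (ii) $u$ is lower (resp. upper) semicontinuous in $D$; (iii) whenever $B(x_0,\rho)\subset D$ and $\phi\in C^2(B(x_0,\rho))\cap L^{p-1}_{sp}(\mathbb{R}^N)$ satisfies $\phi(x_0)=u(x_0)$, $\phi\le u$ (resp. $\phi\ge u$) in $B(x_0,\rho)$ and $\phi=u$ in $\mathbb{R}^N\setminus B(x_0,\rho)$, then $(-\Delta)_p^s\phi(x_0)\ge h(x_0,\phi(x_0))$ (resp. $\le$); (iv) $u_-=\max\{-u,0\}$ (resp. $u_+=\max\{u,0\}$) belongs to $L^{p-1}_{sp}(\mathbb{R}^N)$. A viscosity solution is both a sub- and a supersolution, with $u=0$ on $\mathbb{R}^N\setminus D$. Nonexistence assumption $(\mathcal{NA})$: for $p-1<q<p_s^*-1$ and $\mathcal{H}$ equal either to $\mathbb{R}^N$ or to a half-space in $\mathbb{R}^N$, the problem $(-\Delta)_p^su=u^q$ in $\mathcal{H}$, $u>0$ in $\mathcal{H}$, $u=0$ on $\mathbb{R}^N\setminus\mathcal{H}$ admits no nontrivial viscosity solution in $C^\alpha(\mathcal{H})$ ($\alpha\in(0,1)$).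 *)

(* Defs.v *)
From HB Require Import structures.
From mathcomp Require Import all_boot all_order all_algebra.
From mathcomp Require Import all_classical all_reals all_analysis.
From mathcomp Require Import measurable_realfun.

Set Implicit Arguments.
Unset Strict Implicit.
Unset Printing Implicit Defensive.
Import Order.TTheory GRing.Theory Num.Theory.
Import numFieldNormedType.Exports.

Local Open Scope classical_set_scope.
Local Open Scope ring_scope.

(* R^n is 'rV[R]_n, with the sigma-algebra generated by the coordinates
   (for R : realType, the Borel sets of R^n). *)
Definition rV_display : measure_display -> measure_display.
Proof. exact. Qed.

Section rV_measurable.
Context {d : measure_display} {T : sigmaRingType d} (n : nat).

Let coord : 'I_n -> 'rV[T]_n -> T := fun i v => v ord0 i.

Let rV_set0 : g_sigma_preimage coord set0.
Proof. exact: sigma_algebra0. Qed.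

Let rV_setC A : g_sigma_preimage coord A -> g_sigma_preimage coord (~` A).
Proof. exact: sigma_algebraC. Qed.

Let rV_bigcup (F : _^nat) : (forall i, g_sigma_preimage coord (F i)) ->
  g_sigma_preimage coord (\bigcup_i (F i)).
Proof. exact: sigma_algebra_bigcup. Qed.

HB.instance Definition _ := @isMeasurable.Build (rV_display d)
  'rV[T]_n (g_sigma_preimage coord) rV_set0 rV_setC rV_bigcup.

End rV_measurable.

Section rV_measurable_fun.
Context d1 d2 (T1 : measurableType d1) (T2 : measurableType d2).

Lemma measurable_rV_coord n (i : 'I_n) :
  measurable_fun [set: 'rV[T2]_n] (fun v : 'rV[T2]_n => v ord0 i).
Proof.
move=> _ Y mY; rewrite setTI; apply: sub_sigma_algebra => /=.
rewrite -bigcup_seq/=; exists i => /=; first by rewrite mem_index_enum.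
by exists Y => //; rewrite setTI.
Qed.

Lemma measurable_rV n (f : T1 -> 'rV[T2]_n) :
  (forall i, measurable_fun [set: T1] (fun x => f x ord0 i)) ->
  measurable_fun [set: T1] f.
Proof.
move=> mf _ A mA; rewrite setTI.
have : image_set_system setT f measurable A; last first.
  by rewrite /image_set_system /= setTI.
have sI : sigma_algebra setT (image_set_system setT f measurable).
  exact/sigma_algebra_image/sigma_algebra_measurable.
move: A mA; apply: smallest_sub => //.
rewrite -bigcup_seq; apply: bigcup_sub => i _ _ [B mB <-] /=.
by rewrite /image_set_system /= !setTI -[X in measurable X]setTI; exact: mf.
Qed.

End rV_measurable_fun.

Section lebesgue_rV.
Context {R : realType}.

Let consr n (z : R * 'rV[R]_n) : 'rV[R]_n.+1 :=
  \row_i oapp (z.2 ord0) z.1 (unlift ord0 i).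

Let uncons n (v : 'rV[R]_n.+1) : R * 'rV[R]_n :=
  (v ord0 ord0, \row_j v ord0 (lift ord0 j)).

Let consrK n : cancel (@consr n) (@uncons n).
Proof.
move=> [x v]; rewrite /uncons mxE unlift_none; congr pair.
by apply/rowP => j; rewrite !mxE liftK.
Qed.

Let measurable_consr n : measurable_fun setT (@consr n).
Proof.
apply: measurable_rV => i; under eq_fun do rewrite mxE.
case: (unliftP ord0 i) => [j _|_] /=; last exact: measurable_fst.
exact: (measurableT_comp (@measurable_rV_coord _ _ _ j)).
Qed.

Let measurable_uncons n : measurable_fun setT (@uncons n).
Proof.
apply: measurable_fun_pair; first exact: measurable_rV_coord.
apply: measurable_rV => i /=; under eq_fun do rewrite mxE.
exact: measurable_rV_coord.
Qed.

Section step.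
Variables (n : nat) (m : {sigma_finite_measure set 'rV[R]_n -> \bar R}).

Definition lebesgue_rVS : set 'rV[R]_n.+1 -> \bar R :=
  pushforward (@lebesgue_measure R \x m)%E (@consr n).

Let lebesgue_rVS0 : lebesgue_rVS set0 = 0%E.
Proof. by rewrite /lebesgue_rVS /pushforward preimage_set0 measure0. Qed.

Let lebesgue_rVS_ge0 A : (0 <= lebesgue_rVS A)%E.
Proof. by rewrite /lebesgue_rVS /pushforward; exact: measure_ge0. Qed.

Let lebesgue_rVS_additive : semi_sigma_additive lebesgue_rVS.
Proof. exact: (@measure_semi_sigma_additive _ _ _
  (measure_function_pushforward__canonical__measure_function_Measure
   (@lebesgue_measure R \x m)%E (@measurable_consr n))). Qed.

HB.instance Definition _ := isMeasure.Build _ _ _ lebesgue_rVS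
  lebesgue_rVS0 lebesgue_rVS_ge0 lebesgue_rVS_additive.

Let lebesgue_rVS_sigma_finite : sigma_finite setT lebesgue_rVS.
Proof.
have /sigma_finiteP[F [TF ndF Foo]] := sigma_finiteT (@lebesgue_measure R).
have /sigma_finiteP[G [TG ndG Goo]] := sigma_finiteT m.
exists (fun k => @uncons n @^-1` (F k `*` G k)).
  rewrite -preimage_bigcup; apply/esym/seteqP; split => // v _.
  have [i _ Fi] : (\bigcup_i F i) (@uncons n v).1 by rewrite -TF.
  have [j _ Gj] : (\bigcup_i G i) (@uncons n v).2 by rewrite -TG.
  exists (maxn i j) => //; split.
  - by move: Fi; apply/subsetPset/ndF/leq_maxl.
  - by move: Gj; apply/subsetPset/ndG/leq_maxr.
move=> k; have [mF Fk] := Foo k; have [mG Gk] := Goo k.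
have mFG : measurable (F k `*` G k) by exact: measurableX.
split.
  by rewrite -[X in measurable X]setTI; exact: measurable_uncons.
rewrite /lebesgue_rVS /pushforward -comp_preimage.
rewrite (_ : _ \o _ = id); last by apply/funext => z; exact: consrK.
rewrite preimage_id product_measure1E// lte_mul_pinfty//.
by rewrite ge0_fin_numE.
Qed.

HB.instance Definition _ := Measure_isSigmaFinite.Build _ _ _ lebesgue_rVS
  lebesgue_rVS_sigma_finite.

End step.

Fixpoint lebesgue_rV n : {sigma_finite_measure set 'rV[R]_n -> \bar R} :=
  match n with
  | 0%N => \d_(0 : 'rV[R]_0)
  | n'.+1 => lebesgue_rVS (lebesgue_rV n')
  end.

Lemma lebesgue_rV_box n (A : 'I_n -> set R) :
  (forall i, measurable (A i)) ->
  lebesgue_rV n [set v : 'rV[R]_n | forall i, A i (v ord0 i)] =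
  (\prod_(i < n) lebesgue_measure (A i))%E.
Proof.
elim: n A => [|n IH] A mA /=.
  by rewrite big_ord0 diracE mem_set// => -[].
rewrite /lebesgue_rVS /pushforward big_ord_recl -(IH (fun i => A (lift ord0 i)))//.
pose B := [set v : 'rV[R]_n | forall i, A (lift ord0 i) (v ord0 i)].
have mB : measurable B.
  rewrite (_ : B = \bigcap_(i in [set: 'I_n])
      ((fun v : 'rV[R]_n => v ord0 i) @^-1` A (lift ord0 i))).
    apply: fin_bigcap_measurable; first exact: finite_finset.
    move=> i _; rewrite -[X in measurable X]setTI.
    exact: measurable_rV_coord.
  by apply/seteqP; split => v Bv i => [_|]; exact: Bv.
transitivity ((@lebesgue_measure R \x lebesgue_rV n)%E (A ord0 `*` B)); last first.
  by rewrite (product_measure1E (@lebesgue_measure R) (lebesgue_rV n) (mA ord0) mB).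
congr (_ _); apply/seteqP; split => -[x v] /=.
  move=> Av; split => [|i].
    by have := Av ord0; rewrite mxE unlift_none.
  by have := Av (lift ord0 i); rewrite mxE liftK.
by move=> [Ax Bv] i; rewrite mxE; case: (unliftP ord0 i) => [j|] -> //=; exact: Bv.
Qed.

End lebesgue_rV.

(* The norm of the library on 'rV[R]_n is the sup norm. *)
Section euclidean.
Context {R : realType} {n : nat}.
Implicit Types x y : 'rV[R]_n.

Definition dotv x y : R := \sum_(i < n) x ord0 i * y ord0 i.

Definition enorm x : R := Num.sqrt (dotv x x).

Definition eball x (r : R) : set 'rV[R]_n := [set y | enorm (x - y) < r].

Definition half_space (H : set 'rV[R]_n) : Prop :=
  exists a : 'rV[R]_n, a != 0 /\ exists b : R, H = [set x | b < dotv a x].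

End euclidean.

Section regularity.
Context {R : realType} {n : nat}.

(* Meant for U open: f is of class C^k on U, i.e. its partial derivatives of order at
   most k exist and are continuous on U. *)
Fixpoint Ck (k : nat) (U : set 'rV[R]_n) (f : 'rV[R]_n -> R) : Prop :=
  (forall x, U x -> {for x, continuous f}) /\
  if k is k'.+1 then
    forall i : 'I_n, (forall x, U x -> derivable f x (delta_mx ord0 i)) /\
      Ck k' U ('D_(delta_mx ord0 i) f)
  else True.

(* Finiteness of the full C^alpha norm, i.e. of the sup norm on U and of the
   alpha-Hoelder seminorm on U. *)
Definition hoelder_on (alpha : R) (U : set 'rV[R]_n) (f : 'rV[R]_n -> R) :=
  [bounded f x | x in U] /\
  exists C : R, forall x y, U x -> U y ->
    `|f x - f y| <= C * enorm (x - y) `^ alpha.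

End regularity.

(* In suitable orthonormal coordinates Omega is, near each point of its
   boundary, the strict epigraph of a C^2 function of the other n - 1
   coordinates. *)
Definition C2_boundary (R : realType) (n : nat) (Omega : set 'rV[R]_n) : Prop :=
  forall x0, (closure Omega `\` Omega°) x0 ->
  exists (Q : 'M[R]_n) (i : 'I_n) (g : 'rV[R]_n.-1 -> R) (rho : R),
    [/\ Q *m Q^T = 1%:M, Ck 2 setT g, 0 < rho &
        forall x, eball x0 rho x ->
          (Omega x <-> g (col' i (x *m Q)) < (x *m Q) ord0 i)].

Section fractional_p_laplacian.
Context {R : realType} {N : nat}.
Variables s p : R.

Local Notation E := 'rV[R]_N.
Local Notation leb := (@lebesgue_rV R N).
Implicit Types (u phi : E -> \bar R) (v w : E -> R) (D Omega : set E).

Definition kernel_sp (x y : E) : R := (enorm (x - y) `^ (N%:R + s * p))^-1.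

(* Viscosity sub- and supersolutions take values in \bar R. *)
Definition frac_plap u (x : E) : \bar R :=
  (2%:E * lim ((\int[leb]_(y in ~` eball x eps)
     (poweR `|u x - u y| (p - 2) * (u x - u y) * (kernel_sp x y)%:E))
   @[eps --> 0^'+]))%E.

Definition Lp1_sp u : Prop :=
  [/\ measurable_fun [set: E] u,
      forall K : set E, compact K ->
        (\int[leb]_(x in K) poweR `|u x| (p - 1) < +oo)%E &
      (\int[leb]_x (poweR `|u x| (p - 1) *
         ((1 + enorm x) `^ (N%:R + s * p))^-1%:E) < +oo)%E].

Definition Wsp v : Prop :=
  v \in Lfun leb p%:E /\
  (\int[leb \x leb]_z
     (`|v z.1 - v z.2| `^ p * kernel_sp z.1 z.2)%:E < +oo)%E.

Definition Wsp0 Omega v : Prop :=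
  Wsp v /\ {ae leb, forall x, ~ Omega x -> v x = 0}.

Definition weak_solution (h : E -> R -> R) Omega v : Prop :=
  Wsp0 Omega v /\
  forall w, Wsp0 Omega w ->
    leb.-integrable Omega (fun x => (h x (v x) * w x)%:E) /\
    (\int[leb \x leb]_z
       (`|v z.1 - v z.2| `^ (p - 2) * (v z.1 - v z.2) * (w z.1 - w z.2)
        * kernel_sp z.1 z.2)%:E
     = \int[leb]_(x in Omega) (h x (v x) * w x)%:E)%E.

Definition test_function (x0 : E) (rho : R) u phi : Prop :=
  [/\ forall x, eball x0 rho x -> phi x \is a fin_num,
      Ck 2 (eball x0 rho) (fine \o phi),
      Lp1_sp phi,
      phi x0 = u x0 &
      forall x, ~ eball x0 rho x -> phi x = u x].

Definition viscosity_supersolution (h : E -> R -> R) D u : Prop :=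
  [/\ {ae leb, forall x, (u x < +oo)%E} /\
        {ae leb, forall x, D x -> (-oo < u x)%E},
      @lower_semicontinuous (subspace D) R u,
      forall x0 rho phi, 0 < rho -> eball x0 rho `<=` D ->
        test_function x0 rho u phi ->
        (forall x, eball x0 rho x -> (phi x <= u x)%E) ->
        ((h x0 (fine (phi x0)))%:E <= frac_plap phi x0)%E &
      Lp1_sp (fun x => maxe (- u x) 0)%E].

Definition viscosity_subsolution (h : E -> R -> R) D u : Prop :=
  [/\ {ae leb, forall x, (-oo < u x)%E} /\
        {ae leb, forall x, D x -> (u x < +oo)%E},
      @lower_semicontinuous (subspace D) R (fun x => - u x)%E,
      forall x0 rho phi, 0 < rho -> eball x0 rho `<=` D ->
        test_function x0 rho u phi ->
        (forall x, eball x0 rho x -> (u x <= phi x)%E) ->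
        (frac_plap phi x0 <= (h x0 (fine (phi x0)))%:E)%E &
      Lp1_sp (fun x => maxe (u x) 0)%E].

Definition viscosity_solution (h : E -> R -> R) D u : Prop :=
  [/\ viscosity_supersolution h D u, viscosity_subsolution h D u &
      forall x, ~ D x -> u x = 0%E].

Definition crit_exp : R := N%:R * p / (N%:R - p * s).

(* Such a v is never trivial: it is positive on the nonempty set H. *)
Definition nonexistence : Prop :=
  forall (q : R) (H : set E) (alpha : R),
    p - 1 < q < crit_exp - 1 -> H = setT \/ half_space H -> 0 < alpha < 1 ->
  ~ exists v : E -> R,
      [/\ viscosity_solution (fun _ t => t `^ q) H (EFin \o v),
          forall x, H x -> 0 < v x & hoelder_on alpha H v].

End fractional_p_laplacian.

Arguments nonexistence {R} N s p.
Arguments crit_exp {R} N s p.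

(* Main.v *)
(* Writing u = lam * w with lam^(p-1) = mu * lam^r turns the problem into
   L w = w^r - eps, where eps = mu^(r/(r-p+1)) is small when mu is. For small eps >= 0
   a solution is found by minimising over u >= 0 the mountain-pass level
     max_(t >= 0) of  [u]^p t^p / p + eps t \int u - (\int u^(r+1)) t^(r+1) / (r+1),
   with [u] the Gagliardo seminorm. The kernel enters only through three properties:
   - \int_(y notin E) k(x, y) dy >= c |E|^(-ps/N) for x in E; level by level this gives
     a weak type bound at the critical exponent, hence the subcritical embeddings;
   - Omega is covered by finitely many cells Q on which k(x, y) |Q| is arbitrarily
     large; this gives compactness;
   - k is bounded below on Omega x Omega.
   The minimiser w has a level set {w > m} whose measure is bounded below uniformly
   in eps. If w vanished on a set of positive measure, raising w to tau b there, for a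
   bump b, would gain at least a constant times tau in [w]^p by the lower bound on k,
   while costing tau^p [b]^p + O(eps tau); so w > 0 almost everywhere on Omega for eps
   small. Hence two-sided variations are allowed and w solves the equation. *)
Require Import Defs.
From HB Require Import structures.
From mathcomp Require Import all_boot all_order all_algebra.
From mathcomp Require Import all_classical all_reals all_analysis.
From mathcomp Require Import measurable_realfun.
From mathcomp Require Import ring lra.

Set Implicit Arguments.
Unset Strict Implicit.
Unset Printing Implicit Defensive.
Import Order.TTheory GRing.Theory Num.Theory.
Import numFieldNormedType.Exports.

Local Open Scope classical_set_scope.
Local Open Scope ring_scope.

(** * Powers and the one-dimensional energy *)

(** The right-hand side is negative where the solution is small, so no maximum principle yields
    positivity; and the linear term, being the mass of |u|, is differentiable along a line only
    where u does not vanish. Positivity almost everywhere therefore has to precede the equation, and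
    it is drawn from minimality alone. The point is that the gain and the linear cost of raising [w]
    to [tau * b] are, to first order in [tau], multiples of one and the same number, the integral of
    [b] over the zero set of [w]. The threshold on [eps] thus depends neither on the zero set nor on
    [b].

    The level is minimised, and not the energy under a constraint, because the terms have the three
    homogeneities p, 1 and r + 1: a constraint would leave a multiplier whose removal by scaling
    changes [eps]. The maximum over t is never differentiated. Maximisers [t n] of functions [v_ n]
    close to [w] tend to 1, and the energies of [w] and [v_ n] are compared at the same [t n]. *)

Section power_functions.
Context {R : realType}.
Implicit Types a b e l s t x y P : R.

Lemma continuous_norm_powR e : 0 <= e -> continuous (fun x : R => `|x| `^ e).
Proof.
rewrite le_eqVlt => /predU1P[<-|e0] x.
  rewrite (_ : (fun x => _) = cst 1); first exact: cvg_cst.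
  by apply/funext => z; rewrite powRr0.
have [->|x0] := eqVneq x 0.
  rewrite /continuous_at normr0 powR0 ?gt_eqF//.
  apply/cvgrPdist_lt => d d0; near=> z.
  rewrite sub0r normrN ger0_norm ?powR_ge0//.
  have -> : d = (d `^ e^-1) `^ e by rewrite -powRrM mulVf ?gt_eqF// powRr1// ltW.
  apply: gt0_ltr_powR; rewrite ?nnegrE ?powR_ge0//.
  near: z; apply: (@nbhs0_lt R R); exact: powR_gt0.
apply: (@continuous_comp _ _ _ (fun x : R => `|x|) (fun x => x `^ e)).
  exact: norm_continuous.
apply: differentiable_continuous; apply/derivable1_diffP/derivable_powR.
by rewrite in_itv/= andbT normr_gt0.
Unshelve. all: by end_near. Qed.

Lemma cvg_norm_powR e (u : nat -> R) l : 0 <= e ->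
  u @ \oo --> l -> (fun n => `|u n| `^ e) @ \oo --> `|l| `^ e.
Proof.
move=> e0 ul; apply: (@continuous_cvg _ _ _ _ _ u (fun x : R => `|x| `^ e)) => //.
exact: continuous_norm_powR.
Qed.

Lemma cvg_powR e (u : nat -> R) l : 0 <= e -> (forall n, 0 <= u n) -> 0 <= l ->
  u @ \oo --> l -> (fun n => u n `^ e) @ \oo --> l `^ e.
Proof.
move=> e0 u0 l0.
rewrite -[in l `^ e](ger0_norm l0).
rewrite (_ : (fun n => u n `^ e) = (fun x : R => `|x| `^ e) \o u).
  by move=> ul; apply: continuous_cvg => //; exact: continuous_norm_powR.
by apply/funext => n /=; rewrite ger0_norm.
Qed.

Lemma continuous_norm_powRM e : 0 <= e ->
  continuous (fun x : R => `|x| `^ e * x).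
Proof.
move=> e0 x; apply: cvgM; [exact: continuous_norm_powR|exact: cvg_id].
Qed.

Lemma powRS x P : 0 <= x -> 1 <= P -> x `^ P = x * x `^ (P - 1).
Proof. by move=> x0 P1; rewrite mulr_powRB1// (lt_le_trans ltr01). Qed.

Lemma norm_powRB2 x P : 2 <= P -> `|x| `^ (P - 2) * `|x| = `|x| `^ (P - 1).
Proof.
move=> P2; rewrite mulrC (_ : P - 2 = P - 1 - 1); last by ring.
by rewrite -powRS//; lra.
Qed.

(* Young's inequality: [(y ^ a - 1) / a] is nondecreasing in [a]. *)
Lemma powR_quotient_le a b y : 0 < a -> a <= b -> 0 <= y ->
  (y `^ a - 1) / a <= (y `^ b - 1) / b.
Proof.
move=> a0; rewrite le_eqVlt => /predU1P[->//|ab] y0.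
have b0 : 0 < b by exact: lt_trans ab.
have P1 : 1 < b / a by rewrite ltr_pdivlMr// mul1r.
have ba0 : 0 < b - a by rewrite subr_gt0.
have := @conjugate_powR _ (y `^ a) 1 (b / a) (b / (b - a)) (powR_ge0 _ _) ler01
  (divr_gt0 b0 a0) (divr_gt0 b0 ba0).
have [an0 bn0] : a != 0 /\ b != 0 by rewrite !gt_eqF.
rewrite mulr1 powR1 -powRrM (mulrC a) divfK// !invf_div -mulrDl addrC subrK.
rewrite divff// => /(_ erefl); rewrite -(ler_pM2r b0) mulrDl => H.
have {}H : y `^ a * b <= y `^ b * a + (b - a).
  by apply: le_trans H _; rewrite mul1r divfK// -mulrA divfK.
by rewrite ler_pdivrMr// mulrAC ler_pdivlMr// !mulrBl !mul1r; lra.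
Qed.

(** Convexity of |x|^P in tangent form. It comes from Young's inequality for |y|^(P - 1) and |x|
    with the conjugate exponents [P / (P - 1)] and [P], so nothing is differentiated. *)
Lemma powR_tangent x y P : 2 <= P ->
  `|y| `^ P + P * (`|y| `^ (P - 2) * y) * (x - y) <= `|x| `^ P.
Proof.
move=> P2; have P0 : 0 < P by lra.
have Q0 : 0 < P - 1 by lra.
have H := @conjugate_powR _ (`|y| `^ (P - 1)) `|x| (P / (P - 1)) P (powR_ge0 _ _)
  (normr_ge0 _) (divr_gt0 P0 Q0) P0.
have {}H : P * (`|y| `^ (P - 1) * `|x|) <= (P - 1) * `|y| `^ P + `|x| `^ P.
  have [Pn Qn] : P != 0 /\ P - 1 != 0 by rewrite !gt_eqF.
  move: H; rewrite -powRrM mulrCA divff// mulr1 invf_div -{2}[P^-1]div1r -mulrDl.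
  rewrite subrK divff// => /(_ erefl); rewrite -(ler_pM2l P0) mulrDr => H.
  apply: le_trans H _; rewrite le_eqVlt; apply/orP; left; apply/eqP.
  by field.
have yx : `|y| `^ (P - 2) * y * x <= `|y| `^ (P - 1) * `|x|.
  apply: le_trans (ler_norm _) _.
  by rewrite !normrM (ger0_norm (powR_ge0 _ _)) norm_powRB2.
have yy : `|y| `^ (P - 2) * y * y = `|y| `^ P.
  rewrite -mulrA -expr2 -real_normK ?num_real// expr2 mulrA norm_powRB2//.
  by rewrite mulrC -powRS//; lra.
rewrite -mulrA mulrBr yy; nra.
Qed.

(** The tangent inequality is used once at [a] and once at [a + s * b]. The resulting enclosure
    serves twice: it identifies the limit of the quotient as [s] tends to 0, and it bounds the
    quotient for dominated convergence. *)
Lemma powR_diff_quotient_itv P a b s : 2 <= P -> 0 < s ->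
  P * (`|a| `^ (P - 2) * a) * b <= (`|a + s * b| `^ P - `|a| `^ P) / s
    <= P * (`|a + s * b| `^ (P - 2) * (a + s * b)) * b.
Proof.
move=> P2 s0; have := powR_tangent (a + s * b) a P2.
have := powR_tangent a (a + s * b) P2.
rewrite (_ : a - (a + s * b) = - (b * s)); last by ring.
rewrite (_ : a + s * b - a = b * s); last by ring.
rewrite ler_pdivrMr// ler_pdivlMr// !mulrA => H1 H2; apply/andP; split; lra.
Qed.

Lemma norm_powR_ltD P a b : 0 <= P -> `|a + b| `^ P <= (`|a| + `|b|) `^ P.
Proof.
by move=> P0; rewrite ge0_ler_powR ?nnegrE ?addr_ge0 ?ler_normD.
Qed.

Lemma powR_diff_quotient_le P a b s : 2 <= P -> 0 < s <= 1 ->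
  `|(`|a + s * b| `^ P - `|a| `^ P) / s| <= P * (`|a| + `|b|) `^ P.
Proof.
move=> P2 /andP[s0 s1]; have [P0 P1] : 0 <= P /\ 0 <= P - 1 by split; lra.
have /andP[H1 H2] := powR_diff_quotient_itv a b P2 s0.
have D x : `|x| <= `|a| + `|b| ->
    `|P * (`|x| `^ (P - 2) * x) * b| <= P * (`|a| + `|b|) `^ P.
  move=> xab; rewrite !normrM (ger0_norm P0) (ger0_norm (powR_ge0 _ _)).
  rewrite norm_powRB2// -mulrA ler_wpM2l//.
  rewrite [leRHS]powRS ?addr_ge0//; last lra.
  rewrite mulrC ler_pM ?powR_ge0 ?lerDr//.
  by apply: ge0_ler_powR => //; rewrite nnegrE addr_ge0.
have Da : `|P * (`|a| `^ (P - 2) * a) * b| <= P * (`|a| + `|b|) `^ P.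
  by apply: D; rewrite lerDl.
have Db : `|P * (`|a + s * b| `^ (P - 2) * (a + s * b)) * b| <= P * (`|a| + `|b|) `^ P.
  apply: D; apply: le_trans (ler_normD _ _) _; rewrite lerD2l normrM gtr0_norm//.
  by rewrite ler_piMl.
move: Da Db; rewrite !ler_norml => /andP[? ?] /andP[? ?]; apply/andP; split; lra.
Qed.

Lemma cvg_powR_diff_quotient P a b (s : nat -> R) : 2 <= P ->
  (forall n, 0 < s n) -> s @ \oo --> 0 ->
  (fun n => (`|a + s n * b| `^ P - `|a| `^ P) / s n) @ \oo -->
    P * (`|a| `^ (P - 2) * a) * b.
Proof.
move=> P2 s0 sl.
apply: (@squeeze_cvgr _ _ _ _ (cst (P * (`|a| `^ (P - 2) * a) * b))
  (fun n => P * (`|a + s n * b| `^ (P - 2) * (a + s n * b)) * b)).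
- by apply: nearW => n; exact: powR_diff_quotient_itv.
- exact: cvg_cst.
- apply: cvgM; last exact: cvg_cst.
  apply: cvgM; first exact: cvg_cst.
  apply: (@continuous_cvg _ _ _ _ _ _ (fun x : R => `|x| `^ (P - 2) * x)).
    by apply: continuous_norm_powRM; lra.
  rewrite -[X in _ --> X]addr0; apply: cvgD; first exact: cvg_cst.
  by rewrite -[X in _ --> X](mul0r b); apply: cvgM => //; exact: cvg_cst.
Qed.

Lemma powR_le1 e x : 0 <= e -> 0 <= x <= 1 -> x `^ e <= 1.
Proof.
move=> e0 /andP[x0 x1]; rewrite (_ : 1 = 1 `^ e); last by rewrite powR1.
by apply: ge0_ler_powR; rewrite ?nnegrE.
Qed.

Lemma powR_ge1 e x : 0 <= e -> 1 <= x -> 1 <= x `^ e.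
Proof.
move=> e0 x1; rewrite -[leLHS](powRr0 x).
by apply: ler_powR.
Qed.

Lemma powRD_le P x y : 0 <= P -> 0 <= x -> 0 <= y ->
  (x + y) `^ P <= 2 `^ P * (x `^ P + y `^ P).
Proof.
move=> P0 x0 y0; wlog xy : x y x0 y0 / x <= y.
  move=> H; have [xy|/ltW yx] := leP x y; first exact: H.
  by rewrite addrC (addrC (x `^ P)); exact: H.
apply: (@le_trans _ _ ((2 * y) `^ P)).
  by rewrite ge0_ler_powR ?nnegrE ?addr_ge0 ?mulr_ge0//; lra.
by rewrite powRM// ler_wpM2l ?powR_ge0// lerDr powR_ge0.
Qed.

End power_functions.

(* [nehari A B C] is the energy of [t * u] when [A], [B], [C] stand for the
   p-energy, the mass and the (r + 1)-mass of [u]. *)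
Section nehari.
Context {R : realType} (p r eps : R).
Hypotheses (p2 : 2 <= p) (pr : p - 1 < r) (eps0 : 0 <= eps).
Implicit Types A B C t x : R.

Definition nehari A B C t : R :=
  A / p * t `^ p + eps * B * t - C / (r + 1) * t `^ (r + 1).

(** Vanishing of the [t]-derivative of [nehari A B C]; at [t = 1] it is the Nehari identity of [u]
    itself. *)
Definition nehari_crit A B C t : Prop :=
  A * t `^ (p - 1) + eps * B = C * t `^ r.

Ltac slra := move: p2 pr eps0; lra.
Ltac snra := move: p2 pr eps0; nra.

Let p0 : 0 < p. Proof. slra. Qed.

Let pm1 : 0 <= p - 1. Proof. slra. Qed.
Local Hint Resolve pm1 : core.

Let powR_split t : 0 < t -> t `^ r = t `^ (r - (p - 1)) * t `^ (p - 1).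
Proof. by move=> t0; rewrite -powRD ?subrK// (gt_eqF t0) implybT. Qed.

(** With [y = x / t], criticality replaces C t^(r + 1) by A t^p + eps B t. The difference of the two
    values then splits into a multiple of A t^p and a multiple of eps B t, and [powR_quotient_le]
    makes both nonpositive, comparing the exponents p and 1 with r + 1. So every critical point is a
    global maximum. *)
Lemma nehari_max A B C t x : 0 <= A -> 0 <= B -> 0 < t -> 0 <= x ->
  nehari_crit A B C t -> nehari A B C x <= nehari A B C t.
Proof.
move=> A0 B0 t0 x0 crit; pose y := x / t.
have y0 : 0 <= y by rewrite divr_ge0// ltW.
have xE : x = y * t by rewrite divfK ?gt_eqF.
clearbody y.
have tp : t `^ p = t * t `^ (p - 1) by rewrite powRS ?ltW//; slra.
have tr : t `^ (r + 1) = t * t `^ r.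
  by rewrite powRS ?ltW//; [rewrite addrK|slra].
have pr1 : p <= r + 1 by slra.
have H1 := powR_quotient_le p0 pr1 y0.
have H2 : y `^ 1 - 1 <= (y `^ (r + 1) - 1) / (r + 1).
  by rewrite -[leLHS]divr1; apply: powR_quotient_le => //; slra.
rewrite powRr1// in H2.
have K1 : 0 <= A * t `^ p by rewrite mulr_ge0// powR_ge0.
have K2 : 0 <= eps * B * t by rewrite !mulr_ge0// ltW.
have K : C * t `^ (r + 1) = A * t `^ p + eps * B * t.
  by rewrite tr tp mulrCA -crit; ring.
rewrite -subr_le0 /nehari xE !powRM ?(ltW t0)//.
rewrite [X in X <= 0](_ : _ = A * t `^ p * ((y `^ p - 1) / p) +
  eps * B * t * (y - 1) - C * t `^ (r + 1) * ((y `^ (r + 1) - 1) / (r + 1))); last by ring.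
rewrite K; snra.
Qed.

(** With [e = r - (p - 1)], the defect is t^(p - 1) (C t^e - A) - eps B. The bracket vanishes at
    [t0], and at [t1], where [t1 >= 1], it is at least eps B; the intermediate value theorem gives a
    zero in between. *)
Lemma nehari_crit_exists A B C : 0 < A -> 0 <= B -> 0 < C ->
  exists2 t, 0 < t & nehari_crit A B C t.
Proof.
move=> A0 B0 C0; set e := r - (p - 1); have e0 : 0 < e by rewrite /e; slra.
pose g t := C * `|t| `^ r - A * `|t| `^ (p - 1) - eps * B.
have gc : continuous g.
  move=> x; apply: cvgB; last exact: cvg_cst.
  by apply: cvgB; (apply: cvgM; first exact: cvg_cst); apply: continuous_norm_powR; slra.
have eB0 : 0 <= eps * B by rewrite mulr_ge0.
pose t0 := (A / C) `^ e^-1.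
have AC0 : 0 < A / C by rewrite divr_gt0.
have t00 : 0 < t0 by rewrite powR_gt0.
have split_r t : 0 < t -> t `^ r = t `^ e * t `^ (p - 1).
  exact: powR_split.
have powe z : 0 <= z -> (z `^ e^-1) `^ e = z.
  by move=> z0; rewrite -powRrM mulVf ?gt_eqF// powRr1.
have gt0_le : g t0 <= 0.
  rewrite /g gtr0_norm// split_r// powe ?(ltW AC0)// mulrA mulrCA divff ?gt_eqF//.
  by rewrite mulr1 subrr sub0r oppr_le0.
pose z := Num.max 1 ((A + eps * B) / C).
have z1 : 1 <= z by rewrite le_max lexx.
pose t1 := z `^ e^-1.
have z0 : 0 < z by rewrite (lt_le_trans ltr01).
have t11 : 1 <= t1.
  by rewrite powR_ge1// invr_ge0 ltW.
have g1 : 0 <= g t1.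
  have t10 : 0 < t1 by rewrite (lt_le_trans ltr01).
  rewrite /g gtr0_norm// split_r// powe ?(ltW z0)//.
  have hz : A + eps * B <= C * z.
    by rewrite -ler_pdivrMl// mulrC le_max lexx orbT.
  have ht : 1 <= t1 `^ (p - 1).
    exact: powR_ge1.
  rewrite mulrA -addrA -opprD subr_ge0.
  apply: (@le_trans _ _ ((A + eps * B) * t1 `^ (p - 1))).
    by rewrite mulrDl lerD2l ler_peMr.
  by rewrite ler_wpM2r ?powR_ge0.
have t01 : t0 <= t1.
  rewrite ge0_ler_powR ?nnegrE ?invr_ge0 ?(ltW e0) ?(ltW AC0) ?(ltW z0)//.
  rewrite le_max; apply/orP; right.
  by rewrite ler_wpM2r ?invr_ge0 ?(ltW C0)// lerDl.
clearbody t0 t1.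
have gm : Num.min (g t0) (g t1) <= 0 <= Num.max (g t0) (g t1).
  by rewrite ge_min gt0_le le_max g1 orbT.
have [t] := @IVT _ g t0 t1 0 t01 (continuous_subspaceT gc) gm.
rewrite in_itv => /andP[tt _] gt.
have t_gt0 : 0 < t by rewrite (lt_le_trans t00).
exists t => //; rewrite /nehari_crit; move: gt; rewrite /g gtr0_norm//.
by move=> /eqP; rewrite subr_eq add0r => /eqP <-; ring.
Qed.

Lemma nehari_crit_ge A B C t : 0 <= B -> 0 < C -> 0 < t ->
  nehari_crit A B C t -> A / C <= t `^ (r - (p - 1)).
Proof.
move=> B0 C0 t0 crit; rewrite ler_pdivrMr// -(ler_pM2r (powR_gt0 (p - 1) t0)).
by rewrite mulrAC -powR_split// [leRHS]mulrC -crit lerDl mulr_ge0.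
Qed.

(** Criticality reads C t^e = A + eps B t^(1 - p). Hence t^e lies between 1 and [q n], on the side
    decided by whether [t n] is below or above 1, and [q n] tends to 1 by criticality of the limit
    at 1. *)
Lemma nehari_crit_cvg (A B C t : nat -> R) (A0 B0 C0 : R) :
  (forall n, 0 <= A n) -> (forall n, 0 <= B n) -> (forall n, 0 < C n) ->
  (forall n, 0 < t n) -> 0 < C0 ->
  A @ \oo --> A0 -> B @ \oo --> B0 -> C @ \oo --> C0 ->
  (forall n, nehari_crit (A n) (B n) (C n) (t n)) -> nehari_crit A0 B0 C0 1 ->
  t @ \oo --> (1 : R).
Proof.
move=> Age Bge Cgt tgt C00 cA cB cC crit; rewrite /nehari_crit !powR1 !mulr1 => crit0.
set e := r - (p - 1); have e0 : 0 < e by rewrite /e; slra.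
pose q n := (A n + eps * B n) / C n.
have q1 : q @ \oo --> (1 : R).
  rewrite (_ : 1 = (A0 + eps * B0) / C0); last by rewrite crit0 divff ?gt_eqF.
  apply: cvgM; last by apply: cvgV => //; rewrite gt_eqF.
  by apply: cvgD => //; apply: cvgM => //; exact: cvg_cst.
have nq : (fun n => `|q n - 1|) @ \oo --> (0 : R).
  rewrite -[X in _ --> X](@normr0 _ R); apply: cvg_norm.
  by rewrite -[X in _ --> X](subrr (1 : R)); apply: cvgB => //; exact: cvg_cst.
have te : (fun n => t n `^ e) @ \oo --> (1 : R).
  apply: (@squeeze_cvgr _ _ _ _ (fun n => 1 - `|q n - 1|) (fun n => 1 + `|q n - 1|)).
  - apply: nearW => n.
    have tE : t n `^ r = t n `^ e * t n `^ (p - 1).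
      exact: powR_split.
    have T0 := powR_gt0 (p - 1) (tgt n).
    have eB0 : 0 <= eps * B n by rewrite mulr_ge0.
    have := crit n; rewrite /nehari_crit tE => cn.
    have [t1|t1] := leP (t n) 1.
      have T1 : t n `^ (p - 1) <= 1.
        by rewrite powR_le1 ?(ltW e0)// (ltW (tgt n)).
      have H : q n <= t n `^ e.
        rewrite /q ler_pdivrMr// -(ler_pM2r T0) (_ : t n `^ e * C n * _ = A n * t n `^ (p - 1) + eps * B n).
          by rewrite mulrDl lerD2l ler_piMr.
        by rewrite cn; ring.
      have t1e : t n `^ e <= 1.
        by rewrite powR_le1 ?(ltW e0)// (ltW (tgt n)).
      by rewrite ler0_norm; slra.
    have T1 : 1 <= t n `^ (p - 1).
      by rewrite powR_ge1// ltW.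
    have H : t n `^ e <= q n.
      rewrite /q ler_pdivlMr// -(ler_pM2r T0) (_ : t n `^ e * C n * _ = A n * t n `^ (p - 1) + eps * B n).
        by rewrite mulrDl lerD2l ler_peMr.
      by rewrite cn; ring.
    have t1e : 1 <= t n `^ e.
      by rewrite powR_ge1// ltW.
    by rewrite ger0_norm; slra.
  - rewrite -[X in _ --> X]subr0; apply: cvgB; first exact: cvg_cst.
    exact: nq.
  - rewrite -[X in _ --> X]addr0; apply: cvgD; first exact: cvg_cst.
    exact: nq.
rewrite (_ : t = fun n => (t n `^ e) `^ e^-1).
  rewrite (_ : 1 = 1 `^ e^-1); last by rewrite powR1.
  by apply: cvg_powR => //; [rewrite invr_ge0 ltW|move=> n; exact: powR_ge0].
by apply/funext => n; rewrite -powRrM mulfV ?gt_eqF// powRr1// ltW.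
Qed.

End nehari.

(** * Weighted integrals *)

Lemma le_limn_einf (R : realType) (u v : nat -> \bar R) :
  (forall n, (u n <= v n)%E) -> (limn_einf u <= limn_einf v)%E.
Proof.
move=> uv; rewrite !limn_einf_lim; apply: lee_lim; [exact: is_cvg_einfs..|].
apply: nearW => n; apply: le_ereal_inf_tmp => _ [m /= nm <-].
by apply: le_trans (uv m); apply: ereal_inf_lbound; exists m.
Qed.

(** The weight lets the same limit theorems serve the seminorm, with the product measure and the
    kernel as weight, and the masses, with the constant weight 1. *)
Definition wint d (X : measurableType d) (R : realType)
    (nu : {measure set X -> \bar R}) (rho : X -> R) (P : R) (a : X -> R) : \bar R :=
  (\int[nu]_x (`|a x| `^ P * rho x)%:E)%E.

Section weighted_integrals.
Context d (X : measurableType d) (R : realType) (nu : {measure set X -> \bar R}).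
Variable rho : X -> R.
Hypotheses (rho0 : forall x, 0 <= rho x) (mrho : measurable_fun setT rho).
Implicit Types (a b c : X -> R) (P : R).
Local Notation W := (wint nu rho).

Lemma measurable_wint P a : measurable_fun setT a ->
  measurable_fun setT (fun x => (`|a x| `^ P * rho x)%:E).
Proof.
move=> ma; apply/measurable_EFinP; apply: measurable_funM => //.
apply: (measurableT_comp (measurable_powR _)); exact: measurableT_comp.
Qed.

Lemma wint_integrand_ge0 P a x : (0 <= (`|a x| `^ P * rho x)%:E)%E.
Proof. by rewrite lee_fin mulr_ge0// powR_ge0. Qed.

Lemma wint_ge0 P a : (0 <= W P a)%E.
Proof. by apply: integral_ge0 => x _; exact: wint_integrand_ge0. Qed.

Lemma le_wint P a b : 0 <= P -> measurable_fun setT a -> measurable_fun setT b ->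
  (forall x, `|a x| <= `|b x|) -> (W P a <= W P b)%E.
Proof.
move=> P0 ma mb ab; apply: ge0_le_integral => //.
- by move=> x _; exact: wint_integrand_ge0.
- exact: measurable_wint.
- exact: measurable_wint.
- by move=> x _; rewrite lee_fin ler_wpM2r// ge0_ler_powR ?nnegrE.
Qed.

Lemma wintZ P (c : R) a : measurable_fun setT a ->
  W P (fun x => c * a x) = ((`|c| `^ P)%:E * W P a)%E.
Proof.
move=> ma; rewrite /wint -ge0_integralZl//.
- by apply: eq_integral => x _; rewrite normrM powRM// -mulrA EFinM.
- exact: measurable_wint.
- by move=> x _; exact: wint_integrand_ge0.
Qed.

Lemma wint_integrable P a : measurable_fun setT a -> (W P a < +oo)%E ->
  nu.-integrable setT (fun x => (`|a x| `^ P * rho x)%:E).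
Proof.
move=> ma Wa; apply/integrableP; split; first exact: measurable_wint.
by under eq_integral => x _ do rewrite gee0_abs ?wint_integrand_ge0//.
Qed.

Lemma wint_fin_num P a : (W P a < +oo)%E -> W P a \is a fin_num.
Proof. by move=> Wa; rewrite ge0_fin_numE// wint_ge0. Qed.

Lemma integrable_sum_powR P b c : measurable_fun setT b -> measurable_fun setT c ->
  (W P b < +oo)%E -> (W P c < +oo)%E ->
  nu.-integrable setT (fun x => (2 `^ P * (`|b x| `^ P + `|c x| `^ P) * rho x)%:E).
Proof.
move=> mb mc Wb Wc.
have := integrableZl measurableT (2 `^ P)
  (integrableD measurableT (wint_integrable mb Wb) (wint_integrable mc Wc)).
apply: eq_integrable => // x _ /=.
by rewrite -EFinD -EFinM -mulrDl mulrA.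
Qed.

Lemma wint_dominated P a b c : 0 <= P -> measurable_fun setT a ->
  measurable_fun setT b -> measurable_fun setT c ->
  (forall x, `|a x| <= `|b x| + `|c x|) -> (W P b < +oo)%E -> (W P c < +oo)%E ->
  (W P a < +oo)%E.
Proof.
move=> P0 ma mb mc abc Wb Wc.
have /integrableP[_] := integrable_sum_powR mb mc Wb Wc; apply: le_lt_trans.
apply: ge0_le_integral => //.
- by move=> x _; exact: wint_integrand_ge0.
- exact: measurable_wint.
- do 2 apply: measurableT_comp => //; apply: measurable_funM => //.
  apply: measurable_funM => //; apply: measurable_funD;
  apply: (measurableT_comp (measurable_powR _)); exact: measurableT_comp.
- move=> x _; rewrite lee_fin; apply: le_trans (ler_norm _); rewrite ler_wpM2r//.
  apply: le_trans (powRD_le P0 _ _) => //.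
  by rewrite ge0_ler_powR ?nnegrE ?addr_ge0.
Qed.

Lemma wintD_fin P a b : 0 <= P -> measurable_fun setT a -> measurable_fun setT b ->
  (W P a < +oo)%E -> (W P b < +oo)%E -> (W P (fun x => a x + b x)%R < +oo)%E.
Proof.
move=> P0 ma mb; apply: wint_dominated => //; first exact: measurable_funD.
by move=> x; exact: ler_normD.
Qed.

Lemma wint_dominated_cvg P (a_ : nat -> X -> R) a b c : 0 <= P ->
  (forall n, measurable_fun setT (a_ n)) ->
  measurable_fun setT b -> measurable_fun setT c ->
  (forall x, a_ ^~ x @ \oo --> a x) ->
  (forall n x, `|a_ n x| <= `|b x| + `|c x|) ->
  (W P b < +oo)%E -> (W P c < +oo)%E ->
  (fun n => W P (a_ n)) @ \oo --> W P a.
Proof.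
move=> P0 ma_ mb mc a_a a_bc Wb Wc.
apply: (dominated_cvg measurableT (g := fun x =>
  (2 `^ P * (`|b x| `^ P + `|c x| `^ P) * rho x)%:E)) => //.
- by move=> n; exact: measurable_wint.
- move=> x _; apply/cvg_EFin; first exact: nearW.
  rewrite /comp/=; apply: cvgM; last exact: cvg_cst.
  by apply: cvg_norm_powR => //; exact: a_a.
- exact: integrable_sum_powR.
- move=> n x _; rewrite lee_fin ger0_norm ?mulr_ge0 ?powR_ge0// ler_wpM2r//.
  apply: le_trans (powRD_le P0 _ _) => //.
  by rewrite ge0_ler_powR ?nnegrE ?addr_ge0.
Qed.

Lemma wint_fatou P (a_ : nat -> X -> R) a (m : nat -> R) (l : R) : 0 <= P ->
  (forall n, measurable_fun setT (a_ n)) ->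
  (forall x, a_ ^~ x @ \oo --> a x) ->
  (forall n, (W P (a_ n) <= (m n)%:E)%E) -> m @ \oo --> l -> (W P a <= l%:E)%E.
Proof.
move=> P0 ma_ a_a Wm ml.
pose f n x := (`|a_ n x| `^ P * rho x)%:E.
have H : (fun x => (`|a x| `^ P * rho x)%:E) = (fun x => limn_einf (f ^~ x)).
  apply/funext => x; apply/esym.
  suff fx : f ^~ x @ \oo --> (`|a x| `^ P * rho x)%:E.
    by rewrite is_cvg_limn_einfE; [exact/cvg_lim|apply/cvg_ex; eexists; exact: fx].
  apply/cvg_EFin; first exact: nearW.
  rewrite /comp/=; apply: cvgM; last exact: cvg_cst.
  by apply: cvg_norm_powR => //; exact: a_a.
rewrite /wint H; apply: le_trans (fatou _ _ _ _) _ => //.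
- by move=> n; exact: measurable_wint.
- by move=> n x _; exact: wint_integrand_ge0.
have cm : (EFin \o m) @ \oo --> l%:E by apply/cvg_EFin => //; exact: nearW.
rewrite -(cvg_lim _ cm)// -is_cvg_limn_einfE; last by apply/cvg_ex; eexists; exact: cm.
exact: le_limn_einf.
Qed.

(** Instead of Hoelder's inequality, the crude bound |a|^(P - 1) |b| <= (|a| + |b|)^P is enough. *)
Lemma integrable_wint_product P a b : 2 <= P ->
  measurable_fun setT a -> measurable_fun setT b ->
  (W P a < +oo)%E -> (W P b < +oo)%E ->
  nu.-integrable setT (fun x => (`|a x| `^ (P - 2) * a x * b x * rho x)%:E).
Proof.
move=> P2 ma mb Wa Wb.
have P0 : 0 <= P by lra.
have P1 : 0 <= P - 1 by lra.
apply: le_integrable (integrable_sum_powR ma mb Wa Wb) => //.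
  apply/measurable_EFinP; apply: measurable_funM => //; apply: measurable_funM => //.
  apply: measurable_funM => //; apply: (measurableT_comp (measurable_powR _)).
  exact: measurableT_comp.
move=> x _; rewrite lee_fin !normrM (ger0_norm (rho0 x)) ler_wpM2r//.
rewrite (ger0_norm (powR_ge0 _ _)) norm_powRB2//.
rewrite (ger0_norm (powR_ge0 _ _)) (ger0_norm (addr_ge0 (powR_ge0 _ _) (powR_ge0 _ _))).
apply: le_trans (powRD_le P0 _ _) => //.
rewrite [leRHS]powRS ?addr_ge0//; last lra.
rewrite mulrC ler_pM ?powR_ge0 ?lerDr//.
by apply: ge0_ler_powR => //; rewrite ?nnegrE ?addr_ge0 ?lerDl.
Qed.

(** Dominated convergence of the difference quotients. Steps at most 1 give a dominating function
    that does not depend on [n]. *)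
Lemma wint_derivative P a b (s : nat -> R) : 2 <= P ->
  measurable_fun setT a -> measurable_fun setT b ->
  (W P a < +oo)%E -> (W P b < +oo)%E ->
  (forall n, 0 < s n <= 1) -> s @ \oo --> 0 ->
  (fun n => (fine (W P (fun x => a x + s n * b x)%R) - fine (W P a)) / s n) @ \oo -->
  P * fine (\int[nu]_x (`|a x| `^ (P - 2) * a x * b x * rho x)%:E)%E.
Proof.
move=> P2 ma mb Wa Wb s01 s0.
have P0 : 0 <= P by lra.
have spos n : 0 < s n by have /andP[] := s01 n.
pose q n x := ((`|a x + s n * b x| `^ P - `|a x| `^ P) / s n * rho x)%:E.
have msb n : measurable_fun setT (fun x => s n * b x) by exact: measurable_funM.
have mD n : measurable_fun setT (fun x => a x + s n * b x) by exact: measurable_funD.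
have Wsb n : (W P (fun x => s n * b x)%R < +oo)%E.
  by rewrite wintZ// lte_mul_pinfty// lee_fin powR_ge0.
have WD n : (W P (fun x => a x + s n * b x)%R < +oo)%E.
  exact: (wintD_fin P0 ma (msb n) Wa (Wsb n)).
have integralBZ (c : R) (A B : X -> \bar R) : nu.-integrable setT A ->
    nu.-integrable setT B ->
    (\int[nu]_x (c%:E * (A x - B x)) = c%:E * (\int[nu]_x A x - \int[nu]_x B x))%E.
  by move=> IA IB; rewrite integralZl ?integralB//; exact: integrableB.
have qE n : (\int[nu]_x q n x)%E =
    ((fine (W P (fun x => a x + s n * b x)%R) - fine (W P a)) / s n)%:E.
  transitivity (\int[nu]_x ((s n)^-1%:E *
      ((`|a x + s n * b x| `^ P * rho x)%:E - (`|a x| `^ P * rho x)%:E)))%E.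
    by apply: eq_integral => x _; rewrite -EFinB -EFinM -mulrBl mulrCA mulrA.
  rewrite (integralBZ _ _ _ (wint_integrable (mD n) (WD n)) (wint_integrable ma Wa)).
  rewrite -[X in (_ * (X - _))%E](fineK (wint_fin_num (WD n))).
  by rewrite -[X in (_ * (_ - X))%E](fineK (wint_fin_num Wa)) -EFinB -EFinM mulrC.
have iP := integrable_wint_product P2 ma mb Wa Wb.
pose g x := `|a x| `^ (P - 2) * a x * b x * rho x.
have gE : (\int[nu]_x (P * g x)%:E)%E = (P * fine (\int[nu]_x (g x)%:E)%E)%:E.
  under eq_integral do rewrite EFinM.
  by rewrite integralZl// EFinM fineK//; exact: integrable_fin_num.
have cq : (fun n => \int[nu]_x q n x)%E @ \oo --> (\int[nu]_x (P * g x)%:E)%E.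
  apply: (dominated_cvg measurableT (g := fun x =>
    (P * (2 `^ P * (`|a x| `^ P + `|b x| `^ P) * rho x))%:E)) => //.
  - move=> n; apply/measurable_EFinP; apply: measurable_funM => //.
    apply: measurable_funM => //; apply: measurable_funB;
    apply: (measurableT_comp (measurable_powR _)); exact: measurableT_comp.
  - move=> x _; apply/cvg_EFin; first exact: nearW.
    rewrite (_ : P * g x = P * (`|a x| `^ (P - 2) * a x) * b x * rho x); last first.
      by rewrite /g !mulrA.
    apply: cvgM; last exact: cvg_cst.
    exact: cvg_powR_diff_quotient.
  - by under eq_fun do rewrite EFinM; apply: integrableZl => //; exact: integrable_sum_powR.
  - move=> n x _; rewrite lee_fin normrM (ger0_norm (rho0 x)) mulrA ler_wpM2r//.
    apply: le_trans (powR_diff_quotient_le _ _ P2 (s01 n)) _.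
    by rewrite ler_wpM2l// powRD_le.
rewrite gE (_ : (fun n => _) = EFin \o (fun n =>
  (fine (W P (fun x => a x + s n * b x)) - fine (W P a)) / s n)) in cq; last first.
  by apply/funext => n /=; exact: qE.
exact: (fine_cvg cq).
Qed.

End weighted_integrals.

(** * Level estimates and the subcritical embedding *)

(* [gag mu k p u] is the p-th power of the Gagliardo seminorm of [u] for the
   kernel [k]. It is locked: failed unifications would otherwise compare integrals. *)
HB.lock Definition gag d (T : measurableType d) (R : realType)
    (mu : {sigma_finite_measure set T -> \bar R}) (k : T -> T -> R) (p : R)
    (u : T -> R) : \bar R :=
  wint (mu \x mu)%E (fun z => k z.1 z.2) p (fun z => u z.1 - u z.2).

HB.lock Definition mass d (T : measurableType d) (R : realType)
    (mu : {measure set T -> \bar R}) (q : R) (u : T -> R) : \bar R :=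
  wint mu (cst 1) q u.

Lemma gagE d (T : measurableType d) (R : realType)
    (mu : {sigma_finite_measure set T -> \bar R}) (k : T -> T -> R) (p : R)
    (u : T -> R) :
  gag mu k p u = wint (mu \x mu)%E (fun z => k z.1 z.2) p (fun z => u z.1 - u z.2).
Proof. by rewrite gag.unlock. Qed.

Lemma massW d (T : measurableType d) (R : realType)
    (mu : {measure set T -> \bar R}) (q : R) (u : T -> R) :
  mass mu q u = wint mu (cst 1) q u.
Proof. by rewrite mass.unlock. Qed.

Section geometric.
Context {R : realType}.

Lemma geometric_partial_sum_le (x : R) n : 0 <= x -> x < 1 ->
  \sum_(0 <= i < n) x ^+ i <= (1 - x)^-1.
Proof.
move=> x0 x1; have x10 : 0 < 1 - x by rewrite subr_gt0.
rewrite -(ler_pM2r x10) mulVf ?gt_eqF// mulrC.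
suff -> : (1 - x) * \sum_(0 <= i < n) x ^+ i = 1 - x ^+ n.
  by rewrite lerBlDr lerDl exprn_ge0.
elim: n => [|n ih]; first by rewrite big_nil mulr0 expr0 subrr.
by rewrite big_nat_recr//= mulrDr ih exprS; ring.
Qed.

End geometric.

Section embedding.
Context d (T : measurableType d) (R : realType).
Variables (mu : {sigma_finite_measure set T -> \bar R}) (k : T -> T -> R).
Variables (p c theta : R).
Hypotheses (k0 : forall x y, 0 <= k x y)
  (mk : measurable_fun setT (fun z : T * T => k z.1 z.2)).
Hypotheses (p2 : 2 <= p) (c0 : 0 < c) (theta0 : 0 < theta) (theta1 : theta < 1).
Hypothesis ktail : forall (E : set T) (x : T), measurable E -> E x ->
  (0 < mu E)%E -> (mu E < +oo)%E ->
  ((c * (fine (mu E)) `^ (- theta))%:E <= \int[mu]_(y in ~` E) (k x y)%:E)%E.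
Implicit Types (u : T -> R) (a b M V q : R).

Ltac slra := move: p2 c0 theta0 theta1; lra.

Let p0 : 0 <= p. Proof. slra. Qed.

Lemma measurable_norm_gt u a : measurable_fun setT u ->
  measurable [set x | (a < `|u x|)%R].
Proof.
move=> mu_; have mn : measurable_fun setT (fun x => `|u x|) by exact: measurableT_comp.
rewrite (_ : mkset _ = (fun x => `|u x|) @^-1` `]a, +oo[); last first.
  by apply/seteqP; split => x /=; rewrite in_itv/= andbT.
by rewrite -[X in measurable X]setTI; exact: mn.
Qed.

Lemma measurable_gag_diff u : measurable_fun setT u ->
  measurable_fun setT (fun z : T * T => u z.1 - u z.2).
Proof.
move=> mu_; apply: measurable_funB.
  exact: (measurableT_comp mu_ (@measurable_fst _ _ _ _)).
exact: (measurableT_comp mu_ (@measurable_snd _ _ _ _)).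
Qed.

Let mkx x : measurable_fun setT (fun y => k x y).
Proof. exact: (measurableT_comp mk (pair1_measurable x)). Qed.

(* On {|u| > b} x {|u| <= a} the difference quotient is at least b - a; [ktail] bounds
   the integral of the kernel over the second factor. *)
Lemma gag_level u a b : measurable_fun setT u -> 0 <= a -> a < b ->
  (0 < mu [set x | (a < `|u x|)%R])%E -> (mu [set x | (a < `|u x|)%R] < +oo)%E ->
  (((b - a) `^ p * (c * (fine (mu [set x | (a < `|u x|)%R])) `^ (- theta)))%:E *
    mu [set x | (b < `|u x|)%R] <= gag mu k p u)%E.
Proof.
move=> mu_ a0 ab; set E := [set x | (a < `|u x|)%R]; set F := [set x | (b < `|u x|)%R].
move=> E0 Eoo; set C := (b - a) `^ p * _.
have mE : measurable E by exact: measurable_norm_gt.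
have mF : measurable F by exact: measurable_norm_gt.
have C0 : 0 <= C by rewrite !mulr_ge0 ?powR_ge0// ltW.
have mf : measurable_fun setT (fun z : T * T =>
    (`|u z.1 - u z.2| `^ p * k z.1 z.2)%:E).
  apply: measurable_wint => //; exact: measurable_gag_diff.
rewrite gagE /wint fubini_tonelli1//; last first.
  by move=> z; rewrite lee_fin mulr_ge0 ?powR_ge0.
rewrite -[X in (_ * mu X)%E]setIT -integral_indic// -ge0_integralZl//; last first.
  by apply/measurable_EFinP; exact: measurable_indic.
apply: ge0_le_integral => //.
- by move=> x _; rewrite mule_ge0// lee_fin.
- apply: measurable_funeM; apply/measurable_EFinP; exact: measurable_indic.
- apply: measurable_fun_fubini_tonelli_F => //.
  by move=> z; rewrite lee_fin mulr_ge0 ?powR_ge0.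
move=> x _; rewrite /fubini_F indicE; have [/set_mem Fx|] := boolP (x \in F); last first.
  by rewrite mule0 => _; apply: integral_ge0 => y _; rewrite lee_fin mulr_ge0 ?powR_ge0.
rewrite mule1.
have mfx : measurable_fun setT (fun y => (`|u x - u y| `^ p * k x y)%:E).
  exact: (measurableT_comp mf (pair1_measurable x)).
apply: (@le_trans _ _ (\int[mu]_(y in ~` E) (`|u x - u y| `^ p * k x y)%:E)%E); last first.
  apply: ge0_subset_integral => //; first exact: measurableC.
  by move=> y _; rewrite lee_fin mulr_ge0 ?powR_ge0.
apply: (@le_trans _ _ (\int[mu]_(y in ~` E) ((b - a) `^ p * k x y)%:E)%E).
  under eq_integral do rewrite EFinM.
  rewrite ge0_integralZl//; last 4 first.
  - exact: measurableC.
  - by apply/measurable_EFinP; exact: measurable_funTS.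
  - by move=> y _; rewrite lee_fin.
  - by rewrite lee_fin powR_ge0.
  rewrite EFinM lee_wpmul2l// ?lee_fin ?powR_ge0//; apply: ktail => //.
  exact: lt_trans Fx.
apply: ge0_le_integral => //.
- exact: measurableC.
- by move=> y _; rewrite lee_fin mulr_ge0 ?powR_ge0.
- by apply/measurable_EFinP; apply: measurable_funM => //; exact: measurable_funTS.
- exact: measurable_funTS.
move=> y Ey; rewrite lee_fin ler_wpM2r//.
apply: ge0_ler_powR => //; rewrite ?nnegrE ?subr_ge0 ?(ltW ab)//.
have uy : `|u y| <= a by rewrite leNgt; apply/negP.
have := ler_dist_dist (u x) (u y); have := ler_norm (`|u x| - `|u y|).
by move: Fx; rewrite /F/=; lra.
Qed.

(** For [theta] equal to ps / N this is the critical exponent Np / (N - ps). *)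
Definition sobolev_exp : R := p / (1 - theta).

(** The smallest constant that starts and closes the induction of [gag_weak_type]: at least [V] for
    the level 1, and with K^(1 - theta) at least M 2^sobolev_exp / c for the step. The entry 1 keeps
    it positive. *)
Definition weak_const V M : R :=
  Num.max (Num.max V 1) ((M * 2 `^ sobolev_exp / c) `^ (1 - theta)^-1).

Lemma weak_const_gt0 V M : 0 < weak_const V M.
Proof. by rewrite /weak_const !lt_max ltr01 orbT. Qed.

(** Induction on the dyadic level. [gag_level] between 2^n and 2^(n + 1) bounds the next measure by
    (M / c) 2^(-np) times the power [theta] of the present one. Since p + theta * sobolev_exp =
    sobolev_exp, the decay reproduces itself, and [weak_const] absorbs the factors. *)
Lemma gag_weak_type u V M n : measurable_fun setT u -> 0 <= M ->
  (mu [set x | (0 < `|u x|)%R] <= V%:E)%E -> (gag mu k p u <= M%:E)%E ->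
  (mu [set x | (2 `^ n%:R < `|u x|)%R] <=
    (weak_const V M * 2 `^ (- (n%:R * sobolev_exp)))%:E)%E.
Proof.
move=> mu_ M0 uV uM; set K := weak_const V M.
have K0 : 0 < K by exact: weak_const_gt0.
have th0 : 0 < 1 - theta by slra.
have KM : M * 2 `^ sobolev_exp / c <= K `^ (1 - theta).
  have /(@ge0_ler_powR _ (1 - theta)) : (M * 2 `^ sobolev_exp / c) `^ (1 - theta)^-1 <= K.
    by rewrite /K /weak_const le_max lexx orbT.
  rewrite ?nnegrE powR_ge0 (ltW K0) (ltW th0) -powRrM mulVf ?gt_eqF// powRr1; first by apply.
  by rewrite !mulr_ge0 ?powR_ge0 ?invr_ge0 ?(ltW c0).
elim: n => [|n ih].
  rewrite mul0r oppr0 !powRr0 mulr1.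
  apply: (@le_trans _ _ V%:E); last by rewrite lee_fin /K /weak_const !le_max lexx.
  apply: le_trans uV; apply: le_measure; rewrite ?inE; try exact: measurable_norm_gt.
  by move=> x /=; exact: lt_trans.
have l0 m : 0 < 2 `^ m%:R :> R by rewrite powR_gt0.
have lS : 2 `^ n.+1%:R = 2 `^ n%:R * 2 :> R.
  by rewrite -(natr1 n) powRD ?powRr1// pnatr_eq0 implybT.
set E := [set x | (2 `^ n%:R < `|u x|)%R] in ih *.
set F := [set x | (2 `^ n.+1%:R < `|u x|)%R].
have mE : measurable E by exact: measurable_norm_gt.
have mF : measurable F by exact: measurable_norm_gt.
have FE : F `<=` E by move=> x /=; apply: lt_trans; rewrite lS ltr_pMr// ltr1n.
have muFE : (mu F <= mu E)%E by apply: le_measure; rewrite ?inE.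
have bnd0 : (0%:E <= (K * 2 `^ (- (n.+1%:R * sobolev_exp)))%:E)%E.
  by rewrite lee_fin mulr_ge0 ?powR_ge0// ltW.
(* [gag_level] needs a level set of positive measure; a null one settles the step by inclusion. *)
have [E0|E0] := eqVneq (mu E) 0%E.
  by apply: le_trans bnd0; move: muFE; rewrite E0.
have {}E0 : (0 < mu E)%E by rewrite lt0e E0/=.
have Eoo : (mu E < +oo)%E by apply: le_lt_trans ih (ltry _).
have Ef : mu E \is a fin_num by rewrite ge0_fin_numE.
have Ff : mu F \is a fin_num by rewrite ge0_fin_numE// (le_lt_trans muFE).
have /(le_trans (gag_level mu_ (ltW (l0 n)) _ E0 Eoo)) : (gag mu k p u <= M%:E)%E by [].
move=> /(_ (2 `^ n.+1%:R)); rewrite lS ltr_pMr// ltr1n => /(_ erefl).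
rewrite -/F -lS -/F -(fineK Ff) -EFinM !lee_fin lS (_ : 2 `^ n%:R * 2 - 2 `^ n%:R = 2 `^ n%:R); last by ring.
set e := fine (mu E); set f := fine (mu F) => H.
have e0 : 0 < e by rewrite fine_gt0// E0.
have f0 : 0 <= f by rewrite fine_ge0.
have eK : e <= K * 2 `^ (- (n%:R * sobolev_exp)) by rewrite -lee_fin fineK.
have et : e `^ theta <= K `^ theta * 2 `^ (- (n%:R * sobolev_exp * theta)).
  rewrite -mulNr powRrM -powRM ?powR_ge0 ?(ltW K0)//.
  by apply: ge0_ler_powR; rewrite ?nnegrE ?(ltW theta0) ?(ltW e0) ?mulr_ge0 ?powR_ge0 ?(ltW K0).
have {}H : f <= M / c * 2 `^ (- (n%:R * p)) * e `^ theta.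
  rewrite powRN powRrM; move: H; rewrite powRN.
  have A0 := powR_gt0 p (l0 n); have B0 := powR_gt0 theta e0.
  set A := _ `^ p in A0 *; set B := e `^ theta in B0 * => H.
  have ABc0 : 0 < A * (c / B) by rewrite !mulr_gt0// invr_gt0.
  rewrite -(ler_pM2l ABc0); apply: le_trans H _.
  rewrite le_eqVlt; apply/orP; left; apply/eqP; field.
  by rewrite !gt_eqF.
apply: (le_trans H).
apply: (@le_trans _ _ (M / c * 2 `^ (- (n%:R * p)) *
   (K `^ theta * 2 `^ (- (n%:R * sobolev_exp * theta))))).
  by rewrite ler_wpM2l// !mulr_ge0 ?powR_ge0// ?invr_ge0 ltW.
have sE : n%:R * p + n%:R * sobolev_exp * theta = n%:R * sobolev_exp :> R.
  by rewrite /sobolev_exp; field; rewrite gt_eqF.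
have two_n : 2 `^ (- (n%:R * p)) * 2 `^ (- (n%:R * sobolev_exp * theta)) =
    2 `^ (- (n%:R * sobolev_exp)) :> R.
  by rewrite -powRD ?pnatr_eq0 ?implybT// -opprD sE.
rewrite mulrACA two_n -(natr1 n) mulrDl mul1r opprD powRD ?pnatr_eq0 ?implybT//.
rewrite [leRHS](_ : _ = K * 2 `^ (- sobolev_exp) * 2 `^ (- (n%:R * sobolev_exp))); last by ring.
rewrite ler_wpM2r ?powR_ge0//.
have KE : K = K `^ (1 - theta) * K `^ theta.
  by rewrite -powRD ?subrK ?powRr1 ?(ltW K0)// gt_eqF ?implybT.
rewrite powRN ler_pdivlMr ?powR_gt0// [leRHS]KE.
rewrite [leLHS](_ : _ = M * 2 `^ sobolev_exp / c * K `^ theta); last by ring.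
by rewrite ler_wpM2r ?powR_ge0.
Qed.

Definition moment_const q V M : R :=
  V + weak_const V M * 2 `^ q / (1 - 2 `^ (q - sobolev_exp)).

(** The part where |u| <= 1 contributes at most [V]. On the shell between 2^n and 2^(n + 1) the weak
    type bound leaves a multiple of 2^(n (q - sobolev_exp)), a geometric series exactly because [q]
    is subcritical. *)
Lemma mass_le_moment_const u q V M : measurable_fun setT u -> 0 <= M ->
  0 < q -> q < sobolev_exp ->
  (mu [set x | (0 < `|u x|)%R] <= V%:E)%E -> (gag mu k p u <= M%:E)%E ->
  (mass mu q u <= (moment_const q V M)%:E)%E.
Proof.
move=> mu_ M0 q0 qs uV uM; set K := weak_const V M.
have K0 : 0 < K by exact: weak_const_gt0.
pose E n := [set x | (2 `^ n%:R < `|u x|)%R].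
have mE n : measurable (E n) by exact: measurable_norm_gt.
pose f n x : \bar R := ((2 `^ (n.+1%:R * q))%:E * (\1_(E n) x)%:E)%E.
have f0 n x : (0 <= f n x)%E by rewrite mule_ge0// lee_fin ?powR_ge0.
have mf n : measurable_fun setT (f n).
  apply: measurable_funeM; apply/measurable_EFinP; exact: measurable_indic.
pose g x : \bar R := (\1_[set x | (0 < `|u x|)%R] x)%:E.
have mg : measurable_fun setT g.
  apply/measurable_EFinP/measurable_indic; exact: measurable_norm_gt.
have H x : ((`|u x| `^ q * 1)%:E <= g x + \sum_(0 <= n <oo) f n x)%E.
  rewrite mulr1; have [u1|u1] := leP `|u x| 1.
    apply: (@le_trans _ _ (g x)); last by rewrite leeDl// nneseries_ge0.
    rewrite lee_fin indicE; have [->|ux] := eqVneq (u x) 0.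
      by rewrite normr0 powR0 ?gt_eqF.
    rewrite mem_set/= ?normr_gt0//; apply: powR_le1; rewrite ?(ltW q0)// normr_ge0//.
  have [n /andP[n1 n2]] : exists n, (2 `^ n%:R < `|u x|) && (`|u x| <= 2 `^ n.+1%:R).
    have ex : exists n, `|u x| <= 2 `^ n%:R.
      exists (Num.bound `|u x|); apply: ltW; apply: (lt_trans (archi_boundP (normr_ge0 _))).
      by rewrite powR_mulrn// -natrX ltr_nat ltn_expl.
    case: (ex_minnP ex) => -[|n]; first by rewrite powRr0 leNgt u1.
    move=> un nmin; exists n; rewrite un andbT ltNge; apply/negP => /nmin.
    by rewrite ltnn.
  apply: (@le_trans _ _ (f n x)).
    rewrite /f indicE mem_set// mule1 lee_fin powRrM.
    by apply: ge0_ler_powR; rewrite ?nnegrE ?powR_ge0 ?(ltW q0).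
  apply: (@le_trans _ _ (\sum_(0 <= n <oo) f n x)%E); last by rewrite leeDr// lee_fin.
  apply: (@le_trans _ _ (\sum_(0 <= i < n.+1) f i x)%E); last first.
    by apply: nneseries_lim_ge => i _ _; exact: f0.
  by rewrite big_nat_recr//= leeDr// sume_ge0.
rewrite massW /wint.
apply: (@le_trans _ _ (\int[mu]_x (g x + \sum_(0 <= n <oo) f n x))%E).
  apply: ge0_le_integral => //.
  - by move=> x _; rewrite lee_fin mulr1 powR_ge0.
  - exact: measurable_wint.
  - by apply: emeasurable_funD => //; apply: ge0_emeasurable_sum.
rewrite ge0_integralD//; last 3 first.
- by move=> x _; rewrite lee_fin.
- by move=> x _; exact: nneseries_ge0.
- exact: ge0_emeasurable_sum.
rewrite /moment_const EFinD leeD//.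
  by rewrite /g integral_indic ?setIT//; exact: measurable_norm_gt.
rewrite integral_nneseries//.
set x := 2 `^ (q - sobolev_exp).
have x0 : 0 <= x by exact: powR_ge0.
have x1 : x < 1.
  rewrite /x /powR pnatr_eq0/= -[ltRHS]expR0 ltr_expR pmulr_llt0 ?subr_lt0//.
  by apply: ln_gt0; rewrite ltr1n.
have fE n : (\int[mu]_x f n x <= (K * 2 `^ q * x ^+ n)%:E)%E.
  rewrite /f ge0_integralZl//; last first.
    by apply/measurable_EFinP; exact: measurable_indic.
  rewrite integral_indic// setIT.
  apply: (@le_trans _ _ ((2 `^ (n.+1%:R * q))%:E *
      (K * 2 `^ (- (n%:R * sobolev_exp)))%:E)%E).
    by rewrite lee_wpmul2l ?lee_fin ?powR_ge0//; exact: gag_weak_type.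
  rewrite -EFinM lee_fin -powR_mulrn// /x -powRrM.
  rewrite mulrCA -mulrA -!powRD ?pnatr_eq0 ?implybT//.
  rewrite (_ : n.+1%:R * q + - (n%:R * sobolev_exp) = q + (q - sobolev_exp) * n%:R)//.
  by rewrite -(natr1 n); ring.
apply: lime_le.
  by apply: is_cvg_nneseries => n _ _; apply: integral_ge0 => y _; exact: f0.
apply: nearW => n; apply: (@le_trans _ _ (\sum_(0 <= i < n) (K * 2 `^ q * x ^+ i)%:E)%E).
  by apply: lee_sum => i _; exact: fE.
rewrite sumEFin lee_fin -mulr_sumr ler_wpM2l ?mulr_ge0 ?powR_ge0 ?(ltW K0)//.
exact: geometric_partial_sum_le.
Qed.

End embedding.

(** * Compactness *)

Section ultrafilter_limits.
Context {R : realType}.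

(** A cluster point along an ultrafilter is a limit. One ultrafilter serves all bounded sequences at
    once, which spares a diagonal extraction over the cells. *)
Lemma ultra_bounded_cvg (U : set_system nat) (f : nat -> R) (C : R) :
  UltraFilter U -> (forall n, `|f n| <= C) ->
  exists l : R, forall e, 0 < e -> U [set n | `|f n - l| < e].
Proof.
move=> UU fC; have fU : (f @ U) `[- C, C]%classic.
  have UT : U setT by exact: filterT.
  by apply: (@filterS _ U _ setT _ _ UT) => n _; rewrite /= in_itv/= -ler_norml.
have [l [_ ll]] := @segment_compact R (- C) C (f @ U) _ fU.
exists l => e e0; pose A := [set n | `|f n - l| < e].
have [//|nA] := in_ultra_setVsetC A UU.
have B : nbhs l (ball l e) by exact: nbhsx_ballx.
have [_ [/= [n An <-]]] : ((f @` (~` A)) `&` ball l e) !=set0.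
  by apply: ll B; apply: (@filterS _ U _ _ _ _ nA) => n An; exists n.
by rewrite /ball/= distrC => /An.
Qed.

End ultrafilter_limits.

Section compactness.
Context d (T : measurableType d) (R : realType).
Variables (mu : {sigma_finite_measure set T -> \bar R}) (k : T -> T -> R).
Variables (p c theta : R) (Om : set T).
Hypotheses (k0 : forall x y, 0 <= k x y)
  (mk : measurable_fun setT (fun z : T * T => k z.1 z.2)).
Hypotheses (p2 : 2 <= p).
Hypotheses (mOm : measurable Om) (Omoo : (mu Om < +oo)%E).
Hypothesis kcells : forall D : R, 0 < D -> exists n (Q : 'I_n -> set T),
  [/\ forall i, measurable (Q i), forall i, (0 < mu (Q i) < +oo)%E,
      forall x, Om x -> exists i, Q i x &
      forall i x y, Q i x -> Q i y -> x <> y -> D <= k x y * fine (mu (Q i))].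
Implicit Types (u g : T -> R) (D eta M : R).

Ltac slra := move: p2; lra.

Let p0 : 0 <= p. Proof. slra. Qed.

Lemma measurable_gag_integrand u : measurable_fun setT u ->
  measurable_fun setT (fun z : T * T => (`|u z.1 - u z.2| `^ p * k z.1 z.2)%:E).
Proof. by move=> mu_; apply: measurable_wint => //; exact: measurable_gag_diff. Qed.

Let f0 u (z : T * T) : (0 <= (`|u z.1 - u z.2| `^ p * k z.1 z.2)%:E)%E.
Proof. by rewrite lee_fin mulr_ge0 ?powR_ge0. Qed.

Lemma measurable_gag_slice u x : measurable_fun setT u ->
  measurable_fun setT (fun y => (`|u x - u y| `^ p * k x y)%:E).
Proof.
move=> mu_; exact: (measurableT_comp (measurable_gag_integrand mu_) (pair1_measurable x)).
Qed.

Lemma measurable_gag_inner u : measurable_fun setT u ->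
  measurable_fun setT (fun x => \int[mu]_y (`|u x - u y| `^ p * k x y)%:E)%E.
Proof.
move=> mu_.
exact: (measurable_fun_fubini_tonelli_F _ (measurable_gag_integrand mu_) (f0 u)).
Qed.

Lemma gag_iterated u : measurable_fun setT u ->
  gag mu k p u = (\int[mu]_x \int[mu]_y (`|u x - u y| `^ p * k x y)%:E)%E.
Proof.
move=> mu_; rewrite gagE /wint.
exact: (fubini_tonelli1 _ (measurable_gag_integrand mu_) (f0 u)).
Qed.

Lemma gag_ae_eq u g : measurable_fun setT u -> measurable_fun setT g ->
  {ae mu, forall x, u x = g x} -> gag mu k p u = gag mu k p g.
Proof.
move=> mu_ mg [N [mN N0 sN]].
have ug x : ~ N x -> u x = g x by move=> /(contra_not (@sN x)) /contrapT.
have I0 (v : T -> R) x : (0 <= \int[mu]_y (`|v x - v y| `^ p * k x y)%:E)%E.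
  by apply: integral_ge0 => y _; rewrite lee_fin mulr_ge0 ?powR_ge0.
rewrite (gag_iterated mu_) (gag_iterated mg).
apply: ge0_ae_eq_integral => //.
- exact: measurable_gag_inner.
- exact: measurable_gag_inner.
exists N; split => // x /= /not_implyP[_]; apply: contra_notP => Nx.
apply: ge0_ae_eq_integral => //.
- exact: measurable_gag_slice.
- exact: measurable_gag_slice.
- by move=> y _; rewrite lee_fin mulr_ge0 ?powR_ge0.
- by move=> y _; rewrite lee_fin mulr_ge0 ?powR_ge0.
exists N; split => // y /= /not_implyP[_]; apply: contra_notP => Ny.
by rewrite (ug _ Nx) (ug _ Ny).
Qed.

Lemma mass_ae_eq q u g : measurable_fun setT u -> measurable_fun setT g ->
  {ae mu, forall x, u x = g x} -> mass mu q u = mass mu q g.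
Proof.
move=> mu_ mg ug; rewrite !massW; apply: ge0_ae_eq_integral => //.
- exact: measurable_wint.
- exact: measurable_wint.
- by move=> x _; rewrite lee_fin mulr1 powR_ge0.
- by move=> x _; rewrite lee_fin mulr1 powR_ge0.
by apply: filterS ug => x /= ->.
Qed.

Lemma gagB_le u g M : measurable_fun setT u -> measurable_fun setT g ->
  (gag mu k p u <= M%:E)%E -> (gag mu k p g <= M%:E)%E ->
  (gag mu k p (fun x => u x - g x)%R <= (2 `^ p * (M + M))%:E)%E.
Proof.
move=> mu_ mg uM gM.
have mf := measurable_gag_integrand.
apply: (@le_trans _ _ ((2 `^ p)%:E * (gag mu k p u + gag mu k p g))%E); last first.
  rewrite EFinM; apply: lee_wpmul2l; first by rewrite lee_fin powR_ge0.
  by rewrite EFinD; exact: leeD.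
rewrite !gagE /wint -(ge0_integralD _ measurableT (fun z _ => f0 u z) (mf _ mu_)
  (fun z _ => f0 g z) (mf _ mg)).
have c0 : (0 <= (2 `^ p)%:E)%E by rewrite lee_fin powR_ge0.
rewrite -(ge0_integralZl _ measurableT (emeasurable_funD (mf _ mu_) (mf _ mg)) _ c0); last first.
  by move=> z _; rewrite adde_ge0.
apply: ge0_le_integral => //.
- by move=> z _; exact: (f0 (fun x => u x - g x)).
- by apply: (mf (fun x => u x - g x)); exact: measurable_funB.
- by apply: measurable_funeM; apply: emeasurable_funD; exact: mf.
move=> z _; rewrite -EFinD -EFinM lee_fin -mulrDl mulrA ler_wpM2r//.
apply: le_trans (powRD_le p0 _ _) => //.
rewrite (_ : _ - _ = (u z.1 - u z.2) + - (g z.1 - g z.2)); last by ring.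
by rewrite -(normrN (g z.1 - g z.2)); exact: norm_powR_ltD.
Qed.

(** If [t > eta], then (t / eta)^(p - 1) >= 1. This passes from first powers to p-th powers at the
    price of a small additive [eta], with no use of Hoelder's inequality. *)
Lemma le_threshold_powR eta (t : R) : 0 < eta -> 0 <= t -> t <= eta + eta `^ (1 - p) * t `^ p.
Proof.
move=> eta0 t0; have [te|te] := leP t eta.
  by apply: (le_trans te); rewrite lerDl mulr_ge0 ?powR_ge0.
have tpos : 0 < t by exact: lt_trans te.
apply: (@le_trans _ _ (eta `^ (1 - p) * t `^ p)); last by rewrite lerDr ltW.
have pm1 : 0 <= p - 1 by slra.
rewrite -opprB powRN (powRS t0); last by slra.
rewrite mulrCA ler_peMr// ler_pdivlMl ?powR_gt0// mulr1.
by apply: ge0_ler_powR; rewrite ?nnegrE ?(ltW eta0) ?(ltW te).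
Qed.

(* For x in Q, |g x| is at most |mean of g over Q| plus the mean of |g x - g y|, and
   t <= eta + eta^(1-p) t^p turns the latter into the seminorm. *)
Lemma cells_bound g n (Q : 'I_n -> set T) D eta :
  measurable_fun setT g -> (mass mu 1 g < +oo)%E -> 0 < eta -> 0 < D ->
  (forall i, measurable (Q i)) -> (forall i, (0 < mu (Q i) < +oo)%E) ->
  (forall x, Om x -> exists i, Q i x) ->
  (forall i x y, Q i x -> Q i y -> x <> y -> D <= k x y * fine (mu (Q i))) ->
  (\int[mu]_(x in Om) `|g x|%:E <= \sum_(i < n) `|\int[mu]_(x in Q i) (g x)%:E|
    + eta%:E * mu Om + (eta `^ (1 - p) / D)%:E * gag mu k p g)%E.
Proof.
move=> mg gL eta0 D0 mQ Q0 cQ kQ.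
pose G x := (\int[mu]_y (`|g x - g y| `^ p * k x y)%:E)%E.
have G0 x : (0 <= G x)%E by apply: integral_ge0 => y _; rewrite lee_fin mulr_ge0 ?powR_ge0.
have mG : measurable_fun setT G by exact: measurable_gag_inner.
have gE : gag mu k p g = (\int[mu]_x G x)%E by exact: gag_iterated.
have mS x := measurable_gag_slice x mg.
have ig : mu.-integrable setT (EFin \o g).
  apply/integrableP; split; first exact/measurable_EFinP.
  move: gL; rewrite massW /wint; congr (_ < _)%E; apply: eq_integral => x _ /=.
  by rewrite mulr1 powRr1.
have igQ i : mu.-integrable (Q i) (EFin \o g) by exact: integrableS ig.
pose m i := fine (mu (Q i)).
have Qfin i : mu (Q i) \is a fin_num.
  by rewrite ge0_fin_numE//; case/andP: (Q0 i).
have m0 i : 0 < m i by rewrite /m fine_gt0//; exact: Q0.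
have iC i (r : R) : mu.-integrable (Q i) (fun=> r%:E).
  apply/integrableP; split => //; rewrite (integral_cst _ (mQ i) `|r%:E|%E).
  by rewrite lte_mul_pinfty//; case/andP: (Q0 i).
pose I i := fine (\int[mu]_(x in Q i) (g x)%:E)%E.
have IE i : (\int[mu]_(x in Q i) (g x)%:E = (I i)%:E)%E.
  by rewrite /I fineK//; exact: integrable_fin_num (igQ i).
set C := eta `^ (1 - p) / D.
have C0 : 0 <= C by rewrite /C mulr_ge0 ?powR_ge0// invr_ge0 ltW.
have pw i x : Q i x -> (`|g x|%:E <= (`|I i| / m i)%:E + eta%:E + C%:E * G x)%E.
  move=> Qx.
  have mgx : measurable_fun (Q i) (fun y => (g x - g y)%:E).
    apply/measurable_EFinP; apply: measurable_funTS; exact: measurable_funB.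
  (* Up to the factor [m i], this is the deviation of [g x] from its mean over the cell. *)
  have E1 : (\int[mu]_(y in Q i) (g x - g y)%:E = (g x * m i - I i)%:E)%E.
    under eq_integral do rewrite EFinB.
    rewrite (integralB (mQ i) (iC i (g x)) (igQ i)).
    by rewrite IE integral_cst// EFinB EFinM /m (fineK (Qfin i)).
  have E2 : (`|g x * m i - I i|%:E <= \int[mu]_(y in Q i) `|g x - g y|%:E)%E.
    by rewrite -abse_EFin -E1; exact: le_abse_integral.
  have E3 : (\int[mu]_(y in Q i) `|g x - g y|%:E <= (eta * m i)%:E + (C * m i)%:E * G x)%E.
    apply: (@le_trans _ _ (\int[mu]_(y in Q i)
        (eta%:E + (C * m i)%:E * (`|g x - g y| `^ p * k x y)%:E))%E).
      apply: ge0_le_integral => //.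
      - by apply/measurable_EFinP; apply: measurableT_comp => //; exact/measurable_EFinP.
      - apply: emeasurable_funD => //; apply: measurable_funeM; apply: measurable_funTS.
        exact: mS.
      move=> y Qy; rewrite -EFinM -EFinD lee_fin.
      apply: (le_trans (le_threshold_powR eta0 (normr_ge0 (g x - g y)))); rewrite lerD2l.
      (* On the diagonal there is no lower bound for the kernel, but there the difference is 0. *)
      have [xy|xy] := pselect (x = y).
        by rewrite xy subrr normr0 powR0 ?mulr0 ?mul0r ?mulr0// gt_eqF//; slra.
      rewrite /C (_ : _ / D * m i * _ = eta `^ (1 - p) * `|g x - g y| `^ p *
        (k x y * m i / D)); last by ring.
      rewrite ler_peMr ?mulr_ge0 ?powR_ge0// ler_pdivlMr// mul1r.
      exact: kQ Qx Qy xy.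
    have Cm0 : (0 <= (C * m i)%:E)%E by rewrite lee_fin mulr_ge0// ltW.
    have mSQ : measurable_fun (Q i) (fun y => (`|g x - g y| `^ p * k x y)%:E).
      exact: measurable_funTS.
    have S0 y : Q i y -> (0 <= (`|g x - g y| `^ p * k x y)%:E)%E.
      by move=> _; exact: (f0 g (x, y)).
    rewrite (ge0_integralD _ (mQ i) _ (measurable_cst _) _ (measurable_funeM _ mSQ)); last 2 first.
    - by move=> y _; rewrite lee_fin ltW.
    - by move=> y Qy; rewrite mule_ge0// S0.
    rewrite integral_cst//; apply: leeD; first by rewrite EFinM /m (fineK (Qfin i)).
    rewrite (ge0_integralZl _ (mQ i) mSQ S0 Cm0).
    rewrite lee_wpmul2l// ?lee_fin ?mulr_ge0 ?(ltW (m0 _))//.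
    apply: ge0_subset_integral => //.
    by move=> y _; exact: (f0 g (x, y)).
  have := le_trans E2 E3; move: (G0 x); case: (G x) => [r r0|_|//]; last first.
    move: C0; rewrite le_eqVlt => /predU1P[CE|C0'].
      move=> H; rewrite -CE mul0e adde0; move: H; rewrite -CE mul0r mul0e adde0.
      rewrite -EFinD !lee_fin => H.
      have : `|g x| * m i <= `|I i| + eta * m i.
        by rewrite -(gtr0_norm (m0 i)) -normrM (gtr0_norm (m0 i)) -lerBlDl; apply: le_trans H; exact: lerB_dist.
      by rewrite -ler_pdivlMr// mulrDl mulfK ?gt_eqF.
    by move=> _; rewrite gt0_muley ?lte_fin// addey ?leey.
  rewrite -!EFinM -!EFinD !lee_fin => H.
  have : `|g x| * m i <= `|I i| + eta * m i + C * r * m i.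
    rewrite -[X in `|g x| * X](gtr0_norm (m0 i)) -normrM -addrA -lerBlDl.
    rewrite (mulrAC C); apply: le_trans H; exact: lerB_dist.
  by rewrite -ler_pdivlMr// !mulrDl !mulfK ?gt_eqF.
have mind (A : set T) : measurable A -> measurable_fun Om (fun x => (\1_A x : R)%:E).
  by move=> mA; apply/measurable_EFinP; exact: measurable_indic.
pose h i x : \bar R := ((`|I i| / m i)%:E * (\1_(Q i) x)%:E)%E.
have h0 i x : (0 <= h i x)%E.
  by rewrite /h mule_ge0// lee_fin divr_ge0// ltW.
have mh i : measurable_fun Om (h i) by apply: measurable_funeM; exact: mind.
apply: (@le_trans _ _ (\int[mu]_(x in Om)
   (\sum_(i < n) h i x + (eta%:E + C%:E * G x)))%E).
  apply: ge0_le_integral => //.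
  - apply/measurable_EFinP; apply: measurable_funTS; exact: measurableT_comp.
  - apply: emeasurable_funD; first exact: emeasurable_sum.
    apply: emeasurable_funD => //; apply: measurable_funeM; exact: measurable_funTS.
  move=> x Ox; have [i Qx] := cQ x Ox.
  apply: le_trans (pw i x Qx) _; rewrite -addeA leeD2r//.
  rewrite (bigD1 i)//= {1}/h indicE mem_set// mule1 leeDl// sume_ge0//.
have mCG : measurable_fun Om (fun x => C%:E * G x)%E.
  by apply: measurable_funeM; exact: measurable_funTS.
have CG0 x : (0 <= C%:E * G x)%E by rewrite mule_ge0// lee_fin.
rewrite ge0_integralD//; last 4 first.
- by move=> x _; rewrite sume_ge0.
- exact: emeasurable_sum.
- by move=> x _; rewrite adde_ge0// lee_fin ltW.
- exact: emeasurable_funD.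
rewrite -addeA leeD//.
  rewrite ge0_integral_sum//; apply: lee_sum => i _.
  rewrite /h ge0_integralZl//; last 2 first.
  - exact: mind.
  - by rewrite lee_fin divr_ge0// ltW.
  rewrite integral_indic// IE.
  apply: (@le_trans _ _ ((`|I i| / m i)%:E * mu (Q i))%E).
    rewrite lee_wpmul2l ?lee_fin ?divr_ge0 ?(ltW (m0 _))//.
    by apply: le_measure; rewrite ?inE//; exact: measurableI.
  by rewrite -(fineK (Qfin i)) -EFinM divfK// gt_eqF.
rewrite ge0_integralD//; last first.
  by move=> x _; rewrite lee_fin ltW.
rewrite integral_cst// leeD// ge0_integralZl//; last exact: measurable_funTS.
rewrite lee_wpmul2l ?lee_fin// gE; exact: ge0_subset_integral.
Qed.

End compactness.

(** * Extraction of an almost everywhere convergent subsequence *)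

Section series_convergence.
Context {R : realType}.

Lemma cvg_of_summable_increments (u : nat -> R) :
  (\sum_(0 <= j <oo) `|u j.+1 - u j|%:E < +oo)%E -> cvgn u.
Proof.
set S := (\sum_(0 <= j <oo) _)%E => Soo.
have S0 : (0 <= S)%E by apply: nneseries_ge0 => n _ _; rewrite lee_fin.
have Sfin : S \is a fin_num by rewrite ge0_fin_numE.
have : cvgn [normed series (telescope u)].
  apply: nondecreasing_is_cvgn.
    by apply: nondecreasing_series => n _ _; exact: normr_ge0.
  exists (fine S) => _ [n _ <-]; rewrite -lee_fin fineK// /series/= -sumEFin.
  apply: (@nneseries_lim_ge _ (fun j => `|u j.+1 - u j|%:E) xpredT 0%N n).
  by move=> m _ _; rewrite lee_fin.
move/normed_cvg; rewrite telescopeK => H.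
have -> : u = (fun n => (u n - u 0%N) + u 0%N) by apply/funext => n; rewrite subrK.
exact: is_cvgD H (is_cvg_cst _).
Qed.

End series_convergence.

Section compact_sequences.
Context d (T : measurableType d) (R : realType).
Variables (mu : {sigma_finite_measure set T -> \bar R}) (k : T -> T -> R).
Variables (p : R) (Om : set T).
Hypotheses (k0 : forall x y, 0 <= k x y)
  (mk : measurable_fun setT (fun z : T * T => k z.1 z.2)).
Hypotheses (p2 : 2 <= p).
Hypotheses (mOm : measurable Om) (Omoo : (mu Om < +oo)%E).
Hypothesis kcells : forall D : R, 0 < D -> exists n (Q : 'I_n -> set T),
  [/\ forall i, measurable (Q i), forall i, (0 < mu (Q i) < +oo)%E,
      forall x, Om x -> exists i, Q i x &
      forall i x y, Q i x -> Q i y -> x <> y -> D <= k x y * fine (mu (Q i))].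

Lemma integrable_mass1 g : measurable_fun setT g -> (mass mu 1 g < +oo)%E ->
  mu.-integrable setT (EFin \o g).
Proof.
move=> mg gL; apply/integrableP; split; first exact/measurable_EFinP.
move: gL; rewrite massW /wint; congr (_ < _)%E; apply: eq_integral => x _ /=.
by rewrite mulr1 powRr1.
Qed.

Lemma norm_integral_le_mass1 g (Q : set T) (K : R) : measurable Q ->
  measurable_fun setT g -> (mass mu 1 g <= K%:E)%E ->
  `|fine (\int[mu]_(x in Q) (g x)%:E)| <= K.
Proof.
move=> mQ mg gK; have gL : (mass mu 1 g < +oo)%E by rewrite (le_lt_trans gK) ?ltry.
have ig := integrable_mass1 mg gL.
have igQ : mu.-integrable Q (EFin \o g) by exact: integrableS ig.
rewrite -lee_fin -fine_abse; last exact: integrable_fin_num igQ.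
rewrite fineK ?abse_fin_num; last exact: integrable_fin_num igQ.
apply: (le_trans (le_abse_integral _ mQ (measurable_int _ igQ))).
apply: le_trans gK.
apply: (@le_trans _ _ (\int[mu]_x `|(g x)%:E|)%E).
  apply: ge0_subset_integral => //.
  by apply: measurableT_comp => //; exact/measurable_EFinP.
rewrite massW /wint le_eqVlt; apply/orP; left; apply/eqP; apply: eq_integral => x _ /=.
by rewrite mulr1 powRr1.
Qed.

Let e j : R := 2 ^- j.

Let e0 j : 0 < e j. Proof. by rewrite invr_gt0 exprn_gt0. Qed.

(* Limits of the cell integrals of [u n] along one ultrafilter, for finer and finer
   covers, select a subsequence whose increments are summable in L^1. *)
Lemma gag_compact (u : nat -> T -> R) (M K : R) : 0 <= M ->
  (forall n, measurable_fun setT (u n)) ->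
  (forall n, (mass mu 1 (u n) <= K%:E)%E) ->
  (forall n, (gag mu k p (u n) <= M%:E)%E) ->
  (forall n x, ~ Om x -> u n x = 0) ->
  exists (f : nat -> nat) (N : set T), [/\ forall j, (j <= f j)%N,
    measurable N, mu N = 0%E & forall x, ~ N x -> cvgn (fun j => u (f j) x)].
Proof.
move=> M0 mu_ uK uM u0.
have [U [UU Uoo]] := @ultraFilterLemma nat \oo _.
have FU : Filter U by apply: filter_filter.
(* The covers of step [j]. With [eta = e j], this value of [D] makes the coefficient eta^(1 - p) / D
   of the seminorm in [cells_bound] equal to [e j]. *)
pose fam j := [set nQ : {n & 'I_n -> set T} |
  [/\ forall i, measurable (projT2 nQ i), forall i, (0 < mu (projT2 nQ i) < +oo)%E,
      forall x, Om x -> exists i, projT2 nQ i x &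
      forall i x y, projT2 nQ i x -> projT2 nQ i y -> x <> y ->
        e j `^ (1 - p) / e j <= k x y * fine (mu (projT2 nQ i))]].
have /choice [F FP] : forall j, exists nQ, fam j nQ.
  move=> j; have [|n [Q HQ]] := kcells (D := e j `^ (1 - p) / e j).
    by rewrite divr_gt0// powR_gt0.
  by exists (existT _ n Q).
pose n_ j := projT1 (F j); pose Q j : 'I_(n_ j) -> set T := projT2 (F j).
have mQ j i : measurable (Q j i) by have [H _ _ _] := FP j; exact: H.
pose I j i m := fine (\int[mu]_(x in Q j i) (u m x)%:E)%E.
have Ibnd j i m : `|I j i m| <= K by exact: norm_integral_le_mass1.
have /choice [L LP] : forall ji : {j & 'I_(n_ j)}, exists l : R,
    forall t, 0 < t -> U [set m | `|I (projT1 ji) (projT2 ji) m - l| < t].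
  by move=> [j i]; exact: ultra_bounded_cvg (Ibnd j i).
(* The tolerance is divided by the number of cells plus one, so that the errors of all cells
   together stay below [e j]. *)
pose G j := [set m | forall i, `|I j i m - L (existT _ j i)| < e j / (n_ j).+1%:R].
have UG j : U (G j).
  apply: filter_forall => i; apply: (LP (existT _ j i)).
  by rewrite divr_gt0.
(* The increment from [f j] to [f j.+1] is estimated with the cover [j], so both indices must be in
   [G j]; for [f j.+1] this is the condition on the predecessor. *)
have /choice [f fP] : forall j, exists m, [/\ (j <= m)%N, G j m & G j.-1 m].
  move=> j; have Uj : U [set m | (j <= m)%N] by apply: Uoo; exact: nbhs_infty_ge.
  have UI : U ([set m | (j <= m)%N] `&` G j `&` G j.-1).
    by apply: filterI; [apply: filterI|].
  have [m [[? ?] ?]] := filter_ex UI.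
  by exists m.
pose g j x := u (f j.+1) x - u (f j) x.
have mg j : measurable_fun setT (g j) by exact: measurable_funB.
have muL n : (mass mu 1 (u n) < +oo)%E by rewrite (le_lt_trans (uK n)) ?ltry.
have gL j : (mass mu 1 (g j) < +oo)%E.
  rewrite massW; apply: (@wint_dominated _ _ _ _ _ _ _ _ _ (u (f j.+1)) (u (f j))) => //.
  - by move=> x; rewrite -(normrN (u (f j) x)); exact: ler_normD.
  - by rewrite -massW.
  - by rewrite -massW.
pose C : R := 2 + fine (mu Om) + 2 `^ p * (M + M).
have muOm : mu Om \is a fin_num by rewrite ge0_fin_numE.
have C0 : 0 <= C by rewrite /C !addr_ge0// ?fine_ge0// mulr_ge0 ?powR_ge0 ?addr_ge0.
have bound j : (\int[mu]_(x in Om) `|g j x|%:E <= (C * e j)%:E)%E.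
  have [_ Q0 cQ kQ] := FP j.
  have := cells_bound k0 mk p2 mOm (mg j) (gL j) (e0 j)
    (divr_gt0 (powR_gt0 (1 - p) (e0 j)) (e0 j)) (mQ j) Q0 cQ kQ.
  move/le_trans; apply.
  rewrite (_ : C * e j = e j * 2 + e j * fine (mu Om) + e j * (2 `^ p * (M + M))); last first.
    by rewrite /C; ring.
  rewrite !EFinD; apply: leeD; first apply: leeD.
  - have iE i : `|(\int[mu]_(x in Q j i) (g j x)%:E)%E|%E =
        `|I j i (f j.+1) - I j i (f j)|%:E.
      have iu n : mu.-integrable (Q j i) (EFin \o u n).
        by apply: integrableS (integrable_mass1 (mu_ n) (muL n)).
      rewrite /g; under eq_integral do rewrite EFinB.
      rewrite (integralB (mQ j i) (iu _) (iu _)).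
      by rewrite -(fineK (integrable_fin_num (mQ j i) (iu (f j.+1))))
        -(fineK (integrable_fin_num (mQ j i) (iu (f j)))).
    apply: (@le_trans _ _ (\sum_(i < n_ j) (e j / (n_ j).+1%:R * 2)%:E)%E).
      apply: lee_sum => i _; rewrite iE lee_fin.
      have [_ /(_ i) H1 _] := fP j; have [_ _ /(_ i) H2] := fP j.+1.
      rewrite (_ : _ - _ = (I j i (f j.+1) - L (existT _ j i)) -
        (I j i (f j) - L (existT _ j i))); last by ring.
      by apply: (le_trans (ler_normB _ _)); rewrite mulr_natr mulr2n lerD// ltW.
    rewrite sumEFin lee_fin sumr_const card_ord -mulrnAl ler_wpM2r//.
    rewrite -mulr_natr mulrAC -mulrA ler_piMr ?(ltW (e0 j))//.
    by rewrite ler_pdivrMr// mul1r ler_nat.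
  - by rewrite EFinM fineK.
  - rewrite invf_div mulrCA divff ?mulr1; last by rewrite gt_eqF ?powR_gt0.
    by rewrite EFinM lee_wpmul2l ?lee_fin ?(ltW (e0 j))//; exact: gagB_le.
have mgO j : measurable_fun Om (fun x => `|g j x|%:E).
  by apply/measurable_EFinP; apply: measurable_funTS; exact: measurableT_comp.
pose S x := (\sum_(0 <= j <oo) `|g j x|%:E)%E.
have S0 x : (0 <= S x)%E by apply: nneseries_ge0 => n _ _; rewrite lee_fin.
have iS : mu.-integrable Om S.
  apply/integrableP; split; first exact: ge0_emeasurable_sum.
  under eq_integral do rewrite gee0_abs//.
  rewrite integral_nneseries//; apply: (@le_lt_trans _ _ (C * 2)%:E); last exact: ltry.
  apply: lime_le.
    by apply: is_cvg_nneseries => n _ _; apply: integral_ge0 => x _; rewrite lee_fin.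
  apply: nearW => n; apply: (@le_trans _ _ (\sum_(0 <= i < n) (C * e i)%:E)%E).
    by apply: lee_sum => i _.
  rewrite sumEFin lee_fin -mulr_sumr ler_wpM2l//.
  under eq_bigr do rewrite /e -exprVn.
  apply: (le_trans (geometric_partial_sum_le _ _ _)).
  - by rewrite invr_ge0.
  - by rewrite invf_lt1 ?ltr1n.
  - by rewrite (_ : 1 - 2^-1 = 2^-1) ?invrK//; lra.
have [N [mN N0 sN]] := integrable_ae mOm iS.
exists f, N; split => //; first by move=> j; have [] := fP j.
move=> x /(contra_not (@sN x)) /contrapT /= H.
have [/H xfin|Ox] := pselect (Om x).
  by apply: cvg_of_summable_increments; rewrite -ge0_fin_numE//; exact: S0.
rewrite (_ : (fun j => u (f j) x) = cst 0); first exact: is_cvg_cst.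
by apply/funext => j; exact: u0.
Qed.

End compact_sequences.

(** * Lower semicontinuity, truncation and level sets *)

Section fatou_eventually.
Context d (X : measurableType d) (R : realType) (nu : {measure set X -> \bar R}).
Variable rho : X -> R.
Hypotheses (rho0 : forall x, 0 <= rho x) (mrho : measurable_fun setT rho).

(** Fatou's lemma in a form that holds for all large indices, so that it can be combined with other
    such conditions at one index. If it failed, a choice of indices [g n >= n] with too small
    integrals would contradict [wint_fatou]. *)
Lemma wint_fatou_near P (a_ : nat -> X -> R) a (M delta : R) : 0 <= P ->
  (forall n, measurable_fun setT (a_ n)) ->
  (forall x, a_ ^~ x @ \oo --> a x) ->
  (forall n, (wint nu rho P (a_ n) <= M%:E)%E) -> 0 < delta ->
  \forall n \near \oo, fine (wint nu rho P a) - delta <= fine (wint nu rho P (a_ n)).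
Proof.
move=> P0 ma a_a aM delta0; apply: contrapT => notnear.
have aL : (wint nu rho P a <= M%:E)%E.
  by apply: (wint_fatou rho0 mrho P0 ma a_a aM); exact: cvg_cst.
have Wfin b : (wint nu rho P b <= M%:E)%E -> wint nu rho P b \is a fin_num.
  by move=> bM; apply: wint_fin_num => //; apply: le_lt_trans bM (ltry _).
have /choice [g gP] : forall n, exists m, (n <= m)%N /\
    fine (wint nu rho P (a_ m)) < fine (wint nu rho P a) - delta.
  move=> n; apply: contrapT => H; apply: notnear; exists n => // m /= nm.
  by rewrite leNgt; apply/negP => ma_; apply: H; exists m.
have : (wint nu rho P a <= (fine (wint nu rho P a) - delta)%:E)%E.
  apply: (@wint_fatou _ _ _ _ _ rho0 mrho P (a_ \o g) a
    (cst (fine (wint nu rho P a) - delta))) => //.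
  - by move=> n; exact: ma.
  - move=> x A /a_a [n _ nA]; exists n => // m /= nm; apply: nA.
    by have [gm _] := gP m; exact: leq_trans nm gm.
  - by move=> n; rewrite -(fineK (Wfin _ (aM (g n)))) lee_fin ltW//; have [] := gP n.
  - exact: cvg_cst.
by rewrite -{1}(fineK (Wfin _ aL)) lee_fin leNgt ltrBlDr ltrDl delta0.
Qed.

End fatou_eventually.

Section mass_estimates.
Context d (T : measurableType d) (R : realType) (mu : {measure set T -> \bar R}).
Implicit Types (u : T -> R) (q L m : R).

Lemma massZ q (c : R) u : measurable_fun setT u ->
  mass mu q (fun x => c * u x) = ((`|c| `^ q)%:E * mass mu q u)%E.
Proof. by move=> mu_; rewrite !massW; apply: wintZ. Qed.

Lemma mass_ge0 q u : (0 <= mass mu q u)%E.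
Proof. by rewrite massW; exact: wint_ge0. Qed.

Lemma measurable_powR_norm q u : measurable_fun setT u ->
  measurable_fun setT (fun x => `|u x| `^ q).
Proof.
by move=> mu_; apply: (measurableT_comp (measurable_powR _)); exact: measurableT_comp.
Qed.

Lemma massE q u : mass mu q u = (\int[mu]_x (`|u x| `^ q)%:E)%E.
Proof. by rewrite massW; apply: eq_integral => x _; rewrite mulr1. Qed.

Lemma powR_large q q1 L (t : R) : 0 < L -> 0 < q -> q < q1 -> L <= t ->
  t `^ q <= L `^ (q - q1) * t `^ q1.
Proof.
move=> L0 q0 qq Lt; have t0 : 0 < t by exact: lt_le_trans Lt.
have -> : t `^ q = t `^ (q - q1) * t `^ q1.
  by rewrite -powRD ?subrK// (gt_eqF t0) implybT.
rewrite ler_wpM2r ?powR_ge0// -(opprB q1) !powRN lef_pV2 ?posrE ?powR_gt0//.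
by apply: ge0_ler_powR; rewrite ?nnegrE ?subr_ge0 ?(ltW L0) ?(ltW t0) ?(ltW qq).
Qed.

(** Above the height [L], t^q <= L^(q - q1) t^q1. A bound on a slightly higher mass thus makes the
    tail uniformly small, and the truncated part is bounded, as dominated convergence requires. *)
Lemma mass_truncation q q1 L u : measurable_fun setT u -> (forall x, 0 <= u x) ->
  0 < L -> 0 < q -> q < q1 ->
  (mass mu q u <= mass mu q (fun x => Num.min (u x) L) +
     (L `^ (q - q1))%:E * mass mu q1 u)%E.
Proof.
move=> mu_ u0 L0 q0 qq; rewrite !massE.
have mm : measurable_fun setT (fun x => Num.min (u x) L) by exact: measurable_minr.
have mE (v : T -> R) (s : R) : measurable_fun setT v ->
    measurable_fun setT (fun x => (`|v x| `^ s)%:E).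
  by move=> mv; apply/measurable_EFinP; exact: measurable_powR_norm.
have p0 (v : T -> R) (s : R) x : (0 <= (`|v x| `^ s)%:E)%E.
  by rewrite lee_fin powR_ge0.
have c0 : (0 <= (L `^ (q - q1))%:E)%E by rewrite lee_fin powR_ge0.
rewrite -(ge0_integralZl mu measurableT (mE _ q1 mu_) (fun x _ => p0 u q1 x) c0).
rewrite -(ge0_integralD mu measurableT (fun x _ => p0 _ q x) (mE _ q mm) _
  (measurable_funeM _ (mE _ q1 mu_))); last by move=> x _; exact: mule_ge0.
apply: ge0_le_integral => //.
- exact: mE.
- by apply: emeasurable_funD; [exact: mE|apply: measurable_funeM; exact: mE].
move=> x _; rewrite -EFinM -EFinD lee_fin.
have [uL|Lu] := leP (u x) L.
  by rewrite lerDl mulr_ge0 ?powR_ge0.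
rewrite (ger0_norm (u0 x)); apply: (@le_trans _ _ (L `^ (q - q1) * u x `^ q1)).
  by apply: powR_large => //; exact: ltW.
by rewrite lerDr powR_ge0.
Qed.

(** The [q]-mass is split at the heights [m] and [L]. The values of [m] and [L] make the low part
    m^q V and the tail L^(q - q1) K at most 1/4 each, so the middle part, at most L^q times the
    measure of the level set, keeps at least 1/2. *)
Lemma measure_level_lower_bound q q1 u (V K m L : R) : measurable_fun setT u ->
  0 < q -> q < q1 -> 0 <= V -> 0 <= K ->
  (mu [set x | (0 < `|u x|)%R] <= V%:E)%E -> (mass mu q1 u <= K%:E)%E ->
  (1 <= mass mu q u)%E ->
  m = (4 * (V + 1)) `^ (- q^-1) -> L = (4 * (K + 1)) `^ (q1 - q)^-1 ->
  ((2 * L `^ q)^-1%:E <= mu [set x | (m < `|u x|)%R])%E.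
Proof.
move=> mu_ q0 qq V0 K0 uV uK u1 mE_ LE.
have V4 : 0 < 4 * (V + 1) by rewrite mulr_gt0 ?ltr_wpDl.
have K4 : 0 < 4 * (K + 1) by rewrite mulr_gt0 ?ltr_wpDl.
have q1q : 0 < q1 - q by rewrite subr_gt0.
have m0 : 0 < m by rewrite mE_ powR_gt0.
have L0 : 0 < L by rewrite LE powR_gt0.
have mq : m `^ q * V <= 4^-1.
  rewrite mE_ -powRrM mulNr mulVf ?gt_eqF// powR_inv1 ?(ltW V4)//.
  rewrite invfM -mulrA ler_piMr ?invr_ge0// ler_pdivrMl ?ltr_wpDl// mulr1 lerDl//.
have Lq : L `^ (q - q1) * K <= 4^-1.
  rewrite LE -powRrM -(opprB q1) mulrN mulVf ?gt_eqF// powR_inv1 ?(ltW K4)//.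
  rewrite invfM -mulrA ler_piMr ?invr_ge0// ler_pdivrMl ?ltr_wpDl// mulr1 lerDl//.
set E := [set x | _]; set F := [set x | _] in uV.
have mE : measurable E by exact: measurable_norm_gt.
have mF : measurable F by exact: measurable_norm_gt.
have mi (A : set T) : measurable A -> measurable_fun setT (fun x => (\1_A x : R)%:E).
  by move=> mA; apply/measurable_EFinP/measurable_indic.
have mq1 : measurable_fun setT (fun x => (`|u x| `^ q1)%:E).
  by apply/measurable_EFinP; exact: measurable_powR_norm.
have c0 (s t : R) : (0 <= (s `^ t)%:E)%E by rewrite lee_fin powR_ge0.
have i0 (A : set T) x : (0 <= (\1_A x : R)%:E)%E by rewrite lee_fin.
have pw x : ((`|u x| `^ q)%:E <= (m `^ q)%:E * (\1_F x)%:E +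
    ((L `^ q)%:E * (\1_E x)%:E + (L `^ (q - q1))%:E * (`|u x| `^ q1)%:E))%E.
  rewrite -!EFinM -!EFinD lee_fin !indicE.
  have X0 : 0 <= L `^ (q - q1) * `|u x| `^ q1 by rewrite mulr_ge0 ?powR_ge0.
  have Y0 : 0 <= L `^ q by rewrite powR_ge0.
  have Z0 : 0 <= m `^ q by rewrite powR_ge0.
  have b0 b : 0 <= (b%:R : R) by [].
  have [ux|ux] := leP `|u x| m.
    have [u_0|u_0] := eqVneq (u x) 0.
      by rewrite u_0 normr0 powR0 ?gt_eqF// !addr_ge0 ?mulr_ge0 ?powR_ge0.
    rewrite [x \in F]mem_set /F/= ?normr_gt0// mulr1.
    apply: (@le_trans _ _ (m `^ q)); last by rewrite lerDl addr_ge0// mulr_ge0.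
    by apply: ge0_ler_powR; rewrite ?nnegrE ?(ltW q0) ?(ltW m0).
  rewrite [x \in E]mem_set// mulr1.
  apply: (@le_trans _ _ (L `^ q + L `^ (q - q1) * `|u x| `^ q1)); last first.
    by rewrite lerDr mulr_ge0.
  have [uL|Lu] := leP `|u x| L.
    apply: (@le_trans _ _ (L `^ q)); last by rewrite lerDl.
    by apply: ge0_ler_powR; rewrite ?nnegrE ?(ltW q0) ?(ltW L0).
  apply: (@le_trans _ _ (L `^ (q - q1) * `|u x| `^ q1)); last by rewrite lerDr.
  by apply: powR_large => //; exact: ltW.
have : (mass mu q u <= (m `^ q)%:E * mu F + ((L `^ q)%:E * mu E +
    (L `^ (q - q1))%:E * mass mu q1 u))%E.
  have iE (A : set T) : measurable A -> mu A = (\int[mu]_x (\1_A x : R)%:E)%E.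
    by move=> mA; rewrite integral_indic// setIT.
  rewrite !massE (iE E mE) (iE F mF).
  rewrite -(ge0_integralZl mu measurableT (mi F mF) (fun x _ => i0 F x) (c0 m q)).
  rewrite -(ge0_integralZl mu measurableT (mi E mE) (fun x _ => i0 E x) (c0 L q)).
  rewrite -(ge0_integralZl mu measurableT mq1 (fun x _ => c0 `|u x| q1) (c0 L (q - q1))).
  have mf1 := measurable_funeM (m `^ q)%:E (mi _ mF).
  have mf2 := measurable_funeM (L `^ q)%:E (mi _ mE).
  have mf3 := measurable_funeM (L `^ (q - q1))%:E mq1.
  rewrite -(ge0_integralD _ measurableT _ mf2 _ mf3); last 2 first.
  - by move=> x _; rewrite mule_ge0.
  - by move=> x _; rewrite mule_ge0.
  rewrite -(ge0_integralD _ measurableT _ mf1 _ (emeasurable_funD mf2 mf3)); last 2 first.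
  - by move=> x _; rewrite mule_ge0.
  - by move=> x _; rewrite adde_ge0// mule_ge0.
  apply: ge0_le_integral => //.
  - by apply/measurable_EFinP; exact: measurable_powR_norm.
  - exact: (emeasurable_funD mf1 (emeasurable_funD mf2 mf3)).
have [->|Eoo] := eqVneq (mu E) +oo%E; first by rewrite leey.
have Efin : mu E \is a fin_num by rewrite ge0_fin_numE// ltey.
move=> /(le_trans u1) H.
have {}H : (1 <= (m `^ q)%:E * V%:E + ((L `^ q)%:E * mu E + (L `^ (q - q1))%:E * K%:E))%E.
  by apply: (le_trans H); apply: leeD; [|apply: leeD => //]; rewrite lee_wpmul2l.
rewrite -(fineK Efin) lee_fin; move: H; rewrite -(fineK Efin) -!EFinM -!EFinD lee_fin => H.
by rewrite invfM ler_pdivrMr ?powR_gt0// mulrC; lra.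
Qed.

End mass_estimates.

(** * Ground states *)

(** No integrability of |u|^p is imposed: for [Om] of finite measure it follows from the finite
    seminorm through the embedding. *)
Definition admissible d (T : measurableType d) (R : realType)
    (mu : {sigma_finite_measure set T -> \bar R}) (k : T -> T -> R) (p : R)
    (Om : set T) (u : T -> R) : Prop :=
  [/\ measurable_fun setT u, (gag mu k p u < +oo)%E &
      {ae mu, forall x, ~ Om x -> u x = 0}].

Section ground_state.
Context d (T : measurableType d) (R : realType).
Variables (mu : {sigma_finite_measure set T -> \bar R}) (k : T -> T -> R).
Variables (p r c theta : R) (Om : set T).
Hypotheses (k0 : forall x y, 0 <= k x y)
  (mk : measurable_fun setT (fun z : T * T => k z.1 z.2)).
Hypotheses (p2 : 2 <= p) (pr : p - 1 < r) (c0 : 0 < c).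
Hypotheses (theta0 : 0 < theta) (theta1 : theta < 1).
Hypothesis rcrit : r + 1 < sobolev_exp p theta.
Hypothesis ktail : forall (E : set T) (x : T), measurable E -> E x ->
  (0 < mu E)%E -> (mu E < +oo)%E ->
  ((c * (fine (mu E)) `^ (- theta))%:E <= \int[mu]_(y in ~` E) (k x y)%:E)%E.
Hypotheses (mOm : measurable Om) (Omoo : (mu Om < +oo)%E).
Hypothesis kcells : forall D : R, 0 < D -> exists n (Q : 'I_n -> set T),
  [/\ forall i, measurable (Q i), forall i, (0 < mu (Q i) < +oo)%E,
      forall x, Om x -> exists i, Q i x &
      forall i x y, Q i x -> Q i y -> x <> y -> D <= k x y * fine (mu (Q i))].
Implicit Types (u v w : T -> R).

Ltac slra := move: p2 pr c0 theta0 theta1; lra.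

Local Notation adm := (admissible mu k p Om).
Local Notation gagr u := (fine (gag mu k p u)).
Local Notation massr q u := (fine (mass mu q u)).

Definition energy eps u t :=
  nehari p r eps (gagr u) (massr 1 u) (massr (r + 1) u) t.

Let V : R := fine (mu Om).

Let VE : V%:E = mu Om. Proof. by rewrite /V fineK// ge0_fin_numE. Qed.

Let V0 : 0 <= V. Proof. by rewrite /V fine_ge0. Qed.

Let p0 : 0 <= p. Proof. slra. Qed.

Let kk0 : forall z : T * T, 0 <= k z.1 z.2. Proof. by []. Qed.

Lemma gag_ge0 u : (0 <= gag mu k p u)%E. Proof. by rewrite gagE; exact: wint_ge0. Qed.

Lemma gagZ (s : R) u : measurable_fun setT u ->
  gag mu k p (fun x => s * u x) = ((`|s| `^ p)%:E * gag mu k p u)%E.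
Proof.
move=> mu_; rewrite !gagE -(wintZ _ kk0 mk p s (measurable_gag_diff mu_)).
by congr wint; apply/funext => z; rewrite mulrBr.
Qed.

Lemma adm_support u : adm u -> (mu [set x | (0 < `|u x|)%R] <= V%:E)%E.
Proof.
move=> [mu_ _ [N [mN N0 sN]]]; rewrite VE.
have mF : measurable [set x | (0 < `|u x|)%R] by exact: measurable_norm_gt.
apply: (@le_trans _ _ (mu (Om `|` N))).
  apply: le_measure; rewrite ?inE//; first exact: measurableU.
  move=> x /= ux; apply: contrapT => /not_orP[nO nN].
  have /(contra_not (@sN x)) /contrapT /(_ nO) u0 := nN.
  by move: ux; rewrite u0 normr0 ltxx.
apply: (le_trans (measureU2 mu mOm mN)); rewrite -[leRHS]adde0.
by apply: leeD => //; rewrite le_eqVlt; apply/orP; left; apply/eqP; exact: N0.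
Qed.

Lemma gagrK u : (gag mu k p u < +oo)%E -> (gagr u)%:E = gag mu k p u.
Proof. by move=> uL; rewrite fineK// ge0_fin_numE// gag_ge0. Qed.

Lemma gagr_ge0 u : 0 <= gagr u. Proof. by rewrite fine_ge0// gag_ge0. Qed.

Lemma massr_ge0 q u : 0 <= massr q u. Proof. by rewrite fine_ge0// mass_ge0. Qed.

Lemma adm_mass_le q u M : 0 < q -> q < sobolev_exp p theta -> 0 <= M -> adm u ->
  (gag mu k p u <= M%:E)%E -> (mass mu q u <= (moment_const p c theta q V M)%:E)%E.
Proof.
move=> q0 qs M0 au uM; have [mu_ _ _] := au.
by apply: mass_le_moment_const => //; exact: adm_support.
Qed.

Lemma adm_mass_lty q u : 0 < q -> q < sobolev_exp p theta -> adm u ->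
  (mass mu q u < +oo)%E.
Proof.
move=> q0 qs au; have [_ uL _] := au.
apply: (le_lt_trans (adm_mass_le q0 qs (gagr_ge0 u) au _)); last exact: ltry.
by rewrite gagrK.
Qed.

Let q01 : 0 < 1 :> R. Proof. by []. Qed.
Let q0r : 0 < r + 1. Proof. slra. Qed.
Let sob1 : 1 < sobolev_exp p theta. Proof. move: rcrit; slra. Qed.
Local Hint Resolve q01 q0r sob1 rcrit : core.

Lemma massrK q u : 0 < q -> q < sobolev_exp p theta -> adm u ->
  (massr q u)%:E = mass mu q u.
Proof.
by move=> q0 qs au; rewrite fineK// ge0_fin_numE ?mass_ge0//; exact: adm_mass_lty.
Qed.

Lemma admZ (s : R) u : adm u -> adm (fun x => s * u x).
Proof.
move=> [mu_ uL u0]; split; first exact: measurable_funM.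
- by rewrite gagZ// lte_mul_pinfty// lee_fin powR_ge0.
- by apply: filterS u0 => x H /H ->; rewrite mulr0.
Qed.

Lemma gagrZ (s : R) u : adm u -> gagr (fun x => s * u x) = `|s| `^ p * gagr u.
Proof. by move=> [mu_ uL _]; rewrite gagZ// fineM// ge0_fin_numE// gag_ge0. Qed.

Lemma massrZ q (s : R) u : 0 < q -> q < sobolev_exp p theta -> adm u ->
  massr q (fun x => s * u x) = `|s| `^ q * massr q u.
Proof.
move=> q0 qs au; have [mu_ _ _] := au.
by rewrite massZ// fineM// ge0_fin_numE ?mass_ge0//; exact: adm_mass_lty.
Qed.

Lemma energyZ eps (s t : R) u : adm u -> 0 <= s -> 0 <= t ->
  energy eps (fun x => s * u x) t = energy eps u (s * t).
Proof.
move=> au s0 t0; rewrite /energy /nehari gagrZ// !massrZ//.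
by rewrite ger0_norm// powRr1// !powRM//; ring.
Qed.

Lemma nehari_critZ eps (s : R) u : adm u -> 0 < s ->
  nehari_crit p r eps (gagr u) (massr 1 u) (massr (r + 1) u) s ->
  nehari_crit p r eps (gagr (fun x => s * u x)) (massr 1 (fun x => s * u x))
    (massr (r + 1) (fun x => s * u x)) 1.
Proof.
have pp : 1 <= p by slra.
have rr : 1 <= r + 1 by slra.
move=> au s0; rewrite /nehari_crit.
rewrite gagrZ//.
rewrite (massrZ s q01 sob1 au).
rewrite (massrZ s q0r rcrit au).
rewrite !powR1 !mulr1.
rewrite gtr0_norm//.
rewrite powRr1 ?(ltW s0)//.
rewrite (powRS (ltW s0) pp) (powRS (ltW s0) rr).
rewrite addrK => H.
rewrite (_ : s * s `^ r * _ = s * (massr (r + 1) u * s `^ r)); last by ring.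
by rewrite -H; ring.
Qed.

(** Taking absolute values does not increase differences, and multiplying by the indicator changes
    the function on a null set only. Competitors may thus be taken nonnegative and zero at every
    point outside [Om]. *)
Lemma abs_restrict_adm u : adm u ->
  [/\ adm (fun x => `|u x| * \1_Om x),
    (gag mu k p (fun x => `|u x| * \1_Om x)%R <= gag mu k p u)%E &
    forall q, mass mu q (fun x => `|u x| * \1_Om x)%R = mass mu q u].
Proof.
move=> [mu_ uL u0].
have ma : measurable_fun setT (fun x => `|u x|) by exact: measurableT_comp.
have mv : measurable_fun setT (fun x => `|u x| * \1_Om x).
  by apply: measurable_funM => //; exact: measurable_indic.
have uv : {ae mu, forall x, `|u x| * \1_Om x = `|u x|}.
  apply: filterS u0 => x H; rewrite indicE; have [xO|xO] := boolP (x \in Om).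
    by rewrite mulr1.
  by rewrite H ?normr0 ?mul0r//; move: xO; rewrite notin_setE.
have gle : (gag mu k p (fun x => `|u x| * \1_Om x)%R <= gag mu k p u)%E.
  rewrite (gag_ae_eq _ k0 mk mv ma uv).
  rewrite !gagE; apply: (le_wint _ kk0 mk p0 (measurable_gag_diff ma) (measurable_gag_diff mu_)).
  by move=> z; exact: ler_dist_dist.
split => //.
- split => //; first exact: le_lt_trans gle uL.
  by apply: filterS u0 => x _ xO; rewrite indicE memNset ?mulr0.
- move=> q; rewrite (mass_ae_eq _ mv ma uv) !massE; apply: eq_integral => x _.
  by rewrite normr_id.
Qed.

(** A second subcritical exponent strictly above r + 1, which controls the tails of the (r +
    1)-mass. *)
Let q1 : R := (r + 1 + sobolev_exp p theta) / 2.
Let rq1 : r + 1 < q1. Proof. by rewrite /q1; move: rcrit; lra. Qed.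
Let q1s : q1 < sobolev_exp p theta. Proof. by rewrite /q1; move: rcrit; lra. Qed.
Let q10 : 0 < q1. Proof. exact: lt_trans rq1. Qed.

Let K M : R := Num.max 0 (moment_const p c theta q1 V M).

Let K0 M : 0 <= K M. Proof. by rewrite /K le_max lexx. Qed.

Let mass_q1_le u M : 0 <= M -> adm u -> (gag mu k p u <= M%:E)%E ->
  (mass mu q1 u <= (K M)%:E)%E.
Proof.
move=> M0 au uM; apply: (le_trans (adm_mass_le q10 q1s M0 au uM)).
by rewrite lee_fin /K le_max lexx orbT.
Qed.

(** The seminorm and the mass enter the energy with a plus sign, so Fatou's lemma suffices for them.
    The (r + 1)-mass enters with a minus sign and must not drop in the limit; almost everywhere
    convergence and the uniform control of tails prevent that. *)
Lemma minimizing_limit eps (b M : R) (u_ : nat -> T -> R) : 0 <= eps -> 0 <= M ->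
  (forall n, adm (u_ n)) -> (forall n, massr (r + 1) (u_ n) = 1) ->
  (forall n, gagr (u_ n) <= M) ->
  (forall n t, 0 <= t -> energy eps (u_ n) t <= b + n.+1%:R^-1) ->
  exists w, [/\ adm w, (forall x, 0 <= w x) /\ (forall x, ~ Om x -> w x = 0),
    gagr w <= M, 1 <= massr (r + 1) w & forall t, 0 <= t -> energy eps w t <= b].
Proof.
move=> eps0 M0 au_ u1 uM uE.
pose v_ n x := `|u_ n x| * \1_Om x.
have av n : adm (v_ n) by have [] := abs_restrict_adm (au_ n).
have vg n : gagr (v_ n) <= gagr (u_ n).
  have [_ H _] := abs_restrict_adm (au_ n); have [_ uL _] := au_ n; have [_ vL _] := av n.
  by rewrite -lee_fin !gagrK.
have vm q n : massr q (v_ n) = massr q (u_ n).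
  by have [_ _ H] := abs_restrict_adm (au_ n); rewrite /v_ H.
have vM n : (gag mu k p (v_ n) <= M%:E)%E.
  by have [_ vL _] := av n; rewrite -gagrK// lee_fin (le_trans (vg n)).
have mv n : measurable_fun setT (v_ n) by have [] := av n.
have v0 n x : 0 <= v_ n x by rewrite /v_ mulr_ge0.
have vO n x : ~ Om x -> v_ n x = 0 by move=> xO; rewrite /v_ indicE memNset ?mulr0.
have [f [N [fj mN N0 cN]]] := gag_compact k0 mk p2 mOm Omoo kcells M0 mv
  (fun n => adm_mass_le q01 sob1 M0 (av n) (vM n)) vM vO.
(* Setting the functions to 0 on the exceptional null set makes them converge at every point and
   changes neither seminorm nor masses. *)
pose z_ j x := v_ (f j) x * \1_(~` N) x.
have mz j : measurable_fun setT (z_ j).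
  by apply: measurable_funM => //; apply: measurable_indic; exact: measurableC.
have zv j : {ae mu, forall x, z_ j x = v_ (f j) x}.
  exists N; split => // x /=; apply: contra_notP => Nx.
  by rewrite /z_ indicE mem_set// mulr1.
have z0 j x : 0 <= z_ j x by rewrite /z_ mulr_ge0.
have zO j x : ~ Om x -> z_ j x = 0 by move=> xO; rewrite /z_ vO// mul0r.
have zg j : gag mu k p (z_ j) = gag mu k p (v_ (f j)).
  exact: (gag_ae_eq _ k0 mk (mz j) (mv (f j)) (zv j)).
have zm q j : mass mu q (z_ j) = mass mu q (v_ (f j)).
  exact: (mass_ae_eq _ (mz j) (mv (f j)) (zv j)).
have az j : adm (z_ j).
  split => //; first by rewrite zg; have [_ vL _] := av (f j).
  by apply: nearW => x; exact: zO.
pose w x := lim (z_ ^~ x @ \oo).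
have zw x : z_ ^~ x @ \oo --> w x.
  have [Nx|Nx] := pselect (N x).
    have zx : z_ ^~ x = cst 0.
      by apply/funext => j; rewrite /z_ indicE memNset ?mulr0//; exact.
    by rewrite /w zx; exact: is_cvg_cst.
  have zx : z_ ^~ x = (fun j => v_ (f j) x).
    by apply/funext => j; rewrite /z_ indicE mem_set ?mulr1.
  by rewrite /w zx; exact: cN.
have mw : measurable_fun setT w.
  by apply: (@measurable_fun_cvg _ _ _ _ z_) => // x _; exact: zw.
have w0 x : 0 <= w x.
  by apply: limr_ge; [apply/cvg_ex; exists (w x); exact: zw|exact: nearW].
have wO x : ~ Om x -> w x = 0.
  move=> xO; rewrite /w (_ : z_ ^~ x = cst 0) ?lim_cst//.
  by apply/funext => j; exact: zO.
have zM j : (gag mu k p (z_ j) <= M%:E)%E by rewrite zg.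
have zM' j : (wint (mu \x mu)%E (fun a => k a.1 a.2) p (fun a => z_ j a.1 - z_ j a.2)%R <= M%:E)%E.
  by rewrite -gagE.
have mdz j := measurable_gag_diff (mz j).
have dzw (a : T * T) : (fun j => z_ j a.1 - z_ j a.2) @ \oo --> w a.1 - w a.2.
  by apply: cvgB; exact: zw.
have wM : (gag mu k p w <= M%:E)%E.
  rewrite gagE; apply: (wint_fatou kk0 mk p0 mdz dzw zM'); exact: cvg_cst.
have aw : adm w.
  split => //; first exact: le_lt_trans wM (ltry _).
  by apply: nearW => x; exact: wO.
have zm1 j : massr (r + 1) (z_ j) = 1 by rewrite zm vm u1.
have zE j t : 0 <= t -> energy eps (z_ j) t <= b + (f j).+1%:R^-1.
  move=> t0; apply: le_trans (uE (f j) t t0).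
  rewrite /energy /nehari zg !zm !vm lerB// lerD2r ler_wpM2r ?powR_ge0//.
  by rewrite ler_wpM2r ?invr_ge0// vg.
(* Truncated at [L], the functions are dominated by [L] times the indicator of [Om]; the tail is at
   most L^(r + 1 - q1) K M, uniformly in [j]. *)
have mass1 : 1 <= massr (r + 1) w.
  have H L : 0 < L -> 1 <= massr (r + 1) w + L `^ (r + 1 - q1) * K M.
    move=> L0; pose zL j x := Num.min (z_ j x) L.
    have mzL j : measurable_fun setT (zL j) by exact: measurable_minr.
    have mwL : measurable_fun setT (fun x => Num.min (w x) L) by exact: measurable_minr.
    have mL1 : measurable_fun setT (fun x => L * \1_Om x : R).
      by apply: measurable_funM => //; exact: measurable_indic.
    have LO : (wint mu (cst 1%R) (r + 1)%R (fun x => L * \1_Om x)%R < +oo)%E.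
      apply: (@le_lt_trans _ _ (\int[mu]_x ((L `^ (r + 1))%:E * (\1_Om x : R)%:E))%E).
        apply: ge0_le_integral => //.
        - by move=> x _; rewrite lee_fin mulr1 powR_ge0.
        - exact: measurable_wint.
        - by apply: measurable_funeM; apply/measurable_EFinP/measurable_indic.
        move=> x _; rewrite lee_fin mulr1 indicE; have [_|_] := boolP (x \in Om).
          by rewrite !mulr1 gtr0_norm.
        by rewrite !mulr0 normr0 powR0// gt_eqF.
      have mi : measurable_fun setT (fun x => (\1_Om x : R)%:E).
        exact/measurable_EFinP/measurable_indic.
      have L00 : (0 <= (L `^ (r + 1))%:E)%E by rewrite lee_fin powR_ge0.
      have i0 x : setT x -> (0 <= (\1_Om x : R)%:E)%E by rewrite lee_fin.
      by rewrite (ge0_integralZl mu measurableT mi i0 L00) integral_indic// setIT lte_mul_pinfty.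
    have O0 : (wint mu (cst 1%R) (r + 1)%R (fun=> 0)%R < +oo)%E.
      rewrite /wint (_ : (fun _ => _) = cst 0%E) ?integral0//.
      by apply/funext => x; rewrite normr0 powR0 ?mul0r// gt_eqF.
    have cL : (fun j => mass mu (r + 1) (zL j)) @ \oo -->
        mass mu (r + 1) (fun x => Num.min (w x) L).
      rewrite massW; under eq_fun do rewrite massW.
      apply: (@wint_dominated_cvg _ _ _ _ _ _ _ _ _ _ (fun x => L * \1_Om x) (fun=> 0)) => //.
      - exact: ltW.
      - move=> x; apply: (@continuous_cvg _ _ _ _ _ (z_ ^~ x) (fun y => Num.min y L)) => //.
        by apply: continuous_min => //; exact: cvg_cst.
      - move=> j x; rewrite normr0 addr0 indicE ger0_norm ?le_min ?z0 ?(ltW L0)//.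
        have [_|] := boolP (x \in Om); first by rewrite mulr1 gtr0_norm// ge_min lexx orbT.
        by rewrite notin_setE => /(zO j) zx; rewrite mulr0 normr0 /zL zx ge_min lexx.
    have lb j : (1 - (L `^ (r + 1 - q1) * K M)%:E <= mass mu (r + 1) (zL j))%E.
      rewrite leeBlDr//; have := mass_truncation mu (mz j) (z0 j) L0 q0r rq1.
      rewrite -massrK// zm1 => /le_trans; apply.
      rewrite leeD2l// EFinM lee_wpmul2l ?lee_fin ?powR_ge0//.
      exact: mass_q1_le.
    have : (1 - (L `^ (r + 1 - q1) * K M)%:E <= mass mu (r + 1) w)%E.
      apply: (@le_trans _ _ (mass mu (r + 1) (fun x => Num.min (w x) L))).
        rewrite -(cvg_lim _ cL)//; apply: lime_ge; first by apply/cvg_ex; eexists; exact: cL.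
        by apply: nearW => j; exact: lb.
      rewrite !massW; apply: le_wint => //; first exact: ltW.
      by move=> x; rewrite !ger0_norm ?le_min ?w0 ?(ltW L0)// ge_min lexx.
    by rewrite -massrK// -EFinB lee_fin lerBlDr.
  rewrite leNgt; apply/negP => lt1.
  have d0 : 0 < 1 - massr (r + 1) w by rewrite subr_gt0.
  (* With this [L] the tail is K M / (K M + 1) times the supposed deficit of the mass, hence
     strictly smaller than it. *)
  pose L := ((K M + 1) / (1 - massr (r + 1) w)) `^ (q1 - (r + 1))^-1.
  have KM0 : 0 < K M + 1 by rewrite ltr_wpDl.
  have L0 : 0 < L by rewrite powR_gt0// divr_gt0.
  have qr0 : 0 < q1 - (r + 1) by rewrite subr_gt0.
  have := H L L0; rewrite -(opprB q1) powRN /L -powRrM mulVf ?gt_eqF//.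
  rewrite powRr1 ?divr_ge0 ?(ltW d0) ?(ltW KM0)// invf_div -lerBlDl mulrAC.
  by rewrite ler_pdivlMr// ler_pM2l// gerDl ler10.
exists w; split => //; first by rewrite -lee_fin gagrK//; have [] := aw.
move=> t t0; apply/ler_addgt0Pr => e e0.
(* An error [e / 2 / ct] in the seminorm and in the mass changes the energy at [t] by at most
   [e / 2]; the summand 1 keeps [ct] positive. *)
pose ct := t `^ p / p + eps * t + 1.
have ct0 : 0 < ct.
  by rewrite ltr_wpDl// addr_ge0 ?mulr_ge0 ?powR_ge0// invr_ge0.
have e20 : 0 < e / 2 / ct by rewrite !divr_gt0.
have nA := wint_fatou_near kk0 mk p0 mdz dzw zM' e20.
have mrho1 : measurable_fun setT (cst 1 : T -> R) by exact: measurable_cst.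
have zB j : (wint mu (cst 1%R) 1 (z_ j) <= (moment_const p c theta 1 V M)%:E)%E.
  by rewrite -massW; exact: adm_mass_le.
have nB := @wint_fatou_near _ _ _ mu (cst 1) (fun=> ler01) mrho1 1 z_ w _ _ ler01 mz zw
  zB e20.
have e2 : 0 < e / 2 by rewrite divr_gt0.
have nC : \forall j \near \oo, (f j).+1%:R^-1 < e / 2 :> R.
  have [m _ mP] := near_infty_natSinv_lt (PosNum e2).
  by exists m => // j /= mj; apply: mP; rewrite /= (leq_trans mj).
have [j [[Aj Bj] Cj]] := filter_ex (filterI (filterI nA nB) nC).
rewrite -!gagE in Aj; rewrite -!massW in Bj.
apply: (@le_trans _ _ (energy eps (z_ j) t + e / 2)); last first.
  apply: (le_trans (lerD (zE j t t0) (lexx _))).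
  by rewrite -addrA lerD2l [leRHS]splitr lerD2r ltW.
have -> : e / 2 = e / 2 / ct * ct by rewrite divfK// gt_eqF.
set dl := e / 2 / ct in Aj Bj e20 *.
have tp0 : 0 <= t `^ p / p by rewrite divr_ge0 ?powR_ge0.
have et0 : 0 <= eps * t by rewrite mulr_ge0.
have tr0 : 0 <= t `^ (r + 1) / (r + 1) by rewrite divr_ge0 ?powR_ge0 ?ltW.
rewrite /energy /nehari zm1 /ct.
have H1 : gagr w * (t `^ p / p) <= (gagr (z_ j) + dl) * (t `^ p / p).
  by rewrite ler_wpM2r// -lerBlDr.
have H2 : massr 1 w * (eps * t) <= (massr 1 (z_ j) + dl) * (eps * t).
  by rewrite ler_wpM2r// -lerBlDr.
have H3 : 1 * (t `^ (r + 1) / (r + 1)) <= massr (r + 1) w * (t `^ (r + 1) / (r + 1)).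
  by rewrite ler_wpM2r.
rewrite -subr_ge0.
rewrite [leRHS](_ : _ = ((gagr (z_ j) + dl) * (t `^ p / p) - gagr w * (t `^ p / p)) +
  ((massr 1 (z_ j) + dl) * (eps * t) - massr 1 w * (eps * t)) +
  (massr (r + 1) w * (t `^ (r + 1) / (r + 1)) - 1 * (t `^ (r + 1) / (r + 1))) + dl); last by ring.
apply: addr_ge0; last exact: ltW.
apply: addr_ge0; last by rewrite subr_ge0.
by apply: addr_ge0; rewrite subr_ge0.
Qed.

Lemma energy0 eps u : energy eps u 0 = 0.
Proof.
rewrite /energy /nehari !powR0 ?mulr0 ?subrr ?addr0 ?subr0//; last 2 first.
- by rewrite gt_eqF.
- by rewrite gt_eqF//; slra.
Qed.

Lemma normalize u : adm u -> 0 < massr (r + 1) u ->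
  let s := massr (r + 1) u `^ (- (r + 1)^-1) in
  [/\ 0 < s, adm (fun x => s * u x) & massr (r + 1) (fun x => s * u x) = 1].
Proof.
move=> au Cu s; have s0 : 0 < s by rewrite powR_gt0.
split => //; first exact: admZ.
rewrite massrZ// gtr0_norm// /s -powRrM mulNr mulVf ?gt_eqF//.
by rewrite powR_inv1 ?(ltW Cu)// mulVf// gt_eqF.
Qed.

(** [measure_level_lower_bound], with the exponents r + 1 and [q1], gives the level set. Then
    [gag_level] between the heights 0 and [m] turns its measure into a lower bound for the seminorm,
    the support having measure at most [V]. *)
Lemma level_bounds M : 0 <= M -> exists m a A1, [/\ 0 < m, 0 < a, 0 < A1 &
  forall u, adm u -> gagr u <= M -> 1 <= massr (r + 1) u ->
    (a%:E <= mu [set x | (m < `|u x|)%R])%E /\ A1 <= gagr u].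
Proof.
move=> M0.
pose m := (4 * (V + 1)) `^ (- (r + 1)^-1).
pose L := (4 * (K M + 1)) `^ (q1 - (r + 1))^-1.
have V1 : 0 < V + 1 by rewrite ltr_wpDl.
have KM1 : 0 < K M + 1 by rewrite ltr_wpDl.
have m0 : 0 < m by rewrite powR_gt0// mulr_gt0.
have L0 : 0 < L by rewrite powR_gt0// mulr_gt0.
pose a := (2 * L `^ (r + 1))^-1.
have a0 : 0 < a by rewrite invr_gt0 mulr_gt0// powR_gt0.
exists m, a, (m `^ p * (c * (V + 1) `^ (- theta)) * a).
have C0 : 0 < m `^ p * (c * (V + 1) `^ (- theta)).
  by apply: mulr_gt0; [exact: powR_gt0|apply: mulr_gt0 => //; exact: powR_gt0].
split => //; first exact: mulr_gt0.
move=> u au uM u1; have [mu_ uL _] := au.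
have uME : (gag mu k p u <= M%:E)%E by rewrite -gagrK// lee_fin.
have ua : (a%:E <= mu [set x | (m < `|u x|)%R])%E.
  apply: (measure_level_lower_bound mu_ q0r rq1 V0 (K0 M) (adm_support au) _ _ erefl erefl).
  - exact: mass_q1_le.
  - by rewrite -massrK// lee_fin.
split => //.
have mF : measurable [set x | (0 < `|u x|)%R] by exact: measurable_norm_gt.
have mE : measurable [set x | (m < `|u x|)%R] by exact: measurable_norm_gt.
have EF : (mu [set x | (m < `|u x|)%R] <= mu [set x | (0 < `|u x|)%R])%E.
  by apply: le_measure; rewrite ?inE// => x /=; exact: lt_trans.
have a0E : (0 < a%:E)%E by rewrite lte_fin.
have F0 := lt_le_trans a0E (le_trans ua EF).
have FV := adm_support au.
have Foo : (mu [set x | (0 < `|u x|)%R] < +oo)%E by rewrite (le_lt_trans FV) ?ltry.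
have := gag_level k0 mk p2 c0 theta0 theta1 ktail mu_ (lexx 0) m0 F0 Foo.
rewrite subr0 -lee_fin (gagrK uL) => /(le_trans _); apply.
have Ffin : mu [set x | (0 < `|u x|)%R] \is a fin_num by rewrite ge0_fin_numE.
have f0 : 0 < fine (mu [set x | (0 < `|u x|)%R]) by rewrite fine_gt0// F0.
have fV : fine (mu [set x | (0 < `|u x|)%R]) <= V by rewrite -lee_fin fineK.
rewrite EFinM; apply: lee_pmul; rewrite ?lee_fin ?(ltW a0) ?(ltW C0)//.
rewrite ler_wpM2l ?powR_ge0// ler_wpM2l ?(ltW c0)// !powRN lef_pV2 ?posrE ?powR_gt0//.
by apply: ge0_ler_powR; rewrite ?nnegrE ?(ltW theta0) ?(ltW f0) ?(ltW V1)//; slra.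
Qed.

Lemma gagr_gt0 u : adm u -> 0 < massr (r + 1) u -> 0 < gagr u.
Proof.
move=> au Cu; have [s0 asu su1] := normalize au Cu.
set su := (fun x => _) in asu su1.
have [m [a [A1 [_ _ A10 H]]]] := level_bounds (gagr_ge0 su).
have [|_ H1] := H su asu (lexx _); first by rewrite su1.
have := lt_le_trans A10 H1; rewrite gagrZ// pmulr_rgt0// powR_gt0// normr_gt0.
by rewrite gt_eqF.
Qed.

Lemma energy_attained eps u : 0 <= eps -> adm u -> 0 < massr (r + 1) u ->
  exists2 t, 0 < t &
    nehari_crit p r eps (gagr u) (massr 1 u) (massr (r + 1) u) t /\
    forall x, 0 <= x -> energy eps u x <= energy eps u t.
Proof.
move=> eps0 au Cu; have Au := gagr_gt0 au Cu.
have [t t0 tcrit] := nehari_crit_exists p2 pr eps0 Au (massr_ge0 1 u) Cu.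
exists t => //; split => // x x0.
by apply: nehari_max => //; [exact: ltW|exact: massr_ge0].
Qed.

(** Competitors are normalised to (r + 1)-mass 1, which by [energyZ] does not change their levels.
    The limit [w0] is then multiplied by its maximising [t], which moves the critical parameter to
    1. Its level set survives the multiplication because [t] is bounded below uniformly in [eps]. *)
Lemma ground_state : (exists u0, adm u0 /\ 0 < massr (r + 1) u0) ->
  exists m a, [/\ 0 < m, 0 < a & forall eps, 0 <= eps <= 1 ->
  exists w, [/\ adm w, (forall x, 0 <= w x) /\ (forall x, ~ Om x -> w x = 0),
    0 < massr (r + 1) w /\
      nehari_crit p r eps (gagr w) (massr 1 w) (massr (r + 1) w) 1,
    forall v y, adm v -> 0 < massr (r + 1) v ->
      (forall t, 0 <= t -> energy eps v t <= y) -> energy eps w 1 <= y &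
    (a%:E <= mu [set x | (m < w x)%R])%E]].
Proof.
move=> [u0 [au0 Cu0]].
have [s0 au1 Cu1] := normalize au0 Cu0.
set u1 := (fun x => _) in au1 Cu1.
have Cu1p : 0 < massr (r + 1) u1 by rewrite Cu1.
have [t1 t10 [_ t1max]] := energy_attained ler01 au1 Cu1p.
(* The energy increases with [eps], so the level of one competitor at [eps = 1] bounds the minimal
   level for all [eps <= 1]. This is why the constants below do not depend on [eps]. *)
pose E1 := energy 1 u1 t1.
have E10 : 0 <= E1 by rewrite -(energy0 1 u1) t1max.
have r10 : 0 <= (r + 1)^-1 by rewrite invr_ge0 ltW.
(* At [t = 1] the energy of a normalised competitor is at least its seminorm over p minus 1 / (r +
   1), while an almost minimiser has level at most [E1 + 1]. *)
pose M := p * (E1 + 1 + (r + 1)^-1).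
have M0 : 0 <= M.
  apply: mulr_ge0 => //; apply: addr_ge0 => //; exact: addr_ge0.
have [m0 [a [A1 [m00 a0 A10 lev]]]] := level_bounds M0.
(* A bound for the (r + 1)-mass. By [nehari_crit_ge], the maximising [t] then has t^e >= A1 / Kr,
   that is [t >= tl]. *)
pose Kr := Num.max 1 (moment_const p c theta (r + 1) V M).
have Kr1 : 1 <= Kr by rewrite /Kr le_max lexx.
have Kr0 : 0 < Kr by exact: lt_le_trans Kr1.
pose e := r - (p - 1); have e0 : 0 < e by rewrite /e; slra.
pose tl := (A1 / Kr) `^ e^-1.
have tl0 : 0 < tl by rewrite powR_gt0// divr_gt0.
exists (tl * m0), a; split => //; first exact: mulr_gt0.
move=> eps /andP[eps0 eps1].
pose S := [set y | exists u, [/\ adm u, massr (r + 1) u = 1 &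
  forall t, 0 <= t -> energy eps u t <= y]].
have SE1 : S E1.
  exists u1; split => // t t0; apply: le_trans (t1max t t0).
  rewrite /energy /nehari lerB// lerD2l -!mulrA ler_wpM2r ?mulr_ge0 ?massr_ge0//.
have Slb : lbound S 0.
  by move=> y [u [_ _ /(_ 0 (lexx _))]]; rewrite energy0.
have Sinf : has_inf S by split; [exists E1|exists 0].
have bE1 : inf S <= E1 by apply: ge_inf => //; exists 0.
have /choice [u_ u_P] : forall n, exists u, [/\ adm u, massr (r + 1) u = 1 &
    forall t, 0 <= t -> energy eps u t <= inf S + n.+1%:R^-1].
  move=> n; have n0 : 0 < n.+1%:R^-1 :> R by rewrite invr_gt0.
  have [y [u [au Cu uE]] yb] := inf_adherent n0 Sinf.
  by exists u; split => // t t0; apply: le_trans (uE t t0) (ltW yb).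
have au_ n : adm (u_ n) by have [] := u_P n.
have Cu_ n : massr (r + 1) (u_ n) = 1 by have [] := u_P n.
have uE n t : 0 <= t -> energy eps (u_ n) t <= inf S + n.+1%:R^-1.
  by have [_ _ H] := u_P n; exact: H.
have pp : 0 < p by slra.
have uM n : gagr (u_ n) <= M.
  have := uE n 1 ler01; rewrite /energy /nehari Cu_ !powR1 !mulr1 => H.
  rewrite /M mulrC -ler_pdivrMr//.
  have n1 : n.+1%:R^-1 <= 1 :> R by rewrite invf_le1// ler1n.
  have B0 : 0 <= eps * massr 1 (u_ n) by rewrite mulr_ge0// massr_ge0.
  rewrite -lerBlDr; apply: le_trans (le_trans H (lerD bE1 n1)).
  by rewrite div1r lerB// lerDl.
have [w0 [aw [w0_ge0 w0O] wM C1 wE]] := minimizing_limit eps0 M0 au_ Cu_ uM uE.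
have Cw : 0 < massr (r + 1) w0 by exact: lt_le_trans C1.
have [la lA] := lev w0 aw wM C1.
have [t t0 [tcrit tmax]] := energy_attained eps0 aw Cw.
have tlt : tl <= t.
  have H := nehari_crit_ge eps0 (massr_ge0 1 w0) Cw t0 tcrit.
  have AK : A1 / Kr <= t `^ e.
    apply: le_trans H; rewrite ler_pM ?invr_ge0 ?(ltW A10) ?(ltW Kr0)//.
    rewrite lef_pV2 ?posrE// /Kr le_max; apply/orP; right.
    rewrite -lee_fin massrK//; apply: adm_mass_le => //.
    by rewrite -gagrK ?lee_fin//; have [] := aw.
  have -> : t = (t `^ e) `^ e^-1 by rewrite -powRrM mulfV ?gt_eqF// powRr1// ltW.
  by apply: ge0_ler_powR; rewrite ?nnegrE ?powR_ge0 ?invr_ge0 ?(ltW e0) ?divr_ge0 ?(ltW A10) ?(ltW Kr0).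
exists (fun x => t * w0 x); split.
- exact: admZ.
- by split => [x|x xO]; [rewrite mulr_ge0// ltW|rewrite w0O// mulr0].
- split; last exact: nehari_critZ.
  by rewrite massrZ// mulr_gt0// powR_gt0// normr_gt0 gt_eqF.
- move=> v y av Cv vy; rewrite energyZ ?(ltW t0)// mulr1.
  apply: (le_trans (wE t (ltW t0))).
  apply: ge_inf; first by exists 0.
  have [sv0 asv sv1] := normalize av Cv.
  exists (fun x => massr (r + 1) v `^ (- (r + 1)^-1) * v x); split => // x x0.
  by rewrite energyZ ?(ltW sv0)//; apply: vy; rewrite mulr_ge0// ltW.
- apply: (le_trans la); apply: le_measure; rewrite ?inE.
  + by apply: measurable_norm_gt; have [] := aw.
  + have [mt _ _] := admZ t aw.
    rewrite (_ : mkset _ = [set x | tl * m0 < `|t * w0 x|]); first exact: measurable_norm_gt.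
    by apply/seteqP; split => x /=; rewrite ger0_norm// mulr_ge0// ltW.
  + move=> x /=; rewrite ger0_norm// => mx.
    apply: (@lt_le_trans _ _ (tl * w0 x)); first by rewrite ltr_pM2l.
    by rewrite ler_wpM2r.
Qed.

(* [w] minimises max_t [energy eps v t] over v, this maximum being attained at t = 1
   for [w]; the maximum for [v] is replaced by its upper bounds [y]. *)
Definition is_minimizer eps w : Prop :=
  [/\ adm w, 0 < massr (r + 1) w,
    nehari_crit p r eps (gagr w) (massr 1 w) (massr (r + 1) w) 1 &
    forall v y, adm v -> 0 < massr (r + 1) v ->
      (forall t, 0 <= t -> energy eps v t <= y) -> energy eps w 1 <= y].

(** An envelope argument. Let [t n] be a maximiser for [v_ n]. The energy of [w] at [t n] is at most
    its energy at 1 by [nehari_max], and this is at most the energy of [v_ n] at [t n] by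
    minimality. The last conclusion is the difference of the two ends; [nehari_crit_cvg] gives the
    limit of [t n]. *)
Lemma variation eps w (v_ : nat -> T -> R) : 0 <= eps -> is_minimizer eps w ->
  (forall n, adm (v_ n)) -> (forall n, 0 < massr (r + 1) (v_ n)) ->
  (fun n => gagr (v_ n)) @ \oo --> gagr w ->
  (fun n => massr 1 (v_ n)) @ \oo --> massr 1 w ->
  (fun n => massr (r + 1) (v_ n)) @ \oo --> massr (r + 1) w ->
  exists t : nat -> R, [/\ forall n, 0 < t n, t @ \oo --> (1 : R) & forall n,
    0 <= (gagr (v_ n) - gagr w) / p * t n `^ p +
      eps * (massr 1 (v_ n) - massr 1 w) * t n -
      (massr (r + 1) (v_ n) - massr (r + 1) w) / (r + 1) * t n `^ (r + 1)].
Proof.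
move=> eps0 [aw Cw crit wmin] av Cv cA cB cC.
have /choice [t tP] : forall n, exists t, [/\ 0 < t,
    nehari_crit p r eps (gagr (v_ n)) (massr 1 (v_ n)) (massr (r + 1) (v_ n)) t &
    forall x, 0 <= x -> energy eps (v_ n) x <= energy eps (v_ n) t].
  by move=> n; have [t t0 [tc tm]] := energy_attained eps0 (av n) (Cv n); exists t.
have t0 n : 0 < t n by have [] := tP n.
exists t; split => //.
  apply: (nehari_crit_cvg p2 pr eps0 _ _ Cv t0 Cw cA cB cC _ crit).
  - by move=> n; exact: gagr_ge0.
  - by move=> n; exact: massr_ge0.
  - by move=> n; have [] := tP n.
move=> n; have [_ _ tm] := tP n.
have H1 : energy eps w (t n) <= energy eps w 1.
  by apply: nehari_max => //; [exact: gagr_ge0|exact: massr_ge0|exact: ltW].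
have H2 : energy eps w 1 <= energy eps (v_ n) (t n) by exact: wmin (av n) (Cv n) tm.
have := le_trans H1 H2; rewrite -subr_ge0 /energy /nehari => /le_trans; apply.
by rewrite le_eqVlt; apply/orP; left; apply/eqP; ring.
Qed.

(** * First variation and the Euler-Lagrange equation *)

Lemma cvg_of_quotient (A : nat -> R) (A0 l : R) (s : nat -> R) :
  (forall n, 0 < s n) -> s @ \oo --> (0 : R) ->
  (fun n => (A n - A0) / s n) @ \oo --> l -> A @ \oo --> A0.
Proof.
move=> s0 sl Al.
rewrite (_ : A = fun n => A0 + (A n - A0) / s n * s n); last first.
  by apply/funext => n; rewrite divfK ?gt_eqF// subrKC.
rewrite -[X in _ --> X]addr0; apply: cvgD; first exact: cvg_cst.
by rewrite -[X in _ --> X](mulr0 l); exact: cvgM.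
Qed.

Lemma harmonic_shift_cvg (N : nat) : (fun n => (n + N).+1%:R^-1 : R) @ \oo --> (0 : R).
Proof. by have := @cvg_harmonic R; rewrite -(cvg_shiftn N). Qed.

Lemma admD u v : adm u -> adm v -> adm (fun x => u x + v x).
Proof.
move=> [mu_ uL uO] [mv vL vO]; split; first exact: measurable_funD.
- rewrite gagE in uL; rewrite gagE in vL; rewrite gagE.
  have := wintD_fin kk0 mk p0 (measurable_gag_diff mu_) (measurable_gag_diff mv) uL vL.
  rewrite (_ : (fun z : T * T => u z.1 - u z.2 + (v z.1 - v z.2)) =
    (fun z : T * T => u z.1 + v z.1 - (u z.2 + v z.2)))//.
  by apply/funext => z; ring.
- by apply: filterS2 uO vO => x H1 H2 xO; rewrite H1// H2// addr0.
Qed.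

(** Here positivity enters, since the absolute value has no derivative at 0. Where [0 < w x], the
    quotient equals [v x] as soon as s n |v x| < w x; almost everywhere outside [Om] it is 0, as [v]
    is. Its absolute value never exceeds that of [v]. *)
Lemma mass1_derivative w v (s : nat -> R) : adm w -> adm v -> (forall x, 0 <= w x) ->
  {ae mu, forall x, Om x -> 0 < w x} ->
  (forall n, 0 < s n) -> s @ \oo --> (0 : R) ->
  (fun n => (massr 1 (fun x => w x + s n * v x) - massr 1 w) / s n) @ \oo -->
    fine (\int[mu]_x (v x)%:E)%E.
Proof.
move=> aw av w0 wpos s0 sl; have [mw _ _] := aw; have [mv _ vO] := av.
have iL u : adm u -> mu.-integrable setT (fun x => `|u x|%:E).
  move=> au; have [mu_ _ _] := au.
  have := integrable_mass1 mu_ (adm_mass_lty q01 sob1 au).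
  by move/integrable_abse; apply: eq_integrable.
have iV : mu.-integrable setT (EFin \o v).
  exact: integrable_mass1 mv (adm_mass_lty q01 sob1 av).
have asv n : adm (fun x => w x + s n * v x) by exact: (admD aw (admZ (s n) av)).
have mass1E u : adm u -> (massr 1 u)%:E = (\int[mu]_x `|u x|%:E)%E.
  move=> au; rewrite massrK// massE; apply: eq_integral => x _.
  by rewrite powRr1.
pose q n x := (`|w x + s n * v x| - `|w x|) / s n.
have qE n : (\int[mu]_x (q n x)%:E)%E =
    ((massr 1 (fun x => w x + s n * v x) - massr 1 w) / s n)%:E.
  transitivity (\int[mu]_x ((s n)^-1%:E * (`|w x + s n * v x|%:E - `|w x|%:E)))%E.
    by apply: eq_integral => x _; rewrite -EFinB -EFinM mulrC.
  rewrite (integralZl measurableT (integrableB measurableT (iL _ (asv n)) (iL _ aw))).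
  rewrite (integralB measurableT (iL _ (asv n)) (iL _ aw)).
  by rewrite -(mass1E _ (asv n)) -(mass1E _ aw) -EFinB -EFinM mulrC.
have qb n x : `|q n x| <= `|v x|.
  rewrite /q normrM normfV (gtr0_norm (s0 n)) ler_pdivrMr//.
  apply: (le_trans (ler_dist_dist _ _)).
  by rewrite addrAC subrr add0r normrM (gtr0_norm (s0 n)) mulrC.
have mq n : measurable_fun setT (fun x => (q n x)%:E).
  apply/measurable_EFinP; apply: measurable_funM => //; apply: measurable_funB;
  apply: measurableT_comp => //; apply: measurable_funD => //; exact: measurable_funM.
have qv : {ae mu, forall x, [set: T] x -> (fun n => (q n x)%:E) @ \oo --> (v x)%:E}.
  apply: filterS2 wpos vO => x wx vx _; apply/cvg_EFin; first exact: nearW.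
  rewrite /comp/=; have [vx0|vx0] := eqVneq (v x) 0.
    rewrite (_ : (fun n => _) = cst 0); first by rewrite vx0; exact: cvg_cst.
    by apply/funext => n; rewrite /q vx0 mulr0 addr0 subrr mul0r.
  have Ox : Om x by apply: contrapT => /vx /eqP; rewrite (negbTE vx0).
  have {}wx := wx Ox.
  apply: cvg_near_cst.
  have e0 : 0 < w x / `|v x| by rewrite divr_gt0// normr_gt0.
  have /cvgrPdist_lt /(_ _ e0) := sl; apply: filterS => n.
  rewrite sub0r normrN (gtr0_norm (s0 n)) ltr_pdivlMr ?normr_gt0// => sn.
  have wsv : 0 <= w x + s n * v x.
    have : - (s n * v x) <= s n * `|v x|.
      by rewrite -mulrN ler_wpM2l ?(ltW (s0 n))// -normrN ler_norm.
    by move: sn; lra.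
  rewrite /q !ger0_norm// (addrC (w x)) addrK mulrC mulKf//.
  by rewrite gt_eqF.
have [_ _ H] := dominated_convergence measurableT mq
  (measurable_int _ iV) qv (iL _ av) (aeW _ (fun x n _ => qb n x)).
have vfin := integrable_fin_num measurableT iV.
move: H; rewrite -(fineK vfin) (_ : [sequence _]_n = EFin \o (fun n =>
  (massr 1 (fun x => w x + s n * v x) - massr 1 w) / s n)); last first.
  by apply/funext => n /=; rewrite -qE.
by move/fine_cvg.
Qed.

Definition gag_pairing w v : \bar R :=
  (\int[mu \x mu]_z (`|w z.1 - w z.2| `^ (p - 2) * (w z.1 - w z.2) *
     (v z.1 - v z.2) * k z.1 z.2)%:E)%E.

Lemma gag_derivative w v (s : nat -> R) : adm w -> adm v ->
  (forall n, 0 < s n <= 1) -> s @ \oo --> (0 : R) ->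
  (fun n => (gagr (fun x => w x + s n * v x) - gagr w) / s n) @ \oo -->
    p * fine (gag_pairing w v).
Proof.
move=> [mw wL _] [mv vL _] s01 sl; rewrite gagE in wL; rewrite gagE in vL.
pose a (z : T * T) := w z.1 - w z.2; pose b (z : T * T) := v z.1 - v z.2.
have ma : measurable_fun setT a by exact: measurable_gag_diff.
have mb : measurable_fun setT b by exact: measurable_gag_diff.
have H := wint_derivative kk0 mk p2 ma mb wL vL s01 sl.
have E n : gag mu k p (fun x => w x + s n * v x) =
    wint (mu \x mu)%E (fun z : T * T => k z.1 z.2) p (fun z => a z + s n * b z).
  rewrite gagE; have -> // : (fun z : T * T => w z.1 + s n * v z.1 - (w z.2 + s n * v z.2)) =
    (fun z => a z + s n * b z).
  by apply/funext => z; rewrite /a /b; ring.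
have E0 : gag mu k p w = wint (mu \x mu)%E (fun z : T * T => k z.1 z.2) p a.
  by rewrite gagE.
by under eq_fun do rewrite E E0.
Qed.

Definition mass_pairing w v : \bar R :=
  (\int[mu]_x (`|w x| `^ (r + 1 - 2) * w x * v x)%:E)%E.

Let r12 : 2 <= r + 1. Proof. slra. Qed.

Let mcst1 : measurable_fun setT (cst 1 : T -> R).
Proof. exact: measurable_cst. Qed.

Let cst10 : forall x : T, 0 <= cst (1 : R) x. Proof. by []. Qed.

Let massL u : adm u -> (wint mu (cst 1%R) (r + 1)%R u < +oo)%E.
Proof. by move=> au; rewrite -massW; exact: adm_mass_lty. Qed.

Lemma mass_derivative w v (s : nat -> R) : adm w -> adm v ->
  (forall n, 0 < s n <= 1) -> s @ \oo --> (0 : R) ->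
  (fun n => (massr (r + 1) (fun x => w x + s n * v x) - massr (r + 1) w) / s n) @ \oo -->
    (r + 1) * fine (mass_pairing w v).
Proof.
move=> aw av s01 sl; have [mw _ _] := aw; have [mv _ _] := av.
have -> : mass_pairing w v =
    (\int[mu]_x (`|w x| `^ (r + 1 - 2) * w x * v x * cst 1 x)%:E)%E.
  by apply: eq_integral => x _; rewrite mulr1.
under eq_fun do rewrite !massW.
exact: (wint_derivative cst10 mcst1 r12 mw mv (massL aw) (massL av) s01 sl).
Qed.

Lemma mass_pairing_integrable w v : adm w -> adm v ->
  mu.-integrable setT (fun x => (`|w x| `^ (r + 1 - 2) * w x * v x)%:E).
Proof.
move=> aw av; have [mw _ _] := aw; have [mv _ _] := av.
have := integrable_wint_product cst10 mcst1 r12 mw mv (massL aw) (massL av).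
by apply: eq_integrable => // x _; rewrite mulr1.
Qed.

Lemma gag_pairing_integrable w v : adm w -> adm v ->
  (mu \x mu)%E.-integrable setT (fun z => (`|w z.1 - w z.2| `^ (p - 2) *
    (w z.1 - w z.2) * (v z.1 - v z.2) * k z.1 z.2)%:E).
Proof.
move=> [mw wL _] [mv vL _]; rewrite gagE in wL; rewrite gagE in vL.
exact: (integrable_wint_product kk0 mk p2 (measurable_gag_diff mw)
  (measurable_gag_diff mv) wL vL).
Qed.

(** The inequality of [variation] is divided by the step, and [t n] tends to 1. The steps are
    positive, hence only one sign is obtained. *)
Lemma first_variation_ge0 eps w v : 0 <= eps -> is_minimizer eps w ->
  (forall x, 0 <= w x) -> {ae mu, forall x, Om x -> 0 < w x} -> adm v ->
  0 <= fine (gag_pairing w v) + eps * fine (\int[mu]_x (v x)%:E)%E -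
    fine (mass_pairing w v).
Proof.
move=> eps0 wm w0 wpos av; have [aw Cw _ _] := wm.
pose s N n : R := (n + N).+1%:R^-1.
have s0 N n : 0 < s N n by rewrite invr_gt0.
have s01 N n : 0 < s N n <= 1 by rewrite s0 invf_le1// ler1n.
have sl N : s N @ \oo --> (0 : R) by exact: harmonic_shift_cvg.
have QA N := gag_derivative aw av (s01 N) (sl N).
have QB N := mass1_derivative aw av w0 wpos (s0 N) (sl N).
have QC N := mass_derivative aw av (s01 N) (sl N).
have cC N := cvg_of_quotient (s0 N) (sl N) (QC N).
(* [variation] asks for a positive (r + 1)-mass at every index, so the harmonic steps are started
   late enough. *)
have [N _ NP] : \forall n \near \oo, 0 < massr (r + 1) (fun x => w x + s 0%N n * v x).
  have := cC 0%N; move/cvgrPdist_lt/(_ _ Cw); apply: filterS => n.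
  by rewrite ltr_norml => /andP[_]; rewrite ltrBlDr ltrDl.
have sN n : s N n = s 0%N (n + N)%N by rewrite /s addn0.
have av_ n : adm (fun x => w x + s N n * v x) by exact: (admD aw (admZ _ av)).
have Cv n : 0 < massr (r + 1) (fun x => w x + s N n * v x).
  by rewrite sN; apply: NP; rewrite /= leq_addl.
have [t [t0 tl tH]] := variation eps0 wm av_ Cv
  (cvg_of_quotient (s0 N) (sl N) (QA N)) (cvg_of_quotient (s0 N) (sl N) (QB N)) (cC N).
pose F n := (gagr (fun x => w x + s N n * v x) - gagr w) / s N n / p * t n `^ p +
  eps * ((massr 1 (fun x => w x + s N n * v x) - massr 1 w) / s N n) * t n -
  (massr (r + 1) (fun x => w x + s N n * v x) - massr (r + 1) w) / s N n / (r + 1) *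
    t n `^ (r + 1).
have F0 n : 0 <= F n.
  have := mulr_ge0 (tH n) (ltW (divr_gt0 ltr01 (s0 N n))).
  by rewrite /F div1r; congr (0 <= _); ring.
have tp e : 0 <= e -> (fun n => t n `^ e) @ \oo --> (1 : R).
  move=> e0; rewrite (_ : 1 = 1 `^ e); last by rewrite powR1.
  by apply: cvg_powR => // n; exact: ltW.
have FL : F @ \oo --> p * fine (gag_pairing w v) / p * 1 +
    eps * fine (\int[mu]_x (v x)%:E)%E * 1 -
    (r + 1) * fine (mass_pairing w v) / (r + 1) * 1.
  apply: cvgB; first apply: cvgD.
  - apply: cvgM; last exact: tp.
    by apply: cvgM; [exact: QA|exact: cvg_cst].
  - apply: cvgM => //; apply: cvgM; [exact: cvg_cst|exact: QB].
  - apply: cvgM; last by apply: tp; exact: ltW.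
    by apply: cvgM; [exact: QC|exact: cvg_cst].
have pn : p != 0 by rewrite gt_eqF//; slra.
have rn : r + 1 != 0 by rewrite gt_eqF.
move: FL; rewrite !mulr1 (mulrC p) (mulrC (r + 1)) !mulfK// => FL.
rewrite -(cvg_lim _ FL)//; apply: limr_ge; first by apply/cvg_ex; eexists; exact: FL.
exact: nearW.
Qed.

Lemma fine_integralN d' (X : measurableType d') (nu : {measure set X -> \bar R})
    (f g : X -> R) : nu.-integrable setT (EFin \o f) -> (forall x, g x = - f x) ->
  fine (\int[nu]_x (g x)%:E)%E = - fine (\int[nu]_x (f x)%:E)%E.
Proof.
move=> fi gf; rewrite (_ : (\int[nu]_x (g x)%:E)%E = (- \int[nu]_x (f x)%:E)%E) ?fineN//.
rewrite -integralN; last exact: integrable_add_def.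
by apply: eq_integral => x _; rewrite gf.
Qed.

(** The expression in [first_variation_ge0] is linear in [v], so [v] and its opposite together force
    equality. *)
Lemma euler_lagrange eps w v : 0 <= eps -> is_minimizer eps w ->
  (forall x, 0 <= w x) -> {ae mu, forall x, Om x -> 0 < w x} -> adm v ->
  fine (gag_pairing w v) + eps * fine (\int[mu]_x (v x)%:E)%E =
    fine (mass_pairing w v).
Proof.
move=> eps0 wm w0 wpos av; have [aw _ _ _] := wm; have [mv _ _] := av.
apply/eqP; rewrite -subr_eq0 eq_le first_variation_ge0// andbT.
have aNv := admZ (-1) av.
have := first_variation_ge0 eps0 wm w0 wpos aNv.
have -> : fine (gag_pairing w (fun x => -1 * v x)) = - fine (gag_pairing w v).
  by apply: (fine_integralN (gag_pairing_integrable aw av)) => z; ring.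
have -> : fine (mass_pairing w (fun x => -1 * v x)) = - fine (mass_pairing w v).
  by apply: (fine_integralN (mass_pairing_integrable aw av)) => z; ring.
have -> : fine (\int[mu]_x (-1 * v x)%:E)%E = - fine (\int[mu]_x (v x)%:E)%E.
  apply: (fine_integralN (integrable_mass1 mv (adm_mass_lty q01 sob1 av))) => z; ring.
by rewrite mulrN -!opprD oppr_ge0.
Qed.

(** * Positivity of the minimiser *)

Lemma dist_max_le (a b a' b' : R) :
  `|Num.max a b - Num.max a' b'| <= `|a - a'| \/
    `|Num.max a b - Num.max a' b'| <= `|b - b'|.
Proof.
have [ab|/ltW ba] := leP a b; have [ab'|/ltW ba'] := leP a' b'.
- by right.
- have [ba2|/ltW ab2] := leP a' b.
    by right; rewrite !ger0_norm ?subr_ge0 ?lerB// (le_trans ba').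
  by left; rewrite !ler0_norm ?subr_le0 ?(le_trans ab)// lerN2 lerB.
- have [ba2|/ltW ab2] := leP b' a.
    by left; rewrite !ger0_norm ?subr_ge0 ?lerB// (le_trans ab').
  by right; rewrite !ler0_norm ?subr_le0 ?(le_trans ba)// lerN2 lerB.
- by left.
Qed.

(** Integrated against the kernel, it says that raising [w] to [tau * b] costs at most tau^p times
    the energy of [b], which is of higher order in [tau]. *)
Lemma powR_dist_max_le (a b a' b' : R) :
  `|Num.max a b - Num.max a' b'| `^ p <= `|a - a'| `^ p + `|b - b'| `^ p.
Proof.
have [H|H] := dist_max_le a b a' b'.
- apply: (@le_trans _ _ (`|a - a'| `^ p)); last by rewrite lerDl powR_ge0.
  by apply: ge0_ler_powR; rewrite ?nnegrE.
- apply: (@le_trans _ _ (`|b - b'| `^ p)); last by rewrite lerDr powR_ge0.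
  by apply: ge0_ler_powR; rewrite ?nnegrE.
Qed.

(** One factor A - b is kept and the other p - 1 are bounded by A. The term linear in [b] is the
    source of the first-order gain. *)
Lemma powR_sub_le (A b : R) : 0 <= b <= A -> (A - b) `^ p <= A `^ p - b * A `^ (p - 1).
Proof.
move=> /andP[b0 bA]; have A0 : 0 <= A by exact: le_trans bA.
have p1 : 1 <= p by slra.
have Ab : 0 <= A - b by rewrite subr_ge0.
rewrite (powRS Ab p1) (powRS A0 p1) -mulrBl ler_wpM2l//.
by apply: ge0_ler_powR; rewrite ?nnegrE// ?gerBl//; slra.
Qed.

Section positivity.
Variables (kmin : R).
Hypothesis kmin0 : 0 < kmin.
Hypothesis klow : forall x y, Om x -> Om y -> x <> y -> kmin <= k x y.
Variables (w b : T -> R) (m : R).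
Hypotheses (aw : adm w) (w0 : forall x, 0 <= w x) (wO : forall x, ~ Om x -> w x = 0).
Hypotheses (ab : adm b) (b01 : forall x, 0 <= b x <= 1) (bO : forall x, ~ Om x -> b x = 0).
Hypothesis m0 : 0 < m.

Let mw : measurable_fun setT w. Proof. by have [] := aw. Qed.
Let mb : measurable_fun setT b. Proof. by have [] := ab. Qed.
Let b0 x : 0 <= b x. Proof. by have /andP[] := b01 x. Qed.

Let Z := [set x | w x = 0].
Let E := [set x | (m < w x)%R].

Let mZ : measurable Z.
Proof.
rewrite (_ : Z = w @^-1` [set 0]) // -[X in measurable X]setTI; exact: mw.
Qed.

Let mE : measurable E.
Proof.
rewrite (_ : E = w @^-1` `]m, +oo[); last first.
  by apply/seteqP; split => x /=; rewrite in_itv/= andbT.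
by rewrite -[X in measurable X]setTI; exact: mw.
Qed.

Let bZ x := b x * \1_Z x.

Let mbZ : measurable_fun setT bZ.
Proof. by apply: measurable_funM => //; exact: measurable_indic. Qed.

Let bZ0 x : 0 <= bZ x. Proof. by rewrite /bZ mulr_ge0. Qed.

Let mM (tau : R) : measurable_fun setT (fun x => Num.max (w x) (tau * b x)).
Proof. by apply: measurable_maxr => //; exact: measurable_funM. Qed.

(** Pairs with [w x = 0] and [m < w y] gain: since [tau * b y <= m], the maximum leaves [w y]
    unchanged and lifts the value at [x] to [tau * b x], which narrows the difference. [powR_sub_le]
    measures this, and [klow] applies as both points are in [Om]. For all other pairs the product
    [bZ x * \1_E y] is 0 and [powR_dist_max_le] is enough. *)
Let gain_pointwise (tau : R) x y : 0 < tau <= m ->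
  `|Num.max (w x) (tau * b x) - Num.max (w y) (tau * b y)| `^ p * k x y +
    tau * (m `^ (p - 1) * kmin) * (bZ x * \1_E y) <=
  `|w x - w y| `^ p * k x y + tau `^ p * (`|b x - b y| `^ p * k x y).
Proof.
move=> /andP[tau0 taum].
have R0 : 0 <= tau `^ p * (`|b x - b y| `^ p * k x y) by rewrite !mulr_ge0 ?powR_ge0.
have generic : `|Num.max (w x) (tau * b x) - Num.max (w y) (tau * b y)| `^ p * k x y <=
    `|w x - w y| `^ p * k x y + tau `^ p * (`|b x - b y| `^ p * k x y).
  rewrite mulrA -mulrDl ler_wpM2r//; apply: le_trans (powR_dist_max_le _ _ _ _) _.
  by rewrite -mulrBr normrM gtr0_norm// powRM// ltW.
have [bZ_0|bZ_n0] := eqVneq (bZ x) 0; first by rewrite bZ_0 mul0r mulr0 addr0.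
have [/set_mem Ey|nE] := boolP (y \in E); last first.
  by rewrite [\1_E y]indicE (negbTE nE) !mulr0 addr0.
have Zx : w x = 0.
  apply: contrapT => H; move: bZ_n0; rewrite /bZ indicE memNset ?mulr0 ?eqxx//.
have bZE : bZ x = b x by rewrite /bZ indicE mem_set// mulr1.
have Ox : Om x.
  by apply: contrapT => /bO H; move: bZ_n0; rewrite bZE H eqxx.
have wy0 : 0 < w y by exact: lt_trans Ey.
have Oy : Om y by apply: contrapT => /wO H; move: wy0; rewrite H ltxx.
have xy : x <> y by move=> xy; move: wy0; rewrite -xy Zx ltxx.
have bb z : tau * b z <= m.
  apply: le_trans taum; rewrite ler_piMr ?(ltW tau0)//.
  by have /andP[] := b01 z.
rewrite indicE mem_set// mulr1 bZE Zx max_r ?mulr_ge0 ?(ltW tau0)//.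
rewrite (max_l (le_trans (bb y) (ltW Ey))) sub0r normrN (gtr0_norm wy0).
have bA : 0 <= tau * b x <= w y.
  by rewrite mulr_ge0 ?(ltW tau0)//= (le_trans (bb x) (ltW Ey)).
rewrite ler0_norm ?subr_le0; last by case/andP: bA.
rewrite opprB; apply: (@le_trans _ _ (w y `^ p * k x y)); last by rewrite lerDl.
have H := ler_wpM2r (k0 x y) (powR_sub_le bA).
apply: (@le_trans _ _ ((w y `^ p - tau * b x * w y `^ (p - 1)) * k x y +
  tau * (m `^ (p - 1) * kmin) * b x)); first by rewrite lerD2r.
rewrite mulrBl -addrA gerDl.
have mk1 : m `^ (p - 1) * kmin <= w y `^ (p - 1) * k x y.
  apply: ler_pM; rewrite ?powR_ge0 ?(ltW kmin0)//; last exact: klow.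
  by apply: ge0_ler_powR; rewrite ?nnegrE ?(ltW m0) ?(ltW wy0) ?(ltW Ey)//; slra.
have tb0 : 0 <= tau * b x by case/andP: bA.
have := ler_wpM2l tb0 mk1; rewrite addrC subr_le0.
by rewrite !mulrA (mulrAC tau (b x)) -!mulrA (mulrCA (b x)) (mulrC (b x) kmin).
Qed.

Lemma gag_max_gain (tau : R) : 0 < tau <= m ->
  (gag mu k p (fun x => Num.max (w x) (tau * b x))%R +
    (tau * (m `^ (p - 1) * kmin))%:E * ((\int[mu]_x (bZ x)%:E) * mu E) <=
   gag mu k p w + (tau `^ p)%:E * gag mu k p b)%E.
Proof.
move=> taum; have /andP[tau0 _] := taum.
have mg (u : T -> R) : measurable_fun setT u ->
    measurable_fun setT (fun z : T * T => (`|u z.1 - u z.2| `^ p * k z.1 z.2)%:E).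
  exact: measurable_gag_integrand.
have g0 (u : T -> R) (z : T * T) : (0 <= (`|u z.1 - u z.2| `^ p * k z.1 z.2)%:E)%E.
  by rewrite lee_fin mulr_ge0 ?powR_ge0.
set C := tau * (m `^ (p - 1) * kmin).
have C0 : (0 <= C%:E)%E by rewrite lee_fin !mulr_ge0 ?powR_ge0 ?(ltW tau0) ?(ltW kmin0).
pose h (z : T * T) : \bar R := (bZ z.1 * \1_E z.2)%:E.
have mh : measurable_fun setT h.
  apply/measurable_EFinP; apply: measurable_funM.
    exact: (measurableT_comp mbZ (@measurable_fst _ _ _ _)).
  exact: (measurableT_comp (measurable_indic mE) (@measurable_snd _ _ _ _)).
have h0 z : (0 <= h z)%E by rewrite lee_fin mulr_ge0.
have hE : (\int[mu \x mu]_z h z = (\int[mu]_x (bZ x)%:E) * mu E)%E.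
  rewrite (fubini_tonelli1 _ mh h0) -ge0_integralZr//; last 2 first.
  - exact/measurable_EFinP.
  - by move=> x _; rewrite lee_fin.
  apply: eq_integral => x _; rewrite /fubini_F /h/=.
  under eq_integral do rewrite EFinM.
  rewrite ge0_integralZl//; last 2 first.
  - exact/measurable_EFinP/measurable_indic.
  - by rewrite lee_fin.
  by rewrite integral_indic// setIT.
have tp0 : (0 <= (tau `^ p)%:E)%E by rewrite lee_fin powR_ge0.
set M := (fun x => Num.max (w x) (tau * b x)).
rewrite -hE !gagE /wint.
rewrite -(ge0_integralZl _ measurableT mh (fun z _ => h0 z) C0).
rewrite -(ge0_integralZl _ measurableT (mg _ mb) (fun z _ => g0 b z) tp0).
have Ch0 (z : T * T) : setT z -> (0 <= C%:E * h z)%E by move=> _; rewrite mule_ge0.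
have tb0 (z : T * T) : setT z ->
    (0 <= (tau `^ p)%:E * (`|b z.1 - b z.2| `^ p * k z.1 z.2)%:E)%E.
  by move=> _; rewrite mule_ge0.
rewrite -[leLHS](ge0_integralD _ measurableT (fun z _ => g0 M z) (mg M (mM tau)) Ch0
  (measurable_funeM _ mh)).
rewrite -[leRHS](ge0_integralD _ measurableT (fun z _ => g0 w z) (mg _ mw) tb0
  (measurable_funeM _ (mg _ mb))).
apply: ge0_le_integral => //.
- by move=> z _; apply: adde_ge0; [exact: (g0 M)|exact: mule_ge0].
- exact: (emeasurable_funD (mg M (mM tau)) (measurable_funeM _ mh)).
- exact: (emeasurable_funD (mg _ mw) (measurable_funeM _ (mg _ mb))).
move=> [x y] _; rewrite -!EFinM -!EFinD lee_fin /=; exact: gain_pointwise.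
Qed.

(** [variation] is applied to the maxima of [w] and [tau n * b], and divided by [tau n]. The (r +
    1)-mass only grows, which has the favourable sign. In the limit, 0 <= (eps - m^(p - 1) kmin a /
    p) Iz, where [Iz] is the integral of [b] over the zero set of [w]; as the bracket is negative,
    [Iz] is 0. *)
Lemma positive_on_bump eps a : 0 <= eps -> is_minimizer eps w -> 0 < a ->
  (a%:E <= mu E)%E -> eps < m `^ (p - 1) * kmin * a / p ->
  {ae mu, forall x, 0 < b x -> 0 < w x}.
Proof.
move=> eps0 wm a0 aE epsG; have [_ Cw _ _] := wm.
have pp : 0 < p by slra.
pose tau n : R := m * n.+1%:R^-1.
have tau0 n : 0 < tau n by rewrite mulr_gt0// invr_gt0.
have taum n : 0 < tau n <= m.
  by rewrite tau0 ler_piMr ?(ltW m0)// invf_le1// ler1n.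
have taul : tau @ \oo --> (0 : R).
  by rewrite -[X in _ --> X](mulr0 m); apply: cvgM; [exact: cvg_cst|exact: cvg_harmonic].
pose M n x := Num.max (w x) (tau n * b x).
have M0 n x : 0 <= M n x by rewrite /M le_max w0.
have wM n x : w x <= M n x by rewrite /M le_max lexx.
have tb_le n x : tau n * b x <= m.
  by have /andP[_ H] := taum n; apply: le_trans H; rewrite ler_piMr ?(ltW (tau0 n))//;
    have /andP[] := b01 x.
have Mcvg x : M ^~ x @ \oo --> w x.
  apply: (@squeeze_cvgr _ _ _ _ (cst (w x)) (fun n => w x + tau n * b x)).
  - apply: nearW => n; rewrite wM/= /M ge_max lerDl lerDr w0 mulr_ge0//.
    exact: ltW.
  - exact: cvg_cst.
  - rewrite -[X in _ --> X]addr0; apply: cvgD; first exact: cvg_cst.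
    by rewrite -[X in _ --> X](mul0r (b x)); apply: cvgM => //; exact: cvg_cst.
pose m1b x := m * b x.
have am1b : adm m1b by exact: admZ.
have mm1b : measurable_fun setT m1b by have [] := am1b.
have Mle n x : `|M n x| <= `|w x| + `|m1b x|.
  rewrite !ger0_norm ?mulr_ge0 ?(ltW m0)// /M ge_max lerDl mulr_ge0 ?(ltW m0)//=.
  by apply: le_trans (_ : m * b x <= _); [rewrite ler_wpM2r//; case/andP: (taum n)|rewrite lerDr].
have Mdle n (z : T * T) : `|M n z.1 - M n z.2| <= `|w z.1 - w z.2| + `|m1b z.1 - m1b z.2|.
  have H : `|M n z.1 - M n z.2| <= `|w z.1 - w z.2| + `|tau n * b z.1 - tau n * b z.2|.
    rewrite /M; have [H|H] := dist_max_le (w z.1) (tau n * b z.1) (w z.2) (tau n * b z.2).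
      by apply: (le_trans H); rewrite lerDl.
    by apply: (le_trans H); rewrite lerDr.
  apply: (le_trans H); rewrite lerD2l /m1b -!mulrBr !normrM ler_wpM2r// !gtr0_norm//.
  by case/andP: (taum n).
have aM n : adm (M n).
  split => //; first exact: mM.
    have := gag_max_gain (taum n).
    have [_ wL _] := aw; have [_ bL _] := ab.
    have RL : (gag mu k p w + (tau n `^ p)%:E * gag mu k p b < +oo)%E.
      by rewrite lte_add_pinfty// lte_mul_pinfty// lee_fin powR_ge0.
    move=> /le_lt_trans /(_ RL); apply: le_lt_trans; rewrite leeDl//; apply: mule_ge0.
      rewrite lee_fin; apply: mulr_ge0; first exact: ltW.
      by apply: mulr_ge0; [exact: powR_ge0|exact: ltW].
    by rewrite mule_ge0// integral_ge0// => x _; rewrite lee_fin.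
  by apply: nearW => x xO; rewrite /M wO// bO// mulr0 maxxx.
have gagW u : adm u -> (wint (mu \x mu)%E (fun z : T * T => k z.1 z.2) p
    (fun z => u z.1 - u z.2)%R < +oo)%E by move=> [_ uL _]; rewrite -gagE.
have cA : (fun n => gagr (M n)) @ \oo --> gagr w.
  have [_ wL _] := aw; apply: fine_cvg; rewrite (gagrK wL) gagE.
  under eq_fun do rewrite gagE.
  apply: (wint_dominated_cvg kk0 mk p0 (fun n => measurable_gag_diff (mM (tau n)))
    (measurable_gag_diff mw) (measurable_gag_diff mm1b) _ Mdle (gagW _ aw) (gagW _ am1b)).
  by move=> z; apply: cvgB; exact: Mcvg.
have cm q : 0 < q -> q < sobolev_exp p theta ->
    (fun n => massr q (M n)) @ \oo --> massr q w.
  move=> q0 qs; apply: fine_cvg; rewrite (massrK q0 qs aw) massW.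
  under eq_fun do rewrite massW.
  apply: (wint_dominated_cvg cst10 mcst1 (ltW q0) (fun n => mM (tau n)) mw mm1b Mcvg Mle).
    by rewrite -massW; exact: adm_mass_lty.
  by rewrite -massW; exact: adm_mass_lty.
have CM n : massr (r + 1) w <= massr (r + 1) (M n).
  rewrite -lee_fin !massrK// !massW; apply: (le_wint _ cst10 mcst1 (ltW q0r) mw (mM (tau n))).
  by move=> x; rewrite (ger0_norm (w0 x)) (ger0_norm (M0 n x)) wM.
have CM0 n : 0 < massr (r + 1) (M n) by exact: lt_le_trans (CM n).
have [t [t0 tl tH]] := variation eps0 wm aM CM0 cA (cm 1 q01 sob1) (cm _ q0r rcrit).
pose I x := b x * \1_Z x.
have ib : mu.-integrable setT (EFin \o b).
  exact: (integrable_mass1 mb (adm_mass_lty q01 sob1 ab)).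
(* The mass increases by at most [tau n] times the integral of [b] over [D n] only. Where [b] is
   positive, [D n] shrinks to the zero set of [w], so the cost tends to the same integral [Iz] that
   measures the gain. *)
pose D n := [set x | (w x < tau n * b x)%R].
have mtb n : measurable_fun setT (fun x => tau n * b x) by exact: measurable_funM.
have mD n : measurable (D n).
  have mdf : measurable_fun setT (fun x => tau n * b x - w x) by exact: measurable_funB.
  rewrite (_ : D n = (fun x => tau n * b x - w x) @^-1` `]0, +oo[); last first.
    by apply/seteqP; split => x /=; rewrite in_itv/= andbT subr_gt0.
  by rewrite -[X in measurable X]setTI; exact: mdf.
pose J n := (\int[mu]_x (b x * \1_(D n) x)%:E)%E.
have mbD n : measurable_fun setT (fun x => b x * \1_(D n) x : R).
  by apply: measurable_funM => //; exact: measurable_indic.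
have bD0 n x : 0 <= b x * (\1_(D n) x : R) by rewrite mulr_ge0.
have iD (F : set T) : measurable F -> mu.-integrable setT (fun x => (b x * \1_F x)%:E).
  move=> mF; apply: (le_integrable measurableT _ _ ib).
    by apply/measurable_EFinP; apply: measurable_funM => //; exact: measurable_indic.
  move=> x _; rewrite lee_fin normrM ler_piMr// indicE.
  by case: (x \in F); rewrite ?normr1 ?normr0.
have JL : J @ \oo --> (\int[mu]_x (bZ x)%:E)%E.
  apply: (dominated_cvg measurableT (g := fun x => (b x)%:E)) => //.
  - by move=> n; exact/measurable_EFinP.
  - move=> x _; apply/cvg_EFin; first exact: nearW.
    rewrite /comp/=; apply: cvg_near_cst.
    have [bx|bx] := eqVneq (b x) 0; first by apply: nearW => n; rewrite /bZ bx !mul0r.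
    have bx0 : 0 < b x by rewrite lt0r bx b0.
    have [wx|wx] := eqVneq (w x) 0.
      apply: nearW => n; rewrite /bZ !indicE !mem_set//.
      by rewrite /D/= wx mulr_gt0.
    have wx0 : 0 < w x by rewrite lt0r wx w0.
    have e0 : 0 < w x / b x by rewrite divr_gt0.
    have /cvgrPdist_lt /(_ _ e0) := taul; apply: filterS => n.
    rewrite sub0r normrN gtr0_norm// ltr_pdivlMr// => H.
    have nZ : ~ Z x by move=> H0; move: wx; rewrite (H0 : w x = 0) eqxx.
    have nD : ~ D n x by apply/negP; rewrite -leNgt ltW.
    by rewrite /bZ !indicE !memNset.
  - move=> n x _; rewrite lee_fin normrM (ger0_norm (b0 x)) ler_piMr// indicE.
    by case: (x \in D n); rewrite ?normr1 ?normr0.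
have Jfin n : J n \is a fin_num by exact: (integrable_fin_num measurableT (iD _ (mD n))).
have Zfin : (\int[mu]_x (bZ x)%:E)%E \is a fin_num.
  exact: (integrable_fin_num measurableT (iD _ mZ)).
pose Iz := fine (\int[mu]_x (bZ x)%:E)%E.
have JI : (fun n => fine (J n)) @ \oo --> Iz.
  by apply: fine_cvg; rewrite fineK.
have Iz0 : 0 <= Iz by rewrite fine_ge0// integral_ge0// => x _; rewrite lee_fin.
pose G := m `^ (p - 1) * kmin.
have G0 : 0 < G by rewrite mulr_gt0 ?powR_gt0.
have Again n : gagr (M n) - gagr w <= tau n `^ p * gagr b - tau n * (G * (Iz * a)).
  have [_ wL _] := aw; have [_ bL _] := ab; have [_ ML _] := aM n.
  have c0' : (0 <= (tau n * G)%:E)%E by rewrite lee_fin mulr_ge0 ?(ltW (tau0 n)) ?(ltW G0).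
  have := gag_max_gain (taum n); rewrite -/G -/(M n) -(gagrK wL) -(gagrK bL) -(gagrK ML).
  have : ((tau n * G)%:E * ((\int[mu]_x (bZ x)%:E) * a%:E) <=
     (tau n * G)%:E * ((\int[mu]_x (bZ x)%:E) * mu E))%E.
    by rewrite lee_wpmul2l// lee_wpmul2l// integral_ge0// => x _; rewrite lee_fin.
  move=> /(leeD (lexx (gagr (M n))%:E)) /le_trans H /H.
  rewrite -(fineK Zfin) -/Iz -!EFinM -!EFinD lee_fin.
  by rewrite (_ : tau n * G * (Iz * a) = tau n * (G * (Iz * a))); [lra|ring].
have Bgain n : massr 1 (M n) - massr 1 w <= tau n * fine (J n).
  have mass1E u : adm u -> (forall x, 0 <= u x) -> (massr 1 u)%:E = (\int[mu]_x (u x)%:E)%E.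
    move=> au u0; rewrite massrK// massE; apply: eq_integral => x _.
    by rewrite powRr1// ger0_norm.
  rewrite lerBlDl -lee_fin EFinD EFinM (mass1E _ (aM n))// (mass1E _ aw)// (fineK (Jfin n)).
  have t00 : (0 <= (tau n)%:E)%E by rewrite lee_fin ltW.
  have mJ : measurable_fun setT (fun x => (b x * \1_(D n) x)%:E) by exact/measurable_EFinP.
  have J0 x : setT x -> (0 <= (b x * \1_(D n) x)%:E)%E by rewrite lee_fin.
  rewrite -(ge0_integralZl _ measurableT mJ J0 t00).
  have mwE : measurable_fun setT (fun x => (w x)%:E) by exact/measurable_EFinP.
  rewrite -(ge0_integralD _ measurableT _ mwE _ (measurable_funeM _ mJ)); last 2 first.
  - by move=> x _; rewrite lee_fin.
  - by move=> x _; rewrite mule_ge0// J0.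
  apply: ge0_le_integral => //.
  - by move=> x _; rewrite lee_fin.
  - by apply/measurable_EFinP; exact: mM.
  - exact: (emeasurable_funD mwE (measurable_funeM _ mJ)).
  move=> x _; rewrite -EFinM -EFinD lee_fin /M indicE.
  have [wx|wx] := leP (tau n * b x) (w x).
    by rewrite lerDl mulr_ge0 ?(ltW (tau0 n))// mulr_ge0.
  by rewrite mem_set// mulr1 lerDr.
pose F n := (tau n `^ (p - 1) * gagr b - G * (Iz * a)) / p * t n `^ p + eps * fine (J n) * t n.
have F0 n : 0 <= F n.
  have tp0 := powR_gt0 p (t0 n); have tr0 := powR_gt0 (r + 1) (t0 n).
  have taup : tau n `^ p = tau n * tau n `^ (p - 1).
    by rewrite powRS ?(ltW (tau0 n))//; slra.
  rewrite -(pmulr_rge0 _ (tau0 n)); apply: le_trans (tH n) _.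
  rewrite /F [leRHS]mulrDr -[leLHS]addrA; apply: lerD.
    rewrite mulrA ler_wpM2r ?(ltW tp0)// mulrA ler_wpM2r ?invr_ge0//.
    by rewrite mulrBr mulrA -taup; exact: Again.
  apply: (@le_trans _ _ (eps * (massr 1 (M n) - massr 1 w) * t n)).
    rewrite gerBl mulr_ge0 ?(ltW tr0)// mulr_ge0 ?invr_ge0 ?(ltW q0r)// subr_ge0.
    exact: CM.
  rewrite mulrA ler_wpM2r ?(ltW (t0 n))// mulrCA ler_wpM2l//.
have FL : F @ \oo --> (0 * gagr b - G * (Iz * a)) / p * 1 + eps * Iz * 1.
  have pm1 : 0 < p - 1 by slra.
  apply: cvgD.
  - apply: cvgM.
      apply: cvgM; last exact: cvg_cst.
      apply: cvgB; last exact: cvg_cst.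
      apply: cvgM; last exact: cvg_cst.
      rewrite -[X in _ --> X](@powR0 _ (p - 1)) ?gt_eqF//.
      by apply: cvg_powR => //; [exact: ltW|move=> n; exact: ltW].
    rewrite (_ : 1 = 1 `^ p); last by rewrite powR1.
    by apply: cvg_powR => // n; exact: ltW.
  - by apply: cvgM => //; apply: cvgM => //; exact: cvg_cst.
have FL0 : 0 <= (0 * gagr b - G * (Iz * a)) / p * 1 + eps * Iz * 1.
  rewrite -(cvg_lim _ FL)//; apply: limr_ge; first by apply/cvg_ex; eexists; exact: FL.
  exact: nearW.
have IzE : Iz = 0.
  apply/eqP; rewrite eq_le Iz0 andbT leNgt; apply/negP => Izp.
  move: FL0; rewrite leNgt => /negP; apply.
  rewrite (_ : _ + _ = (eps - G * a / p) * Iz); last by ring.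
  by rewrite nmulr_rlt0// subr_lt0 /G.
have bZE0 : {ae mu, forall x, [set: T] x -> (bZ x)%:E = cst 0%E x}.
  apply/(ae_eq_integral_abs mu measurableT); first exact/measurable_EFinP.
  under eq_integral do rewrite gee0_abs ?lee_fin ?bZ0//.
  by rewrite -(fineK Zfin) -/Iz IzE.
apply: filterS bZE0 => x /(_ Logic.I) /= [] bZx bx; rewrite lt0r w0 andbT.
apply/eqP => wx; move: bZx; rewrite /bZ indicE mem_set// mulr1 => bx0.
by move: bx; rewrite bx0 ltxx.
Qed.

End positivity.

Lemma ae_forall_nat (P : nat -> T -> Prop) : (forall n, {ae mu, forall x, P n x}) ->
  {ae mu, forall x, forall n, P n x}.
Proof.
move=> aP; have /choice [N NP] : forall n, exists N, [/\ measurable N, mu N = 0%E &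
    ~` [set x | P n x] `<=` N] by move=> n; exact: aP.
exists (\bigcup_n N n); split.
- by apply: bigcup_measurable => n _; have [] := NP n.
- apply/eqP; rewrite eq_le measure_ge0 andbT.
  apply: (le_trans (measure_sigma_subadditive mu (F := N) _ _ (@subset_refl _ _))).
  + by move=> n; have [] := NP n.
  + by apply: bigcup_measurable => n _; have [] := NP n.
  by rewrite eseries0// => n _ _; have [] := NP n.
- move=> x /= /existsNP[n nP]; exists n => //.
  by have [_ _] := NP n; apply.
Qed.

(** The threshold for [eps] involves only [m], [a], [kmin] and [p], so it is common to all bumps.
    Since they are countably many and cover [Om], one null set serves all of them. *)
Lemma positive_solution (kmin : R) (b : nat -> T -> R) : 0 < kmin ->
  (forall x y, Om x -> Om y -> x <> y -> kmin <= k x y) ->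
  (forall n, adm (b n)) -> (forall n x, 0 <= b n x <= 1) ->
  (forall n x, ~ Om x -> b n x = 0) -> (forall x, Om x -> exists n, 0 < b n x) ->
  (0 < mu Om)%E ->
  exists2 eps0, 0 < eps0 & forall eps, 0 <= eps < eps0 ->
  exists w, [/\ adm w, forall x, 0 <= w x, {ae mu, forall x, Om x -> 0 < w x} &
    forall v, adm v ->
      fine (gag_pairing w v) + eps * fine (\int[mu]_x (v x)%:E)%E =
        fine (mass_pairing w v)].
Proof.
move=> kmin0 klow ab b01 bO bOm Om0.
(* Were all these masses 0, the bumps would vanish outside a common null set, which would then
   contain [Om]. So the minimisation has a competitor. *)
have [n0 Cb] : exists n, 0 < massr (r + 1) (b n).
  apply: contrapT => /forallNP nb.
  have b0 n : {ae mu, forall x, b n x = 0}.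
    have [mb _ _] := ab n.
    have C0 : mass mu (r + 1) (b n) = 0%E.
      rewrite -massrK//; congr EFin; apply/eqP; rewrite eq_le massr_ge0 andbT.
      by rewrite leNgt; apply/negP; exact: nb.
    move: C0; rewrite massE => C0.
    have : {ae mu, forall x, [set: T] x -> (`|b n x| `^ (r + 1))%:E = cst 0%E x}.
      apply/(ae_eq_integral_abs mu measurableT).
        by apply/measurable_EFinP; exact: measurable_powR_norm.
      by under eq_integral do rewrite gee0_abs ?lee_fin ?powR_ge0//.
    apply: filterS => x /(_ Logic.I) /= [] /powR_eq0_eq0 /eqP.
    by rewrite normr_eq0 => /eqP.
  have [N [mN N0 sN]] := ae_forall_nat b0.
  have OmN : Om `<=` N.
    move=> x Ox; apply: sN => /= H; have [n] := bOm x Ox.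
    by rewrite H ltxx.
  have : (mu Om <= mu N)%E by apply: le_measure; rewrite ?inE.
  by rewrite leNgt => /negP; apply; rewrite (N0 : mu N = 0%E).
have [m [a [m0 a0 gs]]] := ground_state (ex_intro _ (b n0) (conj (ab n0) Cb)).
have pp : 0 < p by slra.
pose G := m `^ (p - 1) * kmin * a / p.
have G0 : 0 < G by rewrite !mulr_gt0 ?powR_gt0// invr_gt0.
exists (Num.min 1 G); first by rewrite lt_min ltr01.
move=> eps /andP[eps0]; rewrite lt_min => /andP[eps1 epsG].
have [|w [aw [w0 wO] [Cw crit] wmin wa]] := gs eps; first by rewrite eps0 ltW.
have wm : is_minimizer eps w by split.
have wpos : {ae mu, forall x, Om x -> 0 < w x}.
  have := ae_forall_nat (fun n => positive_on_bump kmin0 klow aw w0 wO (ab n) (b01 n)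
    (bO n) m0 eps0 wm a0 wa epsG).
  by apply: filterS => x H Ox; have [n bn] := bOm x Ox; exact: H bn.
exists w; split => // v av; exact: euler_lagrange.
Qed.

End ground_state.

(** * The kernel on R^N *)

Section euclidean_cubes.
Context {R : realType} {N : nat}.
Local Notation E := 'rV[R]_N.
Local Notation leb := (@lebesgue_rV R N).
Implicit Types (x y : E) (h : R) (U : set E).

Definition cube x h : set E := [set y | forall i, `|x ord0 i - y ord0 i| < h].

Lemma cubeE x h : cube x h =
  [set y : E | forall i, (`]x ord0 i - h, x ord0 i + h[)%classic (y ord0 i)].
Proof.
apply/seteqP; split => y H i; have := H i; rewrite /= in_itv/= distrC.
  by rewrite ltr_norml ltrBDl => /andP[? ?]; apply/andP; split; lra.
by move=> /andP[? ?]; rewrite ltr_norml; apply/andP; split; lra.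
Qed.

Lemma measurable_box (A : 'I_N -> set R) : (forall i, measurable (A i)) ->
  measurable [set v : E | forall i, A i (v ord0 i)].
Proof.
move=> mA; rewrite (_ : mkset _ = \bigcap_(i in [set: 'I_N])
    ((fun v : E => v ord0 i) @^-1` A i)).
  apply: fin_bigcap_measurable; first exact: finite_finset.
  move=> i _; rewrite -[X in measurable X]setTI.
  exact: measurable_rV_coord.
by apply/seteqP; split => v Bv i => [_|]; exact: Bv.
Qed.

Lemma measurable_cube x h : measurable (cube x h).
Proof.
rewrite cubeE; apply: (measurable_box
  (A := fun i => `]x ord0 i - h, x ord0 i + h[%classic)) => i.
exact: measurable_itv.
Qed.

Lemma leb_cube x h : 0 < h -> leb (cube x h) = ((2 * h) ^+ N)%:E.
Proof.
move=> h0; rewrite cubeE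
  (lebesgue_rV_box (A := fun i => `]x ord0 i - h, x ord0 i + h[%classic))//.
under eq_bigr => i _.
  rewrite lebesgue_measure_itv/= lte_fin (_ : _ < _ = true); last by lra.
  rewrite -EFinB (_ : _ - _ = 2 * h); last by ring.
  over.
by rewrite prodEFin prodr_const card_ord.
Qed.

Lemma coord_le_enorm x i : `|x ord0 i| <= enorm x.
Proof.
rewrite /enorm -sqrtr_sqr ler_sqrt ?/dotv.
  by rewrite (bigD1 i)//= expr2 lerDl sumr_ge0// => j _; rewrite -expr2 sqr_ge0.
by apply: sumr_ge0 => j _; rewrite -expr2 sqr_ge0.
Qed.

Lemma enorm_ge0 x : 0 <= enorm x. Proof. exact: sqrtr_ge0. Qed.

Lemma enorm_le x h : 0 <= h -> (forall i, `|x ord0 i| <= h) -> enorm x <= N%:R * h.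
Proof.
move=> h0 xh; have Nh : 0 <= N%:R * h by rewrite mulr_ge0.
rewrite -[leRHS]ger0_norm// -sqrtr_sqr ler_sqrt ?sqr_ge0// /dotv.
apply: (@le_trans _ _ (\sum_(i < N) h ^+ 2)).
  apply: ler_sum => i _; rewrite -expr2 -real_normK ?num_real//.
  by rewrite lerXn2r ?nnegrE.
rewrite sumr_const card_ord exprMn -[leLHS]mulr_natl ler_wpM2r ?sqr_ge0//.
by rewrite -natrX ler_nat; case: (N) => // n; rewrite expnS expn1 leq_pmulr.
Qed.

Lemma enorm_gt0 x : x != 0 -> 0 < enorm x.
Proof.
move=> x0; rewrite lt_neqAle enorm_ge0 andbT eq_sym; apply: contra_neq x0 => e0.
apply/rowP => i; rewrite mxE; apply/eqP; rewrite -normr_le0 -e0.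
exact: coord_le_enorm.
Qed.

Lemma enormN x : enorm (- x) = enorm x.
Proof.
rewrite /enorm /dotv; congr Num.sqrt; apply: eq_bigr => i _.
by rewrite !mxE mulrNN.
Qed.

Lemma enorm_distC x y : enorm (x - y) = enorm (y - x).
Proof. by rewrite -enormN opprB. Qed.

Lemma open_cube U x : open U -> U x -> exists2 h, 0 < h & cube x h `<=` U.
Proof.
move=> oU Ux; have /nbhs_ballP[h /= h0 hU] := open_nbhs_nbhs (conj oU Ux).
exists h => // y xy; apply: hU; split => // i j; rewrite /ball/= (ord1 i); exact: xy.
Qed.

Lemma bounded_cube U : bounded_set U -> exists2 L, 0 < L & U `<=` cube 0 L.
Proof.
move=> [M [_ /(_ (Num.max M 0 + 1))]].
have M0 : 0 <= Num.max M 0 by rewrite le_max lexx orbT.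
have ML : M < Num.max M 0 + 1 by rewrite ltr_pwDr// le_max lexx.
move=> /(_ ML) UM; exists (Num.max M 0 + 2); first by rewrite ltr_wpDl.
move=> y Uy i; rewrite mxE sub0r normrN.
apply: (@le_lt_trans _ _ (Num.max M 0 + 1)); last by rewrite ltrD2l ltr1n.
apply: le_trans (UM y Uy); rewrite /Num.norm/= mx_normrE.
by apply: (le_bigmax _ (fun ij : 'I_1 * 'I_N => `|y ij.1 ij.2|) (ord0, i)).
Qed.

Definition rat_point (q : 'rV[rat]_N) : E := \row_i ratr (q ord0 i).

Lemma rat_point_near x h : 0 < h -> exists q, forall i,
  `|x ord0 i - rat_point q ord0 i| < h.
Proof.
move=> h0; have /choice[f fP] : forall i, exists q : rat, `|x ord0 i - ratr q| < h.
  move=> i; have [|q] := @rat_in_itvoo R (x ord0 i - h) (x ord0 i + h); first by lra.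
  rewrite in_itv/= => /andP[? ?]; exists q; rewrite ltr_norml; apply/andP; split; lra.
by exists (\row_i f i) => i; rewrite !mxE.
Qed.

(** Enumerates the pairs of a rational centre and an index m standing for the radius 1 / (m + 1). A
    number that is no code gets the centre 0 and the radius 1. *)
Definition rat_cube_code (n : nat) : 'rV[rat]_N * nat :=
  odflt (0, 0%N) (unpickle n).

Definition code_center n : E := rat_point (rat_cube_code n).1.
Definition code_radius n : R := (rat_cube_code n).2.+1%:R^-1.

Lemma code_radius_gt0 n : 0 < code_radius n.
Proof. by rewrite invr_gt0. Qed.

(** The second conclusion is stated in the l^1 distance because [tent] is built on it; it also puts
    [x] in the cube. The radius is at most half the side [h] of [open_cube], and the centre is
    closer to [x] than the radius, so the cube stays inside [U]. *)
Lemma code_dense U x : open U -> U x -> exists n,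
  cube (code_center n) (code_radius n) `<=` U /\
  \sum_(i < N) `|x ord0 i - code_center n ord0 i| < code_radius n.
Proof.
move=> oU Ux; have [h h0 hU] := open_cube oU Ux.
pose m := Num.bound (2 / h).
have m0 : 0 < m.+1%:R^-1 :> R by rewrite invr_gt0.
have mh : m.+1%:R^-1 <= h / 2.
  rewrite -[leRHS]invrK lef_pV2 ?posrE ?invr_gt0 ?divr_gt0// invf_div.
  apply: ltW; apply: (@lt_trans _ _ m%:R); last by rewrite ltr_nat.
  by apply: archi_boundP; rewrite divr_ge0// ltW.
have [q qx] := rat_point_near x (divr_gt0 m0 (ltr0Sn R N)).
exists (pickle (q, m)).
rewrite /code_center /code_radius /rat_cube_code pickleK /=.
have qx' i : `|x ord0 i - rat_point q ord0 i| < m.+1%:R^-1.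
  by apply: (lt_le_trans (qx i)); rewrite ler_piMr ?(ltW m0)// invf_le1// ler1n.
split.
  move=> y qy; apply: hU => i.
  rewrite (_ : _ - _ = (x ord0 i - rat_point q ord0 i) + (rat_point q ord0 i - y ord0 i)); last by ring.
  apply: (le_lt_trans (ler_normD _ _)); rewrite [ltRHS]splitr.
  by apply: ltrD; apply: lt_le_trans mh; [exact: qx'|exact: qy].
apply: (@le_lt_trans _ _ (\sum_(i < N) m.+1%:R^-1 / N.+1%:R)).
  by apply: ler_sum => i _; exact: ltW.
by rewrite sumr_const card_ord -[ltLHS]mulr_natl mulrCA gtr_pMr// ltr_pdivrMr// mul1r ltr_nat.
Qed.

(** The sigma-algebra is generated by the coordinates and not by the open sets; an open set is the
    countable union of the coded cubes inside it. *)
Lemma open_measurable_rV U : open U -> measurable U.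
Proof.
move=> oU; pose F n := if pselect (cube (code_center n) (code_radius n) `<=` U)
  then cube (code_center n) (code_radius n) else set0.
rewrite (_ : U = \bigcup_n F n).
  apply: bigcup_measurable => n _; rewrite /F.
  by case: pselect => [?|?]; [exact: measurable_cube|exact: measurable0].
apply/seteqP; split => x.
  move=> Ux; have [n [nU xn]] := code_dense oU Ux; exists n => //.
  rewrite /F; case: pselect => [_ i|//]; rewrite distrC.
  apply: le_lt_trans xn; rewrite (bigD1 i)//= lerDl.
  by apply: sumr_ge0.
by move=> [n _]; rewrite /F; case: pselect => [H /H|].
Qed.

End euclidean_cubes.

Section kernel_sp_estimates.
Context {R : realType} {N : nat}.
Variables s p : R.
Hypotheses (s0 : 0 < s) (s1 : s < 1) (p2 : 2 <= p) (N2 : (2 <= N)%N)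
  (psN : p * s < N%:R).
Local Notation E := 'rV[R]_N.
Local Notation leb := (@lebesgue_rV R N).
Local Notation k := (@kernel_sp R N s p).
Implicit Types (x y : E) (h : R) (Om : set E).

Definition kernel_order : R := N%:R + s * p.
Definition kernel_theta : R := p * s / N%:R.

Local Notation a := kernel_order.
Local Notation theta := kernel_theta.

Let N0 : 0 < N%:R :> R. Proof. by rewrite ltr0n (leq_trans _ N2). Qed.

Let sp0 : 0 < s * p. Proof. by rewrite mulr_gt0//; move: p2; lra. Qed.

Lemma kernel_order_gt0 : 0 < a. Proof. exact: addr_gt0. Qed.

Lemma kernel_theta_gt0 : 0 < theta.
Proof. by rewrite divr_gt0// mulrC. Qed.

Lemma kernel_theta_lt1 : theta < 1.
Proof. by rewrite ltr_pdivrMr// mul1r. Qed.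

Lemma kernel_order_div : a / N%:R = 1 + theta.
Proof. by rewrite /kernel_order mulrDl divff ?gt_eqF// (mulrC s). Qed.

Lemma kernel_spE x y : k x y = enorm (x - y) `^ (- a).
Proof. by rewrite powRN. Qed.

Lemma kernel_sp_ge0 x y : 0 <= k x y.
Proof. by rewrite kernel_spE powR_ge0. Qed.

Lemma kernel_spC x y : k x y = k y x.
Proof. by rewrite !kernel_spE enorm_distC. Qed.

Lemma measurable_enorm_dist : measurable_fun setT (fun z : E * E => enorm (z.1 - z.2)).
Proof.
rewrite (_ : (fun z => _) = (fun z : E * E => dotv (z.1 - z.2) (z.1 - z.2) `^ 2^-1)).
  apply: (measurableT_comp (measurable_powR _)); apply: measurable_sum => i.
  have mi : measurable_fun setT (fun z : E * E => (z.1 - z.2) ord0 i).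
    rewrite (_ : (fun z => _) = (fun z : E * E => z.1 ord0 i - z.2 ord0 i)).
      apply: measurable_funB.
        exact: (measurableT_comp (measurable_rV_coord i) (@measurable_fst _ _ _ _)).
      exact: (measurableT_comp (measurable_rV_coord i) (@measurable_snd _ _ _ _)).
    by apply/funext => z; rewrite !mxE.
  exact: measurable_funM.
apply/funext => z; rewrite powR12_sqrt//.
by apply: sumr_ge0 => i _; rewrite -expr2 sqr_ge0.
Qed.

Lemma measurable_kernel_sp : measurable_fun setT (fun z : E * E => k z.1 z.2).
Proof.
under eq_fun do rewrite kernel_spE.
exact: (measurableT_comp (measurable_powR _) measurable_enorm_dist).
Qed.

(** On the diagonal [kernel_sp] is the inverse of 0, that is 0, hence the condition [x <> y]. The
    factor [N] is the crude constant of [enorm_le]. *)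
Lemma kernel_sp_lower x y h : x <> y -> (forall i, `|x ord0 i - y ord0 i| <= h) ->
  (N%:R * h) `^ (- a) <= k x y.
Proof.
move=> xy xyh; have h0 : 0 <= h.
  by apply: le_trans (xyh (Ordinal (leq_trans (isT : (0 < 2)%N) N2))).
have e0 : 0 < enorm (x - y) by apply: enorm_gt0; rewrite subr_eq0; exact/eqP.
have eh : enorm (x - y) <= N%:R * h by apply: enorm_le => // i; rewrite !mxE.
rewrite kernel_spE !powRN lef_pV2 ?posrE ?powR_gt0// ?(lt_le_trans e0)//.
by apply: ge0_ler_powR; rewrite ?nnegrE ?(ltW kernel_order_gt0) ?(ltW e0) ?(le_trans (ltW e0)).
Qed.

(** For a set of measure e, take the cube of edge l = (2e)^(1/N). There the kernel is at least (N l
    / 2)^(-a), and multiplied by e this equals the constant times e^(-theta), because a / N = 1 +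
    theta. *)
Definition kernel_tail_const : R := (N%:R / 2) `^ (- a) * 2 `^ (- (1 + theta)).

Lemma kernel_tail_const_gt0 : 0 < kernel_tail_const.
Proof. by rewrite mulr_gt0// powR_gt0// divr_gt0. Qed.

(* The cube around x of volume twice that of F has at least the volume of F outside F. *)
Lemma kernel_sp_tail (F : set E) x : measurable F -> F x ->
  (0 < leb F)%E -> (leb F < +oo)%E ->
  ((kernel_tail_const * (fine (leb F)) `^ (- theta))%:E <=
    \int[leb]_(y in ~` F) (k x y)%:E)%E.
Proof.
move=> mF Fx F0 Foo; have Ffin : leb F \is a fin_num by rewrite ge0_fin_numE.
set e := fine (leb F); have e0 : 0 < e by rewrite fine_gt0// F0.
pose l := (2 * e) `^ N%:R^-1.
have l0 : 0 < l by rewrite powR_gt0// mulr_gt0.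
pose h := l / 2; have h0 : 0 < h by rewrite divr_gt0.
have muQ : leb (cube x h) = (2 * e)%:E.
  rewrite leb_cube// /h mulrC divfK// -powR_mulrn ?(ltW l0)// /l -powRrM.
  by rewrite mulVf ?gt_eqF// powRr1// mulr_ge0// ltW.
have mQ := measurable_cube x h.
have mQF : measurable (cube x h `\` F) by exact: measurableD.
have muQF : (e%:E <= leb (cube x h `\` F))%E.
  have Qoo : (leb (cube x h) < +oo)%E by rewrite muQ ltry.
  rewrite measureD//.
  have IF : (leb (cube x h `&` F) <= e%:E)%E.
    by rewrite fineK//; apply: le_measure; rewrite ?inE//; exact: measurableI.
  apply: (@le_trans _ _ (leb (cube x h) - e%:E)%E); last exact: leeB.
  by rewrite (muQ : leb (cube x h) = _) -EFinB lee_fin mulr_natl mulr2n addrK.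
have mk : measurable_fun setT (fun y => (k x y)%:E).
  apply/measurable_EFinP.
  exact: (measurableT_comp measurable_kernel_sp (pair1_measurable x)).
have kpos y : setT y -> (0 <= (k x y)%:E)%E by rewrite lee_fin kernel_sp_ge0.
apply: (@le_trans _ _ (\int[leb]_(y in cube x h `\` F) (k x y)%:E)%E); last first.
  apply: ge0_subset_integral => //.
  - exact: measurableC.
  - exact: measurable_funTS.
  - by move=> y _; exact: kpos.
set C := (N%:R * h) `^ (- a).
apply: (@le_trans _ _ (\int[leb]_(y in cube x h `\` F) (cst C%:E y))%E); last first.
  apply: ge0_le_integral => //.
  - by move=> y _; rewrite lee_fin powR_ge0.
  - exact: measurable_funTS.
  move=> y [Qy nFy]; rewrite lee_fin; apply: kernel_sp_lower.
    by move=> xy; apply: nFy; rewrite -xy.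
  by move=> i; apply: ltW; exact: Qy.
rewrite integral_cst//; apply: (@le_trans _ _ (C%:E * e%:E)%E); last first.
  by rewrite lee_wpmul2l// lee_fin powR_ge0.
rewrite -EFinM lee_fin le_eqVlt; apply/orP; left; apply/eqP.
rewrite /kernel_tail_const /C /h (_ : N%:R * (l / 2) = N%:R / 2 * l); last by ring.
have lE : l `^ (- a) = 2 `^ (- (1 + theta)) * e `^ (- (1 + theta)).
  rewrite /l -powRrM mulrN (mulrC N%:R^-1) kernel_order_div.
  by rewrite powRM ?(ltW e0).
have eE : e `^ (- theta) = e `^ (- (1 + theta)) * e.
  have -> : - theta = - (1 + theta) + 1 by ring.
  by rewrite powRD ?(gt_eqF e0) ?implybT// powRr1 ?(ltW e0).
rewrite (powRM (- a) (_ : 0 <= N%:R / 2) (ltW l0)) ?divr_ge0 ?(ltW N0)//.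
by rewrite lE eE; ring.
Qed.

(** In a cube of edge 2h the distances are at most 2Nh, so kernel times volume is at least N^(-a)
    (2h)^(-sp), which is large when h is small. *)
Lemma kernel_sp_cells Om (L D : R) : 0 < L -> Om `<=` cube 0 L -> 0 < D ->
  exists n (Q : 'I_n -> set E),
  [/\ forall i, measurable (Q i), forall i, (0 < leb (Q i) < +oo)%E,
      forall x, Om x -> exists i, Q i x &
      forall i x y, Q i x -> Q i y -> x <> y -> D <= k x y * fine (leb (Q i))].
Proof.
move=> L0 OmL D0.
have Na0 : 0 < N%:R `^ (- a) / D by rewrite divr_gt0// powR_gt0.
(* The edge at which N^(-a) g0^(-sp) equals [D]. *)
pose g0 := (N%:R `^ (- a) / D) `^ (s * p)^-1.
have g00 : 0 < g0 by rewrite powR_gt0.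
pose m := (Num.bound (4 * L / g0)).+1.
have m0 : 0 < m%:R :> R by rewrite ltr0n.
pose h := 2 * L / m%:R; have h0 : 0 < h by rewrite divr_gt0// mulr_gt0.
have hg : 2 * h <= g0.
  rewrite (_ : 2 * h = 4 * L / m%:R); last by rewrite /h; ring.
  rewrite ler_pdivrMr// -ler_pdivrMl// mulrC.
  apply: ltW; apply: (@lt_trans _ _ (Num.bound (4 * L / g0))%:R).
    by apply: archi_boundP; rewrite divr_ge0 ?mulr_ge0 ?ltW.
  by rewrite ltr_nat.
(* Grid points with spacing [h], each the centre of an open cube of half-side [h]. The cubes
   overlap; truncating the coordinates of [x] finds a cube that contains it. *)
pose c (f : {ffun 'I_N -> 'I_m}) : E := \row_i (- L + (f i)%:R * h).
exists #|{ffun 'I_N -> 'I_m}|, (fun j => cube (c (enum_val j)) h); split.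
- by move=> i; exact: measurable_cube.
- by move=> i; rewrite leb_cube// ltry andbT lte_fin exprn_gt0// mulr_gt0.
- move=> x /OmL Lx.
  pose t i := (x ord0 i + L) / h.
  have xL i : - L < x ord0 i < L.
    by have := Lx i; rewrite mxE sub0r normrN ltr_norml.
  have t0 i : 0 <= t i.
    by rewrite divr_ge0 ?(ltW h0)//; have := xL i; lra.
  have tm i : (Num.truncn (t i) < m)%N.
    rewrite Num.Theory.truncn_lt_nat// ltr_pdivrMr// /h mulrC divfK ?gt_eqF//.
    by have := xL i; lra.
  pose f : {ffun 'I_N -> 'I_m} := [ffun i => Ordinal (tm i)].
  exists (enum_rank f) => i; rewrite enum_rankK /c mxE ffunE /=.
  have /andP[H1 H2] := Num.Theory.truncn_itv (t0 i).
  have xE : x ord0 i = - L + t i * h by rewrite divfK ?gt_eqF//; ring.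
  rewrite xE.
  rewrite (_ : _ - _ = - ((t i - (Num.truncn (t i))%:R) * h)); last by ring.
  rewrite normrN normrM (gtr0_norm h0) gtr_pMl// ger0_norm ?subr_ge0//.
  by rewrite ltrBlDl natr1.
move=> j x y Qx Qy xy.
have d i : `|x ord0 i - y ord0 i| <= 2 * h.
  have := Qx i; have := Qy i; set z := c _ ord0 i => H1 H2.
  rewrite (_ : _ - _ = (z - y ord0 i) - (z - x ord0 i)); last by ring.
  by apply: (le_trans (ler_normB _ _)); rewrite mulr_natl mulr2n lerD// ltW.
have hh0 : 0 < 2 * h by rewrite mulr_gt0.
rewrite leb_cube//=; apply: (@le_trans _ _ ((N%:R * (2 * h)) `^ (- a) * (2 * h) ^+ N)); last first.
  by rewrite ler_wpM2r ?exprn_ge0 ?(ltW hh0)//; exact: (kernel_sp_lower xy d).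
rewrite powRM ?(ltW N0) ?(ltW hh0)// -mulrA -powR_mulrn ?(ltW hh0)//.
rewrite -powRD; last by rewrite (gt_eqF hh0) implybT.
have hsp : (2 * h) `^ (s * p) <= N%:R `^ (- a) / D.
  have -> : N%:R `^ (- a) / D = g0 `^ (s * p).
    by rewrite /g0 -powRrM mulVf ?gt_eqF// powRr1// ltW.
  by apply: ge0_ler_powR; rewrite ?nnegrE ?(ltW sp0) ?(ltW hh0) ?(ltW g00).
rewrite (_ : - a + N%:R = - (s * p)); last by rewrite /kernel_order; ring.
rewrite (powRN (2 * h)) ler_pdivlMr ?powR_gt0// mulrC -ler_pdivlMr//.
Qed.

Lemma kernel_sp_low Om (L : R) : 0 < L -> Om `<=` cube 0 L ->
  exists2 kmin, 0 < kmin & forall x y, Om x -> Om y -> x <> y -> kmin <= k x y.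
Proof.
move=> L0 OmL; exists ((N%:R * (2 * L)) `^ (- a)); first by rewrite powR_gt0 ?mulr_gt0.
move=> x y /OmL Lx /OmL Ly xy; apply: kernel_sp_lower => // i.
have := Lx i; have := Ly i; rewrite !mxE !sub0r !normrN => H1 H2.
by apply: (le_trans (ler_normB _ _)); rewrite mulr_natl mulr2n lerD// ltW.
Qed.

End kernel_sp_estimates.

(** * Finite seminorm of Lipschitz functions supported in a cube *)

Lemma integral_le_geometric d (T : measurableType d) (R : realType)
    (mu : {measure set T -> \bar R}) (f : T -> \bar R) (F : nat -> T -> \bar R) (K rho : R) :
  measurable_fun setT f -> (forall x, 0 <= f x)%E ->
  (forall n, measurable_fun setT (F n)) -> (forall n x, 0 <= F n x)%E ->
  (forall x, f x != 0%E -> exists n, f x <= F n x)%E ->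
  0 <= K -> 0 <= rho -> rho < 1 ->
  (forall n, \int[mu]_x F n x <= (K * rho ^+ n)%:E)%E ->
  (\int[mu]_x f x <= (K / (1 - rho))%:E)%E.
Proof.
move=> mf f0 mF F0 fF K0 rho0 rho1 FK.
apply: (@le_trans _ _ (\int[mu]_x (\sum_(0 <= n <oo) F n x))%E).
  apply: ge0_le_integral => //; first exact: ge0_emeasurable_sum.
  move=> x _; have [->|/fF[n fn]] := eqVneq (f x) 0%E; first exact: nneseries_ge0.
  apply: (le_trans fn); apply: (@le_trans _ _ (\sum_(0 <= i < n.+1) F i x)%E); last first.
    by apply: nneseries_lim_ge => i _ _; exact: F0.
  by rewrite big_nat_recr//= leeDr// sume_ge0.
rewrite integral_nneseries//; apply: lime_le.
  by apply: is_cvg_nneseries => n _ _; exact: integral_ge0.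
apply: nearW => n; apply: (@le_trans _ _ (\sum_(0 <= i < n) (K * rho ^+ i)%:E)%E).
  by apply: lee_sum => i _; exact: FK.
by rewrite sumEFin lee_fin -mulr_sumr ler_wpM2l//; exact: geometric_partial_sum_le.
Qed.

Lemma dyadic_scale (R : realType) (t : R) : 1 <= t ->
  exists n : nat, 2 ^+ n <= t <= 2 ^+ n.+1.
Proof.
move=> t1; have ex : exists n, t <= 2 ^+ n.
  exists (Num.bound t); apply: ltW; apply: (lt_trans (archi_boundP (le_trans ler01 t1))).
  by rewrite -natrX ltr_nat ltn_expl.
case: (ex_minnP ex) => -[|n] tn nmin.
  by exists 0%N; rewrite t1 (le_trans tn)// expr0 expr1 ler1n.
exists n; rewrite tn andbT leNgt; apply/negP => /ltW /nmin.
by rewrite ltnn.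
Qed.

Section lipschitz_seminorm.
Context {R : realType} {N : nat}.
Variables s p : R.
Hypotheses (s0 : 0 < s) (s1 : s < 1) (p2 : 2 <= p) (N2 : (2 <= N)%N)
  (psN : p * s < N%:R).
Local Notation E := 'rV[R]_N.
Local Notation leb := (@lebesgue_rV R N).
Local Notation k := (@kernel_sp R N s p).
Local Notation a := (@kernel_order R N s p).
Implicit Types (x y : E) (b : E -> R).

Let p0 : 0 < p. Proof. by move: p2; lra. Qed.

Let a0 : 0 < a. Proof. exact: kernel_order_gt0. Qed.

Let sp0 : 0 < s * p. Proof. exact: mulr_gt0. Qed.

(* Dyadic annuli: near the diagonal they contribute 2^(-n(p - sp)), far from it 2^(-n sp). *)
Lemma integral_lipschitz_kernel b (C : R) : measurable_fun setT b -> 0 < C ->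
  (forall x y, `|b x - b y| <= 1) ->
  (forall x y, `|b x - b y| <= C * enorm (x - y)) ->
  exists G : R, forall x, (\int[leb]_y (`|b x - b y| `^ p * k x y)%:E <= G%:E)%E.
Proof.
move=> mb C0 b1 bC.
pose K : R := C `^ p * 2 `^ a * 4 ^+ N + 8 ^+ N.
pose rho1 : R := 2 `^ (- (p - s * p)); pose rho2 : R := 2 `^ (- (s * p)).
pose rho := Num.max rho1 rho2.
have h0 : 0 < (2 : R)^-1 by rewrite invr_gt0.
have lt1 (e : R) : 0 < e -> 2 `^ (- e) < 1 :> R.
  move=> e0; rewrite /powR pnatr_eq0/= -[ltRHS]expR0 ltr_expR mulNr oppr_lt0.
  by rewrite mulr_gt0// ln_gt0// ltr1n.
have rho_lt1 : rho < 1.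
  rewrite gt_max !lt1//; move: p0 s1 => pp ss; rewrite subr_gt0 -[ltRHS]mul1r.
  by rewrite ltr_pM2r.
have rho0 : 0 <= rho by rewrite le_max powR_ge0.
exists (K / (1 - rho)) => x.
pose q n : R := 2^-1 ^+ n; pose Q n : R := 2 ^+ n.
have q0 n : 0 < q n by rewrite exprn_gt0.
have Q0 n : 0 < Q n by rewrite exprn_gt0.
(* At distances between q/2 and q, the Lipschitz bound gives (C q)^p (q/2)^(-a) on a cube of volume
   (4q)^N, in total C^p 2^a 4^N q^(p - sp). At distances between Q and 2Q, differences at most 1
   give Q^(-a) on a cube of volume (8Q)^N, in total 8^N Q^(-sp). The factors make up [K]. *)
pose c n := C `^ p * q n `^ p * (q n / 2) `^ (- a).
pose c' n := Q n `^ (- a).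
have c0 n : 0 <= c n by rewrite !mulr_ge0 ?powR_ge0.
have c'0 n : 0 <= c' n by rewrite powR_ge0.
pose F n y : \bar R := ((c n)%:E * (\1_(cube x (2 * q n)) y)%:E +
   (c' n)%:E * (\1_(cube x (4 * Q n)) y)%:E)%E.
have mi (h : R) : measurable_fun setT (fun y : E => ((\1_(cube x h) y : R)%:E)).
  by apply/measurable_EFinP/measurable_indic; exact: measurable_cube.
have mk := @measurable_kernel_sp R N s p.
have k0 := @kernel_sp_ge0 R N s p.
have in_cube y (h : R) : enorm (x - y) < h -> cube x h y.
  move=> xyh i; apply: le_lt_trans xyh.
  by have := coord_le_enorm (x - y) i; rewrite !mxE.
apply: (@integral_le_geometric _ _ _ leb _ F) => //.
- exact: (measurable_gag_slice p mk x mb).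
- by move=> y; rewrite lee_fin mulr_ge0 ?powR_ge0.
- by move=> n; apply: emeasurable_funD; exact: measurable_funeM.
- by move=> n y; rewrite adde_ge0// mule_ge0 ?lee_fin.
- move=> y fn0.
  have xy : x - y != 0.
    apply: contra_neq fn0 => /eqP; rewrite subr_eq0 => /eqP <-.
    by rewrite subrr normr0 powR0 ?gt_eqF// mul0r.
  have d0 := enorm_gt0 xy; set dd := enorm (x - y) in d0.
  have [d1|d1] := leP dd 1.
    have [|n /andP[n1 n2]] := @dyadic_scale R dd^-1; first by rewrite invf_ge1.
    have dq : dd <= q n by rewrite /q exprVn -[leLHS]invrK lef_pV2 ?posrE ?invr_gt0 ?exprn_gt0.
    have qd : q n / 2 <= dd.
      rewrite /q -exprSr exprVn -[leRHS]invrK lef_pV2 ?posrE ?invr_gt0 ?exprn_gt0//.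
    exists n; apply: (@le_trans _ _ ((c n)%:E * (\1_(cube x (2 * q n)) y)%:E)%E); last first.
      by rewrite leeDl// mule_ge0 ?lee_fin.
    rewrite indicE mem_set; last first.
      by apply: in_cube; apply: (le_lt_trans dq); rewrite ltr_pMl// ltr1n.
    rewrite mule1 lee_fin /c; apply: ler_pM; rewrite ?powR_ge0 ?k0//.
      rewrite -powRM ?(ltW C0) ?(ltW (q0 n))//; apply: ge0_ler_powR; rewrite ?nnegrE ?(ltW p0)//.
        by rewrite mulr_ge0// ltW.
      by apply: (le_trans (bC x y)); rewrite ler_wpM2l// ltW.
    rewrite kernel_spE !powRN lef_pV2 ?posrE ?powR_gt0// ?divr_gt0//.
    by apply: ge0_ler_powR; rewrite ?nnegrE ?(ltW a0) ?(ltW d0)// ltW// divr_gt0.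
  have [|n /andP[n1 n2]] := @dyadic_scale R dd; first exact: ltW.
  exists n; apply: (@le_trans _ _ ((c' n)%:E * (\1_(cube x (4 * Q n)) y)%:E)%E); last first.
    by rewrite leeDr// mule_ge0 ?lee_fin.
  rewrite indicE mem_set; last first.
    apply: in_cube; apply: (le_lt_trans n2); rewrite exprS ltr_pM2r ?Q0// ltr_nat//.
  rewrite mule1 lee_fin /c' -[leRHS]mul1r; apply: ler_pM; rewrite ?powR_ge0 ?k0//.
    by rewrite powR_le1 ?(ltW p0)// normr_ge0 b1.
  rewrite kernel_spE !powRN lef_pV2 ?posrE ?powR_gt0//.
  by apply: ge0_ler_powR; rewrite ?nnegrE ?(ltW a0) ?(ltW d0)// ltW.
- by rewrite addr_ge0 ?exprn_ge0// !mulr_ge0 ?powR_ge0 ?exprn_ge0.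
move=> n; rewrite ge0_integralD//; last 4 first.
- by move=> y _; rewrite mule_ge0 ?lee_fin.
- exact: measurable_funeM.
- by move=> y _; rewrite mule_ge0 ?lee_fin.
- exact: measurable_funeM.
rewrite !ge0_integralZl// ?lee_fin//.
have cubeI (h : R) : 0 < h -> (\int[leb]_y (\1_(cube x h) y)%:E = ((2 * h) ^+ N)%:E)%E.
  move=> h1; have mQ := measurable_cube x h.
  by rewrite integral_indic// setIT; exact: leb_cube.
rewrite !cubeI ?mulr_gt0// -!EFinM -EFinD lee_fin [leRHS]mulrDl.
have qE : q n = 2 `^ (- n%:R) by rewrite powRN powR_mulrn// /q exprVn.
have rn (e : R) : 2 `^ (- e) <= rho -> q n `^ e <= rho ^+ n.
  move=> er; apply: (@le_trans _ _ ((2 `^ (- e)) ^+ n)); last first.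
    by rewrite lerXn2r// nnegrE powR_ge0.
  rewrite qE -powRrM -(powR_mulrn n (powR_ge0 _ _)) -powRrM.
  by rewrite !mulNr mulrC.
have Qq : Q n = (q n)^-1 by rewrite /q /Q exprVn invrK.
apply: lerD.
  rewrite /c (powRM _ (ltW (q0 n)) (ltW h0)).
  rewrite (_ : 2^-1 `^ (- a) = 2 `^ a); last first.
    by rewrite -[2^-1](powR_inv1)// -powRrM mulN1r opprK.
  rewrite (_ : 2 * (2 * q n) = 4 * q n); last by ring.
  rewrite exprMn -(powR_mulrn _ (ltW (q0 n))).
  rewrite [leLHS](_ : _ = C `^ p * 2 `^ a * 4 ^+ N * (q n `^ p * q n `^ (- a) * q n `^ N%:R)); last by ring.
  rewrite ler_wpM2l ?mulr_ge0 ?powR_ge0 ?exprn_ge0//.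
  rewrite -!powRD ?(gt_eqF (q0 n)) ?implybT//.
  rewrite (_ : p + - a + N%:R = p - s * p); last by rewrite /kernel_order; ring.
  by apply: rn; rewrite le_max lexx.
rewrite [X in _ * X ^+ N <= _](_ : _ = 8 * Q n); last by ring.
rewrite /c' Qq exprMn -powR_inv1 ?(ltW (q0 n))// -(powR_mulrn N (powR_ge0 (q n) (-1))) -!powRrM.
rewrite mulrCA ler_wpM2l ?exprn_ge0// -powRD ?(gt_eqF (q0 n)) ?implybT//.
rewrite !mulN1r opprK (_ : a + - N%:R = s * p); last by rewrite /kernel_order; ring.
by apply: rn; rewrite le_max lexx orbT.
Qed.

(** The integrand vanishes unless one of the two points is in the cube. By symmetry both cases have
    the same integral, at most the uniform bound of [integral_lipschitz_kernel] times the volume of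
    the cube. *)
Lemma gag_lipschitz_lty b (C : R) (x0 : E) (rad : R) : measurable_fun setT b ->
  (forall x, 0 <= b x <= 1) -> 0 < C -> 0 < rad ->
  (forall x y, `|b x - b y| <= C * enorm (x - y)) ->
  (forall x, ~ cube x0 rad x -> b x = 0) -> (gag leb k p b < +oo)%E.
Proof.
move=> mb b01 C0 rad0 bC bQ.
have b1 x y : `|b x - b y| <= 1.
  by have := b01 x; have := b01 y; rewrite ler_norml => ? ?; lra.
have [G bG] := integral_lipschitz_kernel mb C0 b1 bC.
set Q := cube x0 rad in bQ; have mQ : measurable Q by exact: measurable_cube.
have mk := @measurable_kernel_sp R N s p.
have k0 := @kernel_sp_ge0 R N s p.
pose h z : \bar R := (`|b z.1 - b z.2| `^ p * k z.1 z.2)%:E.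
have mh : measurable_fun setT h by exact: (measurable_gag_integrand p mk mb).
have h0 z : (0 <= h z)%E by rewrite lee_fin mulr_ge0 ?powR_ge0.
have hC x y : h (x, y) = h (y, x) by rewrite /h/= distrC kernel_spC.
pose f1 (z : E * E) : \bar R := ((\1_Q z.1)%:E * h z)%E.
pose f2 (z : E * E) : \bar R := ((\1_Q z.2)%:E * h z)%E.
have i0 x : (0 <= (\1_Q x : R)%:E)%E by rewrite lee_fin.
have mi : measurable_fun setT (fun x => (\1_Q x : R)%:E).
  by apply/measurable_EFinP/measurable_indic.
have mf1 : measurable_fun setT f1.
  by apply: emeasurable_funM => //; exact: (measurableT_comp mi (@measurable_fst _ _ _ _)).
have mf2 : measurable_fun setT f2.
  by apply: emeasurable_funM => //; exact: (measurableT_comp mi (@measurable_snd _ _ _ _)).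
have f10 z : (0 <= f1 z)%E by rewrite mule_ge0.
have f20 z : (0 <= f2 z)%E by rewrite mule_ge0.
have mhx x : measurable_fun setT (fun y => h (x, y)).
  exact: (measurableT_comp mh (pair1_measurable x)).
have GQ : (\int[leb]_x ((\1_Q x)%:E * \int[leb]_y h (x, y)) < +oo)%E.
  apply: (@le_lt_trans _ _ (\int[leb]_x ((\1_Q x)%:E * G%:E))%E).
    apply: ge0_le_integral => //.
    - by move=> x _; rewrite mule_ge0// integral_ge0.
    - apply: emeasurable_funM => //.
      exact: (measurable_fun_fubini_tonelli_F _ mh h0).
    - by apply: emeasurable_funM.
    - by move=> x _; rewrite lee_wpmul2l//; exact: bG.
  under eq_integral do rewrite muleC.
  have G0 : 0 <= G by rewrite -lee_fin; apply: le_trans (bG x0); apply: integral_ge0 => y _; exact: (h0 (x0, y)).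
  rewrite ge0_integralZl ?lee_fin//.
  have -> : (\int[leb]_x (\1_Q x)%:E = ((2 * rad) ^+ N)%:E)%E.
    by rewrite integral_indic// setIT; exact: leb_cube.
  by rewrite -EFinM ltry.
have I : (\int[leb]_x \int[leb]_y f1 (x, y) < +oo)%E.
  rewrite (eq_integral (fun x => (\1_Q x)%:E * \int[leb]_y h (x, y))%E)// => x _.
  exact: (ge0_integralZl leb measurableT (mhx x) (fun y _ => h0 (x, y)) (i0 x)).
have I1 : (\int[leb \x leb]_z f1 z < +oo)%E.
  by rewrite (fubini_tonelli1 _ mf1 f10).
have f21 x y : f1 (y, x) = f2 (x, y) by rewrite /f2 /f1 hC.
have I2 : (\int[leb \x leb]_z f2 z < +oo)%E.
  rewrite (fubini_tonelli2 _ mf2 f20).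
  suff <- : (\int[leb]_x \int[leb]_y f1 (x, y) = \int[leb]_y fubini_G leb f2 y)%E by [].
  apply: eq_integral => y _; apply: eq_integral => x _; exact: f21.
rewrite gagE /wint.
apply: (@le_lt_trans _ _ (\int[leb \x leb]_z (f1 z + f2 z))%E); last first.
  by rewrite ge0_integralD// lte_add_pinfty.
apply: ge0_le_integral => //.
- by move=> z _; exact: h0.
- exact: emeasurable_funD.
move=> [x y] _; rewrite -[leLHS]/(h (x, y)) /f1 /f2 !indicE.
have [Qx|nQx] := pselect (Q x).
  by rewrite (mem_set Qx) mul1e leeDl// mule_ge0// lee_fin.
have [Qy|nQy] := pselect (Q y).
  by rewrite (mem_set Qy) mul1e leeDr// mule_ge0// lee_fin.
rewrite /h/= !bQ// subrr normr0 powR0 ?gt_eqF// mul0r !mule0 adde0//.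
Qed.

End lipschitz_seminorm.

Section tents.
Context {R : realType} {N : nat}.
Local Notation E := 'rV[R]_N.
Local Notation leb := (@lebesgue_rV R N).
Implicit Types (x y c : E) (rho : R).

Definition tent c rho x : R :=
  Num.max 0 (1 - (\sum_(i < N) `|x ord0 i - c ord0 i|) / rho).

Lemma measurable_tent c rho : measurable_fun setT (tent c rho).
Proof.
apply: measurable_maxr => //; apply: measurable_funB => //.
apply: measurable_funM => //; apply: measurable_sum => i.
apply: measurableT_comp => //; apply: measurable_funB => //.
exact: measurable_rV_coord.
Qed.

Lemma tent_ge0_le1 c rho x : 0 < rho -> 0 <= tent c rho x <= 1.
Proof.
move=> rho0; rewrite /tent le_max lexx/= ge_max ler01/= gerBl.
by rewrite divr_ge0 ?(ltW rho0)// sumr_ge0.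
Qed.

Lemma tent_gt0 c rho x : 0 < rho ->
  \sum_(i < N) `|x ord0 i - c ord0 i| < rho -> 0 < tent c rho x.
Proof. by move=> rho0 H; rewrite lt_max subr_gt0 ltr_pdivrMr// mul1r H orbT. Qed.

Lemma tent_off_cube c rho x : 0 < rho -> ~ cube c rho x -> tent c rho x = 0.
Proof.
move=> rho0 /existsNP[i /negP]; rewrite -leNgt distrC => H.
apply/max_idPl; rewrite subr_le0 ler_pdivlMr// mul1r; apply: (le_trans H).
by rewrite (bigD1 i)//= lerDl sumr_ge0.
Qed.

Lemma tent_lipschitz c rho x y : 0 < rho ->
  `|tent c rho x - tent c rho y| <= N%:R / rho * enorm (x - y).
Proof.
move=> rho0; have maxr_lip (a b : R) : `|Num.max 0 a - Num.max 0 b| <= `|a - b|.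
  rewrite /Num.max; have := ler_norm (a - b); have := ler_norm (- (a - b)).
  by rewrite normrN; case: ifP => ?; case: ifP => ?; rewrite ler_norml; lra.
apply: (le_trans (maxr_lip _ _)).
set Sx := \sum_(i < N) _; set Sy := \sum_(i < N) _.
rewrite (_ : 1 - Sx / rho - (1 - Sy / rho) = (Sy - Sx) / rho); last by ring.
rewrite normrM (gtr0_norm (_ : 0 < rho^-1)) ?invr_gt0//.
rewrite mulrAC ler_wpM2r ?invr_ge0 ?(ltW rho0)// /Sx /Sy -sumrB.
apply: (le_trans (ler_norm_sum _ _ _)).
apply: (@le_trans _ _ (\sum_(i < N) enorm (x - y))); last first.
  by rewrite sumr_const card_ord mulr_natl.
apply: ler_sum => i _; apply: (le_trans (ler_dist_dist _ _)).
rewrite (_ : _ - _ = y ord0 i - x ord0 i); last by ring.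
by rewrite distrC; have := coord_le_enorm (x - y) i; rewrite !mxE.
Qed.

(** Codes of cubes that leave [U] get the zero function, so the family is a sequence indexed by all
    natural numbers. *)
Definition bump (U : set E) (n : nat) x : R :=
  if pselect (cube (code_center n) (@code_radius R N n) `<=` U)
  then tent (code_center n) (@code_radius R N n) x else 0.

Lemma bump_ge0_le1 U n x : 0 <= bump U n x <= 1.
Proof.
by rewrite /bump; case: pselect => ?; rewrite ?tent_ge0_le1 ?code_radius_gt0// lexx ler01.
Qed.

Lemma bump_off U n x : ~ U x -> bump U n x = 0.
Proof.
rewrite /bump; case: pselect => // sU nU.
by rewrite tent_off_cube ?code_radius_gt0// => /sU.
Qed.

Lemma bump_cover U x : open U -> U x -> exists n, 0 < bump U n x.
Proof.
move=> oU Ux; have [n [nU xn]] := code_dense oU Ux; exists n.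
by rewrite /bump; case: pselect => // ?; rewrite tent_gt0// code_radius_gt0.
Qed.

Lemma bump_admissible (s p : R) U n : 0 < s -> s < 1 -> 2 <= p -> (2 <= N)%N ->
  p * s < N%:R -> admissible leb (@kernel_sp R N s p) p U (bump U n).
Proof.
move=> s0 s1 p2 N2 psN; have rad0 := @code_radius_gt0 R N n.
have mb : measurable_fun setT (bump U n).
  rewrite /bump; case: pselect => ?; last exact: measurable_cst.
  exact: measurable_tent.
split => //; last by apply: aeW => x; exact: bump_off.
have N0 : 0 < N%:R :> R by rewrite ltr0n (leq_trans _ N2).
apply: (@gag_lipschitz_lty R N s p s0 s1 p2 N2 _ (N%:R / @code_radius R N n)
  (code_center n) (@code_radius R N n) mb) => //.
- exact: bump_ge0_le1.
- by rewrite divr_gt0.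
- move=> x y; rewrite /bump; case: pselect => ?; first exact: tent_lipschitz.
  by rewrite subrr normr0 mulr_ge0 ?enorm_ge0// divr_ge0// ltW.
by move=> x nx; rewrite /bump; case: pselect => // ?; exact: tent_off_cube.
Qed.

End tents.

(** * Weak solutions *)

Section product_null_sets.
Context d (T : measurableType d) (R : realType).
Variable mu : {sigma_finite_measure set T -> \bar R}.

Lemma ae_prod (P : T -> Prop) : {ae mu, forall x, P x} ->
  {ae (mu \x mu)%E, forall z, P z.1 /\ P z.2}.
Proof.
move=> [A [mA A0 PA]]; exists ((A `*` setT) `|` (setT `*` A)); split.
- by apply: measurableU; exact: measurableX.
- apply/eqP; rewrite eq_le measure_ge0 andbT.
  have m1 : measurable (A `*` [set: T]) by exact: measurableX.
  have m2 : measurable ([set: T] `*` A) by exact: measurableX.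
  apply: (le_trans (measureU2 _ m1 m2)).
  have e1 : (mu \x mu)%E (A `*` [set: T]) = 0%E.
    rewrite product_measure1E//.
    by transitivity (0%E * mu setT)%E; [congr (_ * _)%E; exact: A0|exact: mul0e].
  have e2 : (mu \x mu)%E ([set: T] `*` A) = 0%E.
    rewrite product_measure1E//.
    by transitivity (mu setT * 0%E)%E; [congr (_ * _)%E; exact: A0|exact: mule0].
  rewrite -[leRHS]adde0; apply: leeD; rewrite le_eqVlt; apply/orP; left; apply/eqP.
    exact: e1.
  exact: e2.
- move=> [x y] /= /not_andP[nP|nP]; [left|right]; split => //=; exact: PA.
Qed.

Lemma gag_pairing_ae_eq (k : T -> T -> R) (p : R) (Om : set T) (w w' v : T -> R) :
  (forall x y, 0 <= k x y) -> measurable_fun setT (fun z : T * T => k z.1 z.2) ->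
  2 <= p -> admissible mu k p Om w -> admissible mu k p Om w' ->
  admissible mu k p Om v -> {ae mu, forall x, w x = w' x} ->
  gag_pairing mu k p w v = gag_pairing mu k p w' v.
Proof.
move=> k0 mk p2 aw aw' av ww'; apply: ae_eq_integral => //.
- exact: measurable_int (gag_pairing_integrable k0 mk p2 aw av).
- exact: measurable_int (gag_pairing_integrable k0 mk p2 aw' av).
by apply: filterS (ae_prod ww') => z [-> ->].
Qed.

End product_null_sets.

Section weak_solutions.
Context {R : realType} {N : nat}.
Variables s p r : R.
Hypotheses (s0 : 0 < s) (s1 : s < 1) (p2 : 2 <= p) (N2 : (2 <= N)%N)
  (psN : p * s < N%:R).
Hypotheses (pr : p - 1 < r) (rcrit : r < crit_exp N s p - 1).
Variable Om : set 'rV[R]_N.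
Hypotheses (oOm : open Om) (bOm : bounded_set Om).
Local Notation E := 'rV[R]_N.
Local Notation leb := (@lebesgue_rV R N).
Local Notation k := (@kernel_sp R N s p).
Local Notation theta := (@kernel_theta R N s p).
Local Notation adm := (admissible leb k p Om).
Implicit Types (u v w : E -> R).

Let p0 : 0 < p. Proof. by move: p2; lra. Qed.

Let k0 x y : 0 <= k x y. Proof. exact: kernel_sp_ge0. Qed.

Let mk : measurable_fun setT (fun z : E * E => k z.1 z.2).
Proof. exact: measurable_kernel_sp. Qed.

Let mOm : measurable Om. Proof. exact: open_measurable_rV. Qed.

Let Omoo : (leb Om < +oo)%E.
Proof.
have [L L0 OmL] := bounded_cube bOm.
have mL := measurable_cube (0 : E) L.
apply: (@le_lt_trans _ _ (leb (cube 0 L))); first by apply: le_measure; rewrite ?inE.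
by rewrite leb_cube// ltry.
Qed.

Let theta0 : 0 < theta. Proof. exact: kernel_theta_gt0. Qed.

Let theta1 : theta < 1. Proof. exact: kernel_theta_lt1. Qed.

Lemma crit_exp_sobolev : crit_exp N s p = sobolev_exp p theta.
Proof.
rewrite /crit_exp /sobolev_exp /kernel_theta.
have N0 : N%:R != 0 :> R by rewrite pnatr_eq0 -lt0n (leq_trans _ N2).
have D0 : N%:R - p * s != 0 by rewrite gt_eqF// subr_gt0.
by field; rewrite N0 D0.
Qed.

Let rsob : r + 1 < sobolev_exp p theta.
Proof. by move: rcrit; rewrite crit_exp_sobolev; lra. Qed.

Let c0 : 0 < @kernel_tail_const R N s p.
Proof. exact: kernel_tail_const_gt0. Qed.

Let ktail (F : set E) (x : E) : measurable F -> F x -> (0 < leb F)%E -> (leb F < +oo)%E ->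
  ((@kernel_tail_const R N s p * fine (leb F) `^ (- theta))%:E <=
    \int[leb]_(y in ~` F) (k x y)%:E)%E.
Proof. exact: kernel_sp_tail. Qed.

Let adm_mass q u : 0 < q -> q < sobolev_exp p theta -> adm u -> (mass leb q u < +oo)%E.
Proof. exact: (adm_mass_lty k0 mk p2 c0 theta0 theta1 ktail mOm Omoo). Qed.

Lemma gag_kernel_sp u : gag leb k p u =
  (\int[leb \x leb]_z (`|u z.1 - u z.2| `^ p * k z.1 z.2)%:E)%E.
Proof. by rewrite gagE. Qed.

(** The only condition of [Wsp] missing from [admissible] is the integrability of |u|^p, which the
    embedding provides since p < r + 1 < [sobolev_exp p theta]. *)
Lemma Wsp0_admissible u : Wsp0 s p Om u <-> adm u.
Proof.
split => [[[/andP[mu_ _] gu] uO]|[mu_ gu uO]].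
  split => //; last by rewrite gag_kernel_sp.
  by move: mu_; rewrite inE.
split => //; split; last by rewrite -gag_kernel_sp.
rewrite inE; apply/andP; split; rewrite inE//=.
rewrite /finite_norm unlock; apply: poweR_lty.
have := @adm_mass p u p0 _ (And3 mu_ gu uO).
by rewrite massE; apply; move: rsob pr; lra.
Qed.

Let integrable_v v : adm v -> leb.-integrable setT (fun x => (v x)%:E).
Proof.
move=> av; have [mv _ _] := av; apply: (integrable_mass1 mv).
by apply: adm_mass => //; move: rsob pr p2; lra.
Qed.

Lemma integral_test v (f : E -> R) : adm v -> leb.-integrable setT (fun x => (f x * v x)%:E) ->
  (\int[leb]_(x in Om) (f x * v x)%:E = \int[leb]_x (f x * v x)%:E)%E.
Proof.
move=> [_ _ vO] If; rewrite integral_mkcond; apply: ae_eq_integral => //.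
- by apply/(measurable_restrictT _ mOm); apply: measurable_funTS; exact: measurable_int If.
- exact: measurable_int If.
apply: filterS vO => x vx _; rewrite patchE; case: ifPn => // /negP; rewrite inE => /vx ->.
by rewrite mulr0.
Qed.

(** Multiplying L w = w^r - eps by lam^(p - 1) gives L (lam w) = mu lam^r w^r - mu, by the two
    relations between [lam], [mu] and [eps]. *)
Lemma weak_solution_rescaled w (eps lam mu : R) : adm w -> (forall x, 0 <= w x) ->
  (forall v, adm v -> fine (gag_pairing leb k p w v) +
     eps * fine (\int[leb]_x (v x)%:E)%E = fine (mass_pairing leb r w v)) ->
  0 < lam -> lam `^ (p - 1) = mu * lam `^ r -> lam `^ (p - 1) * eps = mu ->
  weak_solution s p (fun _ t => mu * (t `^ r - 1)) Om (fun x => lam * w x).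
Proof.
move=> aw w0 wE lam0 lamr lame; have [mw gw wO] := aw.
have r0 : r != 0 by rewrite gt_eqF//; move: pr p2; lra.
split.
  apply/Wsp0_admissible; exact: admZ.
move=> v /Wsp0_admissible av; have [mv _ _] := av.
have Iv := integrable_v av.
have IM : leb.-integrable setT (fun x => (`|w x| `^ (r + 1 - 2) * w x * v x)%:E).
  exact: (mass_pairing_integrable k0 mk p2 pr c0 theta0 theta1 rsob ktail mOm Omoo aw av).
have IG := gag_pairing_integrable k0 mk p2 aw av.
have hE x : (mu * ((lam * w x) `^ r - 1) * v x)%:E =
    ((lam `^ (p - 1))%:E * (`|w x| `^ (r + 1 - 2) * w x * v x)%:E - mu%:E * (v x)%:E)%E.
  rewrite -!EFinM -EFinB; congr EFin; rewrite powRM ?(ltW lam0)// lamr.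
  have -> : `|w x| `^ (r + 1 - 2) * w x = w x `^ r.
    rewrite ger0_norm//; have [->|wx] := eqVneq (w x) 0; first by rewrite mulr0 powR0.
    rewrite -{2}(powRr1 (w0 x)) -powRD ?wx ?implybT//; congr powR; ring.
  ring.
have I : leb.-integrable setT (fun x => (mu * ((lam * w x) `^ r - 1) * v x)%:E).
  under eq_fun do rewrite hE.
  by apply: integrableB => //; exact: integrableZl.
split; first exact: (integrableS measurableT).
rewrite integral_test//; under [RHS]eq_integral do rewrite hE.
rewrite integralB//; try exact: integrableZl.
rewrite !integralZl//.
have GE (z : E * E) : (`|lam * w z.1 - lam * w z.2| `^ (p - 2) * (lam * w z.1 - lam * w z.2) *
    (v z.1 - v z.2) * k z.1 z.2)%:E = ((lam `^ (p - 1))%:E *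
    (`|w z.1 - w z.2| `^ (p - 2) * (w z.1 - w z.2) * (v z.1 - v z.2) * k z.1 z.2)%:E)%E.
  rewrite -EFinM; congr EFin; rewrite -mulrBr normrM (gtr0_norm lam0) powRM ?(ltW lam0)//.
  have -> : lam `^ (p - 1) = lam `^ (p - 2) * lam.
    rewrite -{3}(powRr1 (ltW lam0)) -powRD ?(gt_eqF lam0) ?implybT//; congr powR; ring.
  ring.
rewrite (eq_integral _ _ (fun z _ => GE z)) integralZl//.
rewrite -[X in (_ * X)%E](fineK (integrable_fin_num _ IG))//.
rewrite -[X in (_ * X - _)%E](fineK (integrable_fin_num _ IM))//.
rewrite -[X in (_ - _ * X)%E](fineK (integrable_fin_num _ Iv))//.
rewrite -!EFinM -EFinB; congr EFin.
have := wE v av; rewrite /gag_pairing /mass_pairing => <-.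
by rewrite mulrDr mulrA lame addrK.
Qed.

(** Adding 1 on the null set where [w] vanishes inside [Om] makes positivity hold at every point
    there; no integral changes. *)
Lemma positive_representative w eps : adm w -> (forall x, 0 <= w x) ->
  {ae leb, forall x, Om x -> 0 < w x} ->
  (forall v, adm v -> fine (gag_pairing leb k p w v) +
     eps * fine (\int[leb]_x (v x)%:E)%E = fine (mass_pairing leb r w v)) ->
  exists w', [/\ adm w', forall x, 0 <= w' x, forall x, Om x -> 0 < w' x &
  forall v, adm v -> fine (gag_pairing leb k p w' v) +
     eps * fine (\int[leb]_x (v x)%:E)%E = fine (mass_pairing leb r w' v)].
Proof.
move=> aw w0 wpos wE; have [mw gw wO] := aw.
pose Z := Om `&` w @^-1` [set 0].
have mZ : measurable Z.
  apply: measurableI => //; rewrite -[X in measurable X]setTI; exact: mw.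
pose w' x := w x + \1_Z x.
have mw' : measurable_fun setT w' by apply: measurable_funD => //; exact: measurable_indic.
have ww' : {ae leb, forall x, w x = w' x}.
  apply: filterS wpos => x wx; rewrite /w' indicE memNset ?addr0// => -[/wx] /[swap].
  by rewrite /= => ->; rewrite ltxx.
have aw' : adm w'.
  split => //; first by rewrite -(gag_ae_eq p k0 mk mw mw' ww').
  by apply: filterS2 wO ww' => x wx <-.
exists w'; split => //.
- by move=> x; rewrite addr_ge0.
- move=> x Ox; rewrite /w' indicE; have [wx|wx] := eqVneq (w x) 0.
    by rewrite mem_set// wx add0r.
  by rewrite ltr_pwDl// lt_neqAle eq_sym wx w0.
move=> v av; rewrite -(gag_pairing_ae_eq k0 mk p2 aw aw' av ww') wE//; congr fine.
have IM u : adm u -> measurable_fun setT (fun x => (`|u x| `^ (r + 1 - 2) * u x * v x)%:E).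
  move=> au; exact: measurable_int
    (mass_pairing_integrable k0 mk p2 pr c0 theta0 theta1 rsob ktail mOm Omoo au av).
apply: ae_eq_integral => //; [exact: IM|exact: IM|].
by apply: filterS ww' => x ->.
Qed.

Lemma exists_positive_weak_solution : Om !=set0 ->
  exists2 mu0 : R, 0 < mu0 & forall mu, 0 < mu < mu0 -> exists u,
    weak_solution s p (fun _ t => mu * (t `^ r - 1)) Om u /\ forall x, Om x -> 0 < u x.
Proof.
move=> [x0 Ox0]; have [L L0 OmL] := bounded_cube bOm.
have [kmin kmin0 klow] := kernel_sp_low s0 p2 N2 L0 OmL.
have Om0 : (0 < leb Om)%E.
  have [h h0 hO] := open_cube oOm Ox0; have mh := measurable_cube x0 h.
  apply: (@lt_le_trans _ _ (leb (cube x0 h))); last by apply: le_measure; rewrite ?inE.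
  by rewrite leb_cube// lte_fin exprn_gt0// mulr_gt0.
have [eps0 eps00 sol] := positive_solution k0 mk p2 pr c0 theta0 theta1 rsob ktail mOm Omoo
  (fun D D0 => kernel_sp_cells s0 p2 N2 L0 OmL D0) kmin0 klow
  (fun n => bump_admissible Om n s0 s1 p2 N2 psN) (bump_ge0_le1 Om) (@bump_off _ _ Om)
  (fun x => bump_cover oOm) Om0.
have e0 : 0 < r - (p - 1) by rewrite subr_gt0.
have r0 : 0 < r by move: pr p2; lra.
pose e := r - (p - 1).
exists (eps0 `^ (e / r)); first exact: powR_gt0.
move=> mu /andP[mu_gt0 mu_lt].
(* [lam] solves lam^(p - 1) = mu lam^r, and then eps = mu lam^(1 - p). The bound on [mu] is the
   value for which [eps] reaches [eps0]. *)
pose eps := mu `^ (r / e); pose lam := mu `^ (- e^-1).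
have eps_lt : eps < eps0.
  have -> : eps0 = eps0 `^ (e / r) `^ (r / e).
    rewrite -powRrM (_ : e / r * (r / e) = 1) ?powRr1 ?(ltW eps00)//.
    by field; rewrite !gt_eqF.
  by apply: gt0_ltr_powR; rewrite ?nnegrE ?divr_gt0 ?powR_ge0 ?(ltW mu_gt0).
have [|w [aw w0 wpos wE]] := sol eps; first by rewrite powR_ge0.
have [w' [aw' w'0 w'pos w'E]] := positive_representative aw w0 wpos wE.
have lam0 : 0 < lam by exact: powR_gt0.
have mu_e : e != 0 by rewrite gt_eqF.
exists (fun x => lam * w' x); split; last by move=> x Ox; rewrite mulr_gt0// w'pos.
apply: (weak_solution_rescaled aw' w'0 w'E lam0).
- rewrite /lam -!powRrM -{2}(powRr1 (ltW mu_gt0)) -powRD ?(gt_eqF mu_gt0) ?implybT//.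
  by congr powR; rewrite /e; field; rewrite -/e.
- rewrite /lam /eps -!powRrM -powRD ?(gt_eqF mu_gt0) ?implybT//.
  rewrite -[RHS](powRr1 (ltW mu_gt0)).
  by congr powR; rewrite /e; field; rewrite -/e.
Qed.

End weak_solutions.

Theorem theorem1p1 (R : realType) (N : nat) (s p r : R)
    (Omega : set 'rV[R]_N) :
  0 < s < 1 -> 2 <= p -> (2 <= N)%N -> p * s < N%:R ->
  bounded_set Omega -> @convex_set R 'rV[R]_N Omega -> open Omega ->
  C2_boundary Omega ->
  p - 1 < r < crit_exp N s p - 1 ->
  nonexistence N s p ->
  exists mu0 : R, 0 < mu0 /\
    forall mu : R, 0 < mu < mu0 ->
      exists u : 'rV[R]_N -> R,
        weak_solution s p (fun _ t => mu * (t `^ r - 1)) Omega u /\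
        (forall x, Omega x -> 0 < u x).
Proof.
move=> /andP[s0 s1] p2 N2 psN bO _ oO _ /andP[pr rcrit] _.
have [Om0|/set0P Om0] := eqVneq Omega set0; last first.
  have [mu0 mu00 sol] := exists_positive_weak_solution s0 s1 p2 N2 psN pr rcrit oO bO Om0.
  by exists mu0.
(* An empty [Omega] is allowed: the zero function then solves the problem for every [mu], and
   positivity is vacuous. *)
exists 1; split => // mu _; exists (fun=> 0); split; last by rewrite Om0.
split.
  apply/(Wsp0_admissible s0 p2 N2 psN pr rcrit oO bO); split => //.
  - rewrite gagE /wint integral0_eq ?ltry// => z _.
    by rewrite subrr normr0 powR0 ?mul0r// gt_eqF// (lt_le_trans _ p2).
  - exact: aeW.
move=> v _; rewrite Om0 integral_set0; split; first exact: integrable_set0.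
by rewrite integral0_eq// => z _; rewrite subrr mulr0 !mul0r.
Qed.
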